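(* Let $0\le m\le n$ be integers and let $\lambda,\mu$ be partitions with $l(\lambda)\le m$ and $l(\mu)\le n$. Then $$\sum_{\nu,\omega}t^{n(\nu)-|\omega|}f^{\lambda}_{\omega\nu}(q,t)\,u^{(n-m)}_0(P_{\mu/\omega})\,\frac{(qt^{m-n-1};q,t)_\nu}{c'_\nu(q,t)} =t^{n(\lambda)-m|\mu|}\,u^{(n)}_0(P_\mu)\,\frac{(qt^{m-1};q,t)_\lambda}{c'_\lambda(q,t)}\prod_{i=1}^m\prod_{j=1}^n\frac{(qt^{j-i+m-n-1};q)_{\lambda_i-\mu_j}}{(qt^{j-i+m-n};q)_{\lambda_i-\mu_j}},$$ the sum being over all partitions $\nu,\omega$ (only finitely many terms are nonzero).
   Context: $q,t$ are indeterminates. For a partition $\lambda$: $l(\lambda)$ is its number of nonzero parts, $|\lambda|$ the sum of its parts, $\lambda'$ the conjugate, $n(\lambda)=\sum_{i\ge1}(i-1)\lambda_i$. For a square $s=(i,j)$ of the diagram of $\lambda$, $a(s)=\lambda_i-j$ and $l(s)=\lambda'_j-i$; $c'_\lambda(q,t)=\prod_{s\in\lambda}(1-q^{a(s)+1}t^{l(s)})$. For integers $N\ge0$, $(b;q)_N=\prod_{k=0}^{N-1}(1-bq^k)$ and $(b;q)_{-N}=1/(bq^{-N};q)_N$. For a partition $\lambda$, $(b;q,t)_\lambda=\prod_{i\ge1}(bt^{1-i};q)_{\lambda_i}$. $P_\lambda(x;q,t)$ denotes the Macdonald polynomial (symmetric function). The $q,t$-Littlewood–Richardson coefficients are defined by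 $P_\mu P_\nu=\sum_\lambda f^\lambda_{\mu\nu}(q,t)P_\lambda$, and skew Macdonald polynomials by $P_\lambda(x,y;q,t)=\sum_\mu P_{\lambda/\mu}(x;q,t)P_\mu(y;q,t)$ (equivalently $P_{\lambda/\mu}=\sum_\nu f^\lambda_{\mu\nu}P_\nu$). For a symmetric function $f$ and integer $N\ge0$, $u^{(N)}_0(f)=f(t^{N-1},t^{N-2},\dots,t,1)$ (evaluation at $N$ variables); for $N=0$ this is evaluation at the empty alphabet, so $u^{(0)}_0(P_{\mu/\omega})=\delta_{\mu\omega}$. *)

(* Defs.v *)
(* Macdonald polynomials over K = Q(q,t), modelled in the
   power-sum basis:  Lambda_K = K[p_1,p_2,...].  A symmetric function is
   represented by its coefficient function  c : seq nat -> K,  c rho being the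
   coefficient of p_rho (rho a partition, written as a weakly decreasing
   sequence of positive integers). *)
From Stdlib Require Import ClassicalEpsilon.
From HB Require Import structures.
From mathcomp Require Import all_boot all_order all_algebra.
Set Implicit Arguments. Unset Strict Implicit. Unset Printing Implicit Defensive.
Import Order.TTheory GRing.Theory Num.Theory.
Local Open Scope ring_scope.

Definition Rqt : idomainType := {poly {poly rat}}.
Definition K : fieldType := {fraction Rqt}.
Definition tt_ : K := tofrac (('X : {poly rat})%:P : Rqt).
Definition qq : K := tofrac ('X : Rqt).

Definition is_part (s : seq nat) : bool :=
  sorted geq s && all (fun x => 0 < x)%N s.

Fixpoint seqs (l b : nat) : seq (seq nat) :=
  if l is l'.+1 then [::] :: [seq x :: s | x <- iota 1 b, s <- seqs l' b]
  else [:: [::]].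

Definition parts (d : nat) : seq (seq nat) :=
  [seq s <- seqs d d | is_part s & sumn s == d].

Definition nfun (la : seq nat) : nat := (\sum_(i < size la) i * nth 0 la i)%N.

Definition conjp (la : seq nat) (j : nat) : nat := count (fun x => j < x)%N la.

Definition dominated (mu la : seq nat) : bool :=
  (sumn mu == sumn la) &&
  [forall k : 'I_(sumn la).+1, sumn (take k mu) <= sumn (take k la)]%N.

Definition qpoch (b x : K) (N : int) : K :=
  match N with
  | Posz n => \prod_(k < n) (1 - b * x ^+ k)
  | Negz n => (\prod_(k < n.+1) (1 - b * x ^ (- (n.+1)%:Z) * x ^+ k))^-1
  end.

Definition qtpoch (b : K) (la : seq nat) : K :=
  \prod_(i < size la) qpoch (b * tt_ ^ (- (i%:Z))) qq (nth 0 la i)%:Z.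

(* c'_lambda(q,t) = prod_{s in lambda} (1 - q^{a(s)+1} t^{l(s)}) *)
Definition cprime (la : seq nat) : K :=
  \prod_(i < size la) \prod_(j < nth 0 la i)
     (1 - qq ^+ ((nth 0 la i - j.+1).+1) * tt_ ^+ (conjp la j - i.+1)).

(* R_{rho,la} = coefficient of x^la in p_rho  (so p_rho = sum_la R m_la) *)
Definition Rpm (rho la : seq nat) : nat :=
  #|[set f : {ffun 'I_(size rho) -> 'I_(size la)} |
     [forall j : 'I_(size la),
        (\sum_(i | f i == j) nth 0 rho i)%N == nth 0 la j]]|.

Definition mcoef (c : seq nat -> K) (mu : seq nat) : K :=
  \sum_(rho <- parts (sumn mu)) c rho * (Rpm rho mu)%:R.

Definition zfac (rho : seq nat) : nat :=
  (\prod_(i <- undup rho) (i ^ count_mem i rho * (count_mem i rho)`!))%N.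
Definition zqt (rho : seq nat) : K :=
  (zfac rho)%:R * \prod_(r <- rho) ((1 - qq ^+ r) / (1 - tt_ ^+ r)).

Definition spqt (d : nat) (c c' : seq nat -> K) : K :=
  \sum_(rho <- parts d) c rho * c' rho * zqt rho.

(* Macdonald's defining properties (Macdonald, SF&HP, VI (4.7)):
   P_la = m_la + sum_{mu < la} u_{la mu} m_mu, and <P_la, P_mu>_{q,t} = 0
   for la <> mu. *)
Definition isMacFamily (P : seq nat -> seq nat -> K) : Prop :=
  forall la, is_part la ->
    (forall rho, rho \notin parts (sumn la) -> P la rho = 0) /\
    (forall mu, is_part mu ->
       (mu = la -> mcoef (P la) mu = 1) /\
       (~~ dominated mu la -> mcoef (P la) mu = 0)) /\
    (forall mu, is_part mu -> mu != la -> spqt (sumn la) (P la) (P mu) = 0).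

Definition MacP : seq nat -> seq nat -> K :=
  epsilon (inhabits (fun _ _ => 0)) isMacFamily.

(* product of a degree d1 element and a degree d2 element: p_al p_be = p_(al u be) *)
Definition pmul (d1 d2 : nat) (c c' : seq nat -> K) (rho : seq nat) : K :=
  \sum_(al <- parts d1) \sum_(be <- parts d2)
     (sort geq (al ++ be) == rho)%:R * c al * c' be.

Definition LRcoefs (mu nu : seq nat) : seq nat -> K :=
  let d := (sumn mu + sumn nu)%N in
  epsilon (inhabits (fun _ => 0))
    (fun g : seq nat -> K => forall rho, rho \in parts d ->
        pmul (sumn mu) (sumn nu) (MacP mu) (MacP nu) rho =
        \sum_(ka <- parts d) g ka * MacP ka rho).

Definition fLR (la mu nu : seq nat) : K :=
  if la \in parts (sumn mu + sumn nu) then LRcoefs mu nu la else 0.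

(* coefficient of p_al(x) p_be(y) in c(x,y), c of degree d; uses
   p_rho(x,y) = prod_i (p_{rho_i}(x) + p_{rho_i}(y)) *)
Definition coef2 (d : nat) (c : seq nat -> K) (al be : seq nat) : K :=
  \sum_(rho <- parts d) c rho *
    (#|[set S : {set 'I_(size rho)} |
        (sort geq [seq nth 0 rho (val i) | i <- enum S] == al) &&
        (sort geq [seq nth 0 rho (val i) | i <- enum (~: S)] == be)]|)%:R.

(* P_la(x,y) = sum_mu P_{la/mu}(x) P_mu(y);  skewP la mu = P_{la/mu} *)
Definition skewP (la : seq nat) : seq nat -> seq nat -> K :=
  epsilon (inhabits (fun _ _ => 0))
    (fun g : seq nat -> seq nat -> K => forall al be, is_part al -> is_part be ->
       coef2 (sumn la) (MacP la) al be =
       \sum_(mu <- parts (sumn be)) g mu al * MacP mu be).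

(* u0 N d c = c(t^{N-1},...,t,1) for a symmetric function c supported in
   degrees <= d; p_r(t^{N-1},...,1) = sum_{i<N} t^{i r}. *)
Definition u0 (N d : nat) (c : seq nat -> K) : K :=
  \sum_(k < d.+1) \sum_(al <- parts k)
     c al * \prod_(r <- al) \sum_(i < N) tt_ ^+ (i * r).

(* Main.v *)
(** Fix N = n - m and let Gamma be the ring morphism p_r |-> t^(-r) p_r + (1 - t^(Nr)) / (1 - t^r).
By the definition of the skew polynomials, Gamma P_mu is the sum over omega of
t^(-|omega|) u_0^(N)(P_(mu/omega)) P_omega, so that, for
Phi = sum_nu t^(n(nu)) (q t^(-N-1); q, t)_nu / c'_nu P_nu,
the left-hand side is the coefficient M(la, mu) of P_la in Phi * Gamma P_mu.  Phi is the
exponential of sum_r (1 - a^r) / (1 - q^r) p_r / r with a = q t^(-N-1).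

The operator E of Macdonald is self-adjoint for the q,t-scalar product and triangular in the
monomial symmetric functions for the dominance order, hence diagonal in the P_la.
Commuting multiplication by p_1 and E with Gamma and Phi, and using the Pieri
rule for p_1, gives two linear recurrences between the M(ka, mu) with ka = la minus a box and the
M(la, nu) with nu = mu plus a box.  The recurrences determine M: for mu empty one eliminates M(la, nu)
and the difference of eigenvalues e_la - 1 is nonzero; otherwise one removes a box from the last row of
mu, by induction on |mu| and then on n(mu).  The product on the right-hand side satisfies the same
recurrences, by partial Lagrange interpolation at the points q^(mu_j) t^(N-j) and q^(la_i) t^(-i-1)
(rows numbered from 0).
The principal specialization of P_mu is the case m = 0, and the P-expansion of Phi the case of
empty mu. *)
From Stdlib Require Import ClassicalEpsilon.
From HB Require Import structures.
From mathcomp Require Import all_boot all_order all_algebra.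
From mathcomp.multinomials Require Import mpoly.
From mathcomp Require Import ring zify.
Require Import Defs.
Set Implicit Arguments. Unset Strict Implicit. Unset Printing Implicit Defensive.
Import GRing.Theory.
Local Open Scope ring_scope.

(** * Power sums and translation operators *)

(** The ring is truncated to K[p_1,...,p_D], so Phi is a finite sum and terms of degree above D have
    to be discarded. Extracting coefficients through the scalar product does this, since it reads a
    single degree. Exponentials enter only through Newton's recurrence, and a factor (1 - y s)/(1 -
    x s) only after its denominator is cleared. This forces a companion [En] of E: clearing a
    denominator couples neighbouring terms of the sum defining E, so E alone passes through neither
    Gamma nor Phi. In both cases the numerator leads to the same combination E - En, and the two
    commutations can be chained. The constant a is free up to there; its value is dictated by the
    product side, where it turns q^(la_i - 1) into the interpolation point of row i. The other
    obstacle is degeneracy. When row i of la equals row i + N of mu, the interpolation point of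
    either row is the zero attached to the other; such pairs are cancelled before interpolating.
    P_la is constructed as an eigenvector of E, and the objects chosen in the definitions are
    identified with it only at the end. *)

Lemma triangular_sum (V : nmodType) (F : nat -> nat -> V) n :
  \sum_(j < n) \sum_(r < j.+1) F r (j - r)%N = \sum_(r < n) \sum_(i < n - r) F r i.
Proof.
elim: n => [|n IH]; first by rewrite !big_ord0.
rewrite big_ord_recr /= IH [in RHS]big_ord_recr /= subSnn big_ord1.
rewrite [X in _ + X]big_ord_recr /= subnn addrA; congr (_ + _).
rewrite -big_split /=; apply: eq_bigr => r _.
by rewrite subSn 1?ltnW // big_ord_recr.
Qed.

Section Newton.
Variable R : comNzRingType.
Implicit Types (a b n m : nat -> R) (B : nat).

(** Says that the n_k with k <= B are the coefficients of exp(sum_r a_r s^r / r). The division-free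
    form makes sense over any commutative ring: K, polynomials over it, or the target of an
    evaluation. *)
Definition newton B a n :=
  n 0%N = 1 /\
  forall k, (k < B)%N -> k.+1%:R * n k.+1 = \sum_(r < k.+1) a r.+1 * n (k - r)%N.

Definition conv n m k := \sum_(i < k.+1) n i * m (k - i)%N.

Lemma convC n m k : conv n m k = conv m n k.
Proof.
rewrite /conv (reindex_inj rev_ord_inj) /=; apply: eq_bigr => i _.
by rewrite mulrC subSS subKn // -ltnS.
Qed.

(** Half of Leibniz's rule for s d/ds on a product of series: the half in which the first factor is
    differentiated. *)
Lemma newton_convl n m a B k : newton B a n -> (k < B)%N ->
  \sum_(i < k.+2) i%:R * n i * m (k.+1 - i)%N
  = \sum_(r < k.+1) a r.+1 * conv n m (k - r).
Proof.
move=> [_ Hn] kB; rewrite big_ord_recl /= !mul0r add0r.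
transitivity (\sum_(j < k.+1) \sum_(r < j.+1) a r.+1 * (n (j - r)%N * m (k - r - (j - r))%N)).
  apply: eq_bigr => j _ /=; rewrite /bump /= add1n Hn; last first.
    exact: leq_ltn_trans (leq_ord j) kB.
  rewrite mulr_suml; apply: eq_bigr => r _; rewrite -mulrA subSS.
  by congr (_ * (_ * m _)); have := ltn_ord r; have := ltn_ord j; lia.
rewrite (triangular_sum (fun r i => a r.+1 * (n i * m (k - r - i)%N))).
apply: eq_bigr => r _; rewrite /conv mulr_sumr subSn //.
by rewrite -ltnS.
Qed.

Lemma newton_conv B a b n m :
  newton B a n -> newton B b m -> newton B (fun r => a r + b r) (conv n m).
Proof.
move=> Hn Hm; split.
  by rewrite /conv big_ord1 Hn.1 Hm.1 mulr1.
move=> k kB.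
have -> : k.+1%:R * conv n m k.+1 =
  \sum_(i < k.+2) i%:R * n i * m (k.+1 - i)%N + \sum_(i < k.+2) i%:R * m i * n (k.+1 - i)%N.
  rewrite [X in _ + X](reindex_inj rev_ord_inj) -big_split /conv mulr_sumr /=.
  apply: eq_bigr => i _; have Hi := ltn_ord i.
  have -> : (k.+1 - (k.+2 - i.+1))%N = i by lia.
  have -> : (k.+2 - i.+1 = k.+1 - i)%N by lia.
  rewrite natrB //; ring.
rewrite (newton_convl _ Hn kB) (newton_convl _ Hm kB) -big_split /=.
by apply: eq_bigr => r _; rewrite (convC m n) mulrDl.
Qed.

(** The n_k are the coefficients of (1 - y s)/(1 - x s), the exponential of sum_r (x^r - y^r) s^r /
    r. *)
Lemma newton_geom (x y : R) B :
  newton B (fun r => x ^+ r - y ^+ r) (fun k => if k is k'.+1 then x ^+ k - y * x ^+ k' else 1).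
Proof.
split=> // k _.
(* Each summand of Newton's recurrence is x^(k+1) - y x^k plus a difference of consecutive terms;
   these differences telescope. *)
have tel (j : nat) : (j <= k)%N ->
  \sum_(i < j) (y ^+ i.+2 * x ^+ (k.-1 - i) - y ^+ i.+1 * x ^+ (k - i)) = y ^+ j.+1 * x ^+ (k - j) - y * x ^+ k.
  elim: j => [|j IH] nk; first by rewrite big_ord0 expr1 subn0 subrr.
  rewrite big_ord_recr /= IH; last exact: ltnW.
  have -> : (k.-1 - j = k - j.+1)%N by lia.
  ring.
rewrite big_ord_recr /= subnn mulr1.
rewrite (_ : \sum_(i < k) _ = \sum_(i < k) (x ^+ k.+1 - y * x ^+ k + (y ^+ i.+2 * x ^+ (k.-1 - i) - y ^+ i.+1 * x ^+ (k - i)))).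
  rewrite big_split /= tel // subnn expr0 sumr_const card_ord -mulr_natl -natr1.
  ring.
apply: eq_bigr => -[i Hi] _ /=.
have -> : (k - i = (k.-1 - i).+1)%N by lia.
have -> : k = (i + (k.-1 - i)).+1 by lia.
move: (k.-1 - i)%N => d; rewrite /= addKn !(exprS, exprD); ring.
Qed.

Lemma eq_newton B a a' n n' : (forall r, (0 < r <= B)%N -> a r = a' r) ->
  (forall k, (k <= B)%N -> n k = n' k) -> newton B a n -> newton B a' n'.
Proof.
move=> Ha Hn [H0 H]; split; first by rewrite -Hn.
move=> k kB; rewrite -Hn // H //; apply: eq_bigr => r _.
have Hr := ltn_ord r.
by rewrite Ha ?Hn //; lia.
Qed.

End Newton.

Lemma newton_morph (R S : comNzRingType) (f : {rmorphism R -> S}) B a n :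
  newton B a n -> newton B (f \o a) (f \o n).
Proof.
move=> [H0 H]; split; first by rewrite /= H0 rmorph1.
move=> k kB; rewrite /= -(rmorph_nat f) -rmorphM H // rmorph_sum.
by apply: eq_bigr => r _; rewrite rmorphM.
Qed.

Section NewtonAlg.
Variables (K : fieldType) (R : comNzRingType) (h : {rmorphism K -> R}).
Hypothesis K0 : forall n : nat, n.+1%:R != 0 :> K.

Lemma natr_inj_alg n (x y : R) : n.+1%:R * x = n.+1%:R * y -> x = y.
Proof.
move=> /(congr1 (fun z => h n.+1%:R^-1 * z)); rewrite !mulrA.
by rewrite -(rmorph_nat h) -rmorphM mulVf // rmorph1 !mul1r.
Qed.

Lemma newton_uniq B a n m : newton B a n -> newton B a m ->
  forall k, (k <= B)%N -> n k = m k :> R.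
Proof.
move=> [n0 Hn] [m0 Hm] k; elim/ltn_ind: k => -[|k] IH kB; first by rewrite n0 m0.
apply: (@natr_inj_alg k); rewrite Hn // Hm //.
apply: eq_bigr => r _; rewrite IH //; have := ltn_ord r; lia.
Qed.

(** The list of all earlier coefficients is carried along, since the recurrence refers to every one
    of them; this keeps the recursion structural. *)
Fixpoint newts (a : nat -> R) n : seq R :=
  if n is n'.+1 then
    let s := newts a n' in
    rcons s (h n'.+1%:R^-1 * \sum_(r < n'.+1) a r.+1 * s`_(n' - r))
  else [:: 1].
Definition newt a k := (newts a k)`_k.

Lemma size_newts a n : size (newts a n) = n.+1.
Proof. by elim: n => //= n IH; rewrite size_rcons IH. Qed.

Lemma nth_newts a n k : (k <= n)%N -> (newts a n)`_k = newt a k.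
Proof.
move=> le; rewrite -(subnK le); elim: (n - k)%N => //= i IH.
by rewrite nth_rcons size_newts ltnS leq_addl IH.
Qed.

Lemma newtP a B : newton B a (newt a).
Proof.
split=> // k _; rewrite /newt /= nth_rcons size_newts ltnn eqxx.
rewrite mulrA -(rmorph_nat h) -rmorphM mulfV // rmorph1 mul1r.
apply: eq_bigr => r _; rewrite nth_newts //; exact: leq_subr.
Qed.

End NewtonAlg.

(** Evaluating the outer variable at ['X] sets the two variables equal, so a coefficient becomes an
    antidiagonal sum. This merges two successive translations into one. *)
Lemma coef_horner_X (R : comNzRingType) (u : {poly {poly R}}) n :
  (u.['X])`_n = \sum_(k < n.+1) (u`_k)`_(n - k).
Proof.
rewrite (@horner_coef_wide _ (maxn (size u) n.+1)) ?leq_maxl // coef_sum.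
rewrite -(big_mkord xpredT (fun k => (u`_k * 'X^k)`_n)) (@big_cat_nat _ _ _ n.+1) ?leq_maxr //=.
rewrite [X in _ + X]big_nat_cond [X in _ + X]big1 ?addr0; last first.
  by move=> k /andP [/andP [nk _] _]; rewrite coefMXn nk.
by rewrite big_mkord; apply: eq_bigr => k _; rewrite coefMXn ltnNge leq_ord.
Qed.

Section PowerSumRing.
Variables (K : fieldType) (D : nat).
Local Notation Lam := {mpoly K[D]}.

(** Variable number i is p_(i+1), so the degree of symmetric functions is the weight [mnmwgt]. Both
    p_0 and the p_r with r > D are set to 0. *)
Definition pw r : Lam :=
  if r is r'.+1 then (if insub r' is Some i then 'X_(i : 'I_D) else 0) else 0.

Lemma pwE (i : 'I_D) : pw i.+1 = 'X_i.
Proof. by rewrite /pw valK. Qed.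

Lemma ord_rng (i : 'I_D) : (0 < i.+1 <= D)%N.
Proof. exact: ltn_ord. Qed.

Lemma pwP r : (0 < r <= D)%N -> exists i : 'I_D, r = i.+1.
Proof. by case: r => // r rD; exists (Ordinal rD). Qed.

Lemma pw_gt r : (D < r)%N -> pw r = 0.
Proof. by case: r => // r rD; rewrite /pw insubF //; apply/negbTE; lia. Qed.

Lemma Lam_ind (P : Lam -> Prop) :
  (forall c, P c%:MP) -> (forall f g, P f -> P g -> P (f + g)) ->
  (forall i f, P f -> P ('X_i * f)) -> forall f, P f.
Proof.
move=> PC PD PX; have PXn (i : 'I_D) n f : P f -> P ('X_i ^+ n * f).
  by move=> Pf; elim: n => [|n IH]; rewrite ?expr0 ?mul1r // exprS -mulrA; apply: PX.
elim/mpolyind => [|c m f _ _ Pf]; first by rewrite -(mpolyC0 D K); apply: PC.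
apply: PD => //; rewrite -mul_mpolyC mulrC mpolyXE_id.
elim/big_rec: _ => [|i g _ Pg]; first by rewrite mul1r; apply: PC.
by rewrite -mulrA; apply: PXn.
Qed.

Lemma rm_ext (R : comNzRingType) (f g : {rmorphism Lam -> R}) :
  (forall c, f c%:MP = g c%:MP) -> (forall i : 'I_D, f 'X_i = g 'X_i) -> f =1 g.
Proof.
move=> HC HX; elim/Lam_ind => [|x y Hx Hy|i x Hx]; first exact: HC.
  by rewrite !rmorphD Hx Hy.
by rewrite !rmorphM HX Hx.
Qed.

Section Ev.
Variables (R : comNzRingType) (h : {rmorphism K -> R}) (v : nat -> R).
Definition ev (f : Lam) : R := mmap h (fun i : 'I_D => v i.+1) f.
HB.instance Definition _ := GRing.RMorphism.copy ev (mmap h (fun i : 'I_D => v i.+1)).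
Lemma evC c : ev c%:MP = h c. Proof. exact: mmapC. Qed.
Lemma evX (i : 'I_D) : ev 'X_i = v i.+1.
Proof. by rewrite /ev mmapX mmap1U. Qed.
Lemma ev_pw r : (0 < r <= D)%N -> ev (pw r) = v r.
Proof. by move=> /pwP[i ->]; rewrite pwE evX. Qed.
Lemma evZ c f : ev (c *: f) = h c * ev f.
Proof. by rewrite -mul_mpolyC rmorphM /= evC. Qed.
End Ev.

Lemma eq_ev (R : comNzRingType) (h : {rmorphism K -> R}) v w :
  (forall r, (0 < r <= D)%N -> v r = w r) -> ev h v =1 ev h w.
Proof.
move=> H; apply: rm_ext => [c|i] /=; first by rewrite !evC.
by rewrite !evX H //=.
Qed.

Lemma morph_ev (R S : comNzRingType) (h : {rmorphism K -> R}) (k : {rmorphism R -> S}) v f :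
  k (ev h v f) = ev (k \o h) (k \o v) f.
Proof.
move: f; apply: (@rm_ext _ (k \o ev h v) (ev (k \o h) (k \o v))) => [c|i] /=.
  by rewrite !evC.
by rewrite !evX.
Qed.

(* [tr c f] is f(p_r + c_r y^r), as a polynomial in y. *)
Definition tr (c : nat -> K) : Lam -> {poly Lam} :=
  ev (polyC \o @mpolyC D K) (fun r => (pw r)%:P + (c r)%:MP *: 'X^r).
HB.instance Definition _ c := GRing.RMorphism.copy (tr c)
  (ev (polyC \o @mpolyC D K) (fun r => (pw r)%:P + (c r)%:MP *: 'X^r)).

(** With c_r = 1 the translation adjoins a variable y, and the coefficient of y^k is taken; with c_r
    = q^r - 1 it replaces a variable y by q y. *)
Definition Tk_def (c : nat -> K) k (f : Lam) : Lam := (tr c f)`_k.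
Fact Tk_key : unit. Proof. by []. Qed.
Definition Tk := locked_with Tk_key Tk_def.
Canonical Tk_unlockable := [unlockable fun Tk].

Lemma TkE c k f : Tk c k f = (tr c f)`_k.
Proof. by rewrite [Tk]unlock. Qed.

Lemma trC c a : tr c a%:MP = a%:MP%:P. Proof. exact: evC. Qed.
Lemma trX c (i : 'I_D) : tr c 'X_i = ('X_i)%:P + (c i.+1)%:MP *: 'X^(i.+1).
Proof. by rewrite /tr evX pwE. Qed.
Lemma trZ c a f : tr c (a *: f) = a%:MP *: tr c f.
Proof. by rewrite /tr evZ mul_polyC. Qed.

Lemma eq_tr c c' : (forall r, (0 < r)%N -> c r = c' r) -> tr c =1 tr c'.
Proof. by move=> H; apply: eq_ev => r /andP[r0 _]; rewrite H. Qed.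
Lemma eq_Tk c c' k : (forall r, (0 < r)%N -> c r = c' r) -> Tk c k =1 Tk c' k.
Proof. by move=> H f; rewrite !TkE (eq_tr H). Qed.

Lemma Tk_is_linear c k : linear (Tk c k).
Proof.
move=> a f g; rewrite !TkE rmorphD /= trZ coefD coefZ.
by rewrite mul_mpolyC.
Qed.
HB.instance Definition _ c k :=
  GRing.isLinear.Build K Lam Lam _ (Tk c k) (Tk_is_linear c k).

Lemma TkD c k f g : Tk c k (f + g) = Tk c k f + Tk c k g.
Proof. exact: linearD. Qed.
Lemma TkZ c k a f : Tk c k (a *: f) = a *: Tk c k f.
Proof. exact: linearZ. Qed.
Lemma Tk_0 c k : Tk c k 0 = 0.
Proof. exact: linear0. Qed.

Lemma TkM c k f g : Tk c k (f * g) = \sum_(j < k.+1) Tk c j f * Tk c (k - j) g.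
Proof. by rewrite TkE rmorphM coefM; apply: eq_bigr => j _; rewrite !TkE. Qed.

Lemma TkC c k a : Tk c k a%:MP = if k == 0%N then a%:MP else 0.
Proof. by rewrite TkE trC coefC. Qed.

Lemma Tk1 c k : Tk c k 1 = (k == 0%N)%:R.
Proof. by rewrite -mpolyC1 TkC; case: k. Qed.

Lemma Tk_pw c k r : (0 < r <= D)%N ->
  Tk c k (pw r) = if k == 0%N then pw r else if k == r then (c r)%:MP else 0.
Proof.
move=> rD; rewrite TkE /tr ev_pw // coefD coefC coefZ coefXn.
case: (k =P 0%N) => [->|_]; last by rewrite add0r; case: eqP; rewrite ?mulr1 ?mulr0.
by case: r rD => // r _; rewrite /= mulr0 addr0.
Qed.

Lemma Tk_pwM c k r f : (0 < r <= D)%N ->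
  Tk c k (pw r * f) = pw r * Tk c k f + (if (r <= k)%N then c r *: Tk c (k - r) f else 0).
Proof.
move=> rD; rewrite !TkE rmorphM /= [tr c (pw r)]ev_pw // mulrDl coefD coefCM.
by rewrite -scalerAl coefZ coefXnM; case: ltnP => _; rewrite ?mulr0 // mul_mpolyC.
Qed.

Lemma Tk0 c f : Tk c 0 f = f.
Proof.
rewrite TkE -horner_coef0.
move: f; apply: (@rm_ext _ (horner_eval 0 \o tr c) idfun) => [a|i] /=.
  by rewrite trC /horner_eval hornerC.
by rewrite trX /horner_eval !hornerE expr0n /= mulr0 addr0.
Qed.

Lemma map_tr_coef c c' f j k : (map_poly (tr c) (tr c' f))`_k`_j = Tk c j (Tk c' k f).
Proof. by rewrite coef_map !TkE. Qed.

(** Both sides are the coefficient of y^j z^k in f(p_r + c_r y^r + c'_r z^r). *)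
Lemma Tk_comm c c' j k f : Tk c j (Tk c' k f) = Tk c' k (Tk c j f).
Proof.
rewrite -!map_tr_coef -[RHS]coef_swapXY; apply: (congr1 (fun u : {poly {poly Lam}} => u`_k`_j)).
move: f; apply: (@rm_ext _ (map_poly (tr c) \o tr c') (swapXY \o map_poly (tr c') \o tr c))
  => [a|i]; apply/polyP => {}k; apply/polyP => {}j; rewrite /= coef_swapXY !map_tr_coef.
  have [->|k0] := eqVneq k 0%N; first by rewrite !Tk0.
  have [->|j0] := eqVneq j 0%N; first by rewrite !Tk0.
  by rewrite !TkC (negbTE k0) (negbTE j0) !linear0.
have [->|k0] := eqVneq k 0%N; first by rewrite !Tk0.
have [->|j0] := eqVneq j 0%N; first by rewrite !Tk0.
rewrite -pwE !Tk_pw ?ord_rng // (negbTE k0) (negbTE j0).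
by do 2![case: eqP => _]; rewrite ?TkC ?(negbTE k0) ?(negbTE j0) ?linear0.
Qed.

Lemma Tk_add c c' n f :
  \sum_(j < n.+1) Tk c j (Tk c' (n - j) f) = Tk (fun r => c r + c' r) n f.
Proof.
pose phi : {rmorphism {poly {poly Lam}} -> {poly Lam}} := horner_eval 'X.
have -> : \sum_(j < n.+1) Tk c j (Tk c' (n - j) f) = (phi (map_poly (tr c) (tr c' f)))`_n.
  rewrite /phi /= /horner_eval coef_horner_X (reindex_inj rev_ord_inj) /=.
  apply: eq_bigr => j _; rewrite map_tr_coef subSS subKn //; exact: leq_ord.
rewrite TkE; apply: (congr1 (fun u : {poly Lam} => u`_n)).
move: f; apply: (@rm_ext _ (phi \o map_poly (tr c) \o tr c')) => [a|i] /=.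
  by rewrite !trC map_polyC /= trC /phi /= /horner_eval hornerC.
rewrite !trX rmorphD /= map_polyC /= trX map_polyZ map_polyXn /= trC.
rewrite /phi /= /horner_eval hornerD hornerC hornerZ hornerXn.
by rewrite mulrC -[in LHS]mul_polyC mul_polyC -addrA mulrC mul_polyC -scalerDl -rmorphD.
Qed.

Lemma Tk_scale c x n f : Tk (fun r => c r * x ^+ r) n f = x ^+ n *: Tk c n f.
Proof.
pose phi : {rmorphism {poly Lam} -> {poly Lam}} := comp_poly (x%:MP *: 'X).
have -> : x ^+ n *: Tk c n f = (phi (tr c f))`_n.
  rewrite /phi /= comp_polyE coef_sum TkE.
  have [ns|sn] := ltnP n (size (tr c f)).
    rewrite (bigD1 (Ordinal ns)) //= big1 => [|i ni].
      rewrite exprZn !coefZ coefXn eqxx mulr1 -rmorphXn /= addr0 mulrC.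
      by rewrite mul_mpolyC.
    rewrite exprZn !coefZ coefXn; case: eqP => [e|]; last by rewrite !mulr0.
    by case/eqP: ni; apply: val_inj.
  rewrite nth_default // scaler0 big1 // => i _.
  rewrite exprZn !coefZ coefXn gtn_eqF ?mulr0 //; exact: leq_trans sn.
rewrite TkE; apply: (congr1 (fun u : {poly Lam} => u`_n)).
move: f; apply: (@rm_ext _ (tr _) (phi \o tr c)) => [a|i] /=.
  by rewrite !trC /phi /= comp_polyC.
rewrite !trX /phi /= comp_polyD comp_polyC comp_polyZ comp_Xn_poly exprZn.
by rewrite scalerA rmorphM rmorphXn.
Qed.

Section Gen.
Hypothesis K0 : forall n : nat, n.+1%:R != 0 :> K.

(* [GN b k] is the coefficient of s^k in exp (sum_r b_r p_r s^r / r). *)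
Definition GN_def (b : nat -> K) : nat -> Lam := newt (@mpolyC D K) (fun r => b r *: pw r).
Fact GN_key : unit. Proof. by []. Qed.
Definition GN := locked_with GN_key GN_def.
Canonical GN_unlockable := [unlockable fun GN].

Lemma GNP b B : newton B (fun r => b r *: pw r) (GN b).
Proof. rewrite [GN]unlock; exact: newtP. Qed.

Lemma ev_GN (R : comNzRingType) (h : {rmorphism K -> R}) v b :
  newton D (fun r => h (b r) * v r) (fun k => ev h v (GN b k)).
Proof.
apply: eq_newton (newton_morph (ev h v) (GNP b D)) => //= r rD.
by rewrite evZ ev_pw.
Qed.

(** Translating p_r by c_r y^r multiplies exp(sum_r b_r p_r s^r / r) by exp(sum_r b_r c_r (s y)^r /
    r), a series in s y with coefficients [nu]. *)
Lemma Tk_GN b c nu k j : newton D (fun r => b r * c r) nu -> (k <= D)%N ->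
  Tk c j (GN b k) = if (j <= k)%N then nu j *: GN b (k - j) else 0.
Proof.
move=> Hnu kD.
pose h := (polyC \o @mpolyC D K : {rmorphism K -> {poly Lam}}).
have H1 : newton D (fun r => h (b r) * ((pw r)%:P + (c r)%:MP *: 'X^r)) (fun k => tr c (GN b k)).
  exact: ev_GN.
have H2 : newton D (fun r => (b r *: pw r)%:P) (fun k => (GN b k)%:P).
  exact: (newton_morph polyC (GNP b D)).
have H3 : newton D (fun r => (b r * c r)%:MP *: 'X^r) (fun k => (nu k)%:MP *: 'X^k : {poly Lam}).
  case: Hnu => [nu0 Hnu]; split; first by rewrite nu0 scale1r.
  move=> i iD; rewrite mulr_natl -scaler_nat scalerA -(mpolyC_nat D K) -rmorphM /= Hnu //.
  rewrite rmorph_sum scaler_suml; apply: eq_bigr => r _ /=.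
  rewrite rmorphM -scalerAl -scalerAr scalerA -exprD.
  by congr (_ *: 'X^_); have := ltn_ord r; lia.
have H4 := newton_conv H2 H3.
have -> : Tk c j (GN b k) = (tr c (GN b k))`_j by rewrite TkE.
have H1' : newton D (fun r => (b r *: pw r)%:P + (b r * c r)%:MP *: 'X^r) (fun k => tr c (GN b k)).
  apply: eq_newton H1 => // r _; rewrite mulrDr /h /=.
  by rewrite -polyCM mul_mpolyC mul_polyC scalerA rmorphM.
rewrite (newton_uniq h K0 H1' H4 kD) /conv coef_sum.
case: ifP => jk; last first.
  rewrite big1 // => i _; rewrite mul_polyC !coefZ coefXn.
  have -> : (j == k - i)%N = false by apply/negbTE; lia.
  by rewrite /= !mulr0.
have kj : (k - j < k.+1)%N by lia.
rewrite (bigD1 (Ordinal kj)) //= big1 ?addr0 => [|i ni].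
  by rewrite subKn // mul_polyC !coefZ coefXn eqxx mulr1 mulrC mul_mpolyC.
rewrite mul_polyC !coefZ coefXn; case: eqP => [e|]; last by rewrite !mulr0.
by case/eqP: ni; apply: val_inj => /=; have := ltn_ord i; lia.
Qed.

End Gen.

Lemma mderivU (i j : 'I_D) : ('X_j : Lam)^`M(i) = (i == j)%:R.
Proof.
rewrite mderivX mnm1E eq_sym; case: eqP => [->|_]; last by rewrite scale0r.
suff -> : (U_(j) - U_(j) = 0 :> 'X_{1..D})%MM by rewrite mpolyX0 scale1r.
by apply/mnmP => k; rewrite mnmBE subnn mnm0E.
Qed.

Lemma Tk_deriv c (i : 'I_D) k f : (Tk c k f)^`M(i) = Tk c k f^`M(i).
Proof.
move: k; apply: (@Lam_ind (fun f => forall k, (Tk c k f)^`M(i) = Tk c k f^`M(i))) => {f}.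
- move=> a k; rewrite !TkC mderivC Tk_0; case: eqP => _; by rewrite ?mderivC ?mderiv0.
- by move=> f g Hf Hg k; rewrite mderivD !TkD mderivD; congr (_ + _); [exact: Hf | exact: Hg].
move=> j f Hf k; rewrite -pwE Tk_pwM ?ord_rng // mderivD !mderivM TkD.
rewrite Tk_pwM ?ord_rng // -addrA; congr (_ + _).
  by rewrite pwE mderivU; case: eqP; rewrite ?mul1r // !mul0r Tk_0.
rewrite Hf; case: (j < k)%N; last by rewrite mderiv0.
by rewrite mderivZ Hf.
Qed.

(** As a series in y the translation is exp(sum_r c_r y^r d/dp_r), and y d/dy is applied to it. The
    outcome is a Newton recurrence for the [Tk c k], parallel to the one for [GN]. *)
Lemma Tk_newton c k f :
  k.+1%:R *: Tk c k.+1 f = \sum_(i < D | (i <= k)%N) (i.+1%:R * c i.+1) *: Tk c (k - i) f^`M(i).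
Proof.
move: f k; apply: Lam_ind => [a|f g Hf Hg|j f Hf] k.
- rewrite TkC /= scaler0 big1 // => i _; by rewrite mderivC Tk_0 scaler0.
- rewrite TkD scalerDr Hf Hg -big_split /=; apply: eq_bigr => i _.
  by rewrite mderivD TkD scalerDr.
rewrite (eq_bigr (fun i : 'I_D => (if i == j then (i.+1%:R * c i.+1) *: Tk c (k - i) f else 0)
   + ('X_j * ((i.+1%:R * c i.+1) *: Tk c (k - i) f^`M(i))
   + (if (i + j < k)%N then c j.+1 *: ((i.+1%:R * c i.+1) *: Tk c (k - j.+1 - i) f^`M(i)) else 0))));
  last first.
  move=> i ik; rewrite mderivM TkD scalerDr; congr (_ + _).
    by rewrite mderivU; case: eqP => [->|_]; rewrite ?mul1r // mul0r Tk_0 scaler0.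
  rewrite -pwE Tk_pwM ?ord_rng // scalerDr -scalerAr; congr (_ + _).
  have -> : (j < k - i)%N = (i + j < k)%N by lia.
  case: ifP => _; rewrite ?scaler0 // !scalerA [c j.+1 * _]mulrC.
  by have -> : (k - i - j.+1 = k - j.+1 - i)%N by lia.
rewrite !big_split /= -mulr_sumr -Hf.
rewrite -pwE Tk_pwM ?ord_rng // scalerDr addrCA -scalerAr; congr (_ + _).
rewrite ltnS -big_mkcondr /= subSS.
have -> : \sum_(i < D | (i <= k)%N && (i == j)) (i.+1%:R * c i.+1) *: Tk c (k - i) f =
  if (j <= k)%N then (j.+1%:R * c j.+1) *: Tk c (k - j) f else 0.
  case: ifP => jk; last by rewrite big_pred0 // => i; case: eqP => [->|]; rewrite ?jk ?andbF.
  by rewrite (big_pred1 j) // => i /=; case: eqP => [->|]; rewrite ?jk ?andbF.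
rewrite -big_mkcondr /= -scaler_sumr.
case: ifP => jk; last first.
  by rewrite big_pred0 ?scaler0 ?addr0 // => i; apply/negbTE; lia.
have -> : \sum_(i < D | (i <= k)%N && (i + j < k)%N) (i.+1%:R * c i.+1) *: Tk c (k - j.+1 - i) f^`M(i)
   = (k - j)%:R *: Tk c (k - j) f.
  have [jk'|kj] := ltnP j k; last first.
    have -> : (k - j = 0)%N by lia.
    by rewrite scale0r big_pred0 // => i; apply/negbTE; lia.
  have -> : (k - j = (k - j.+1).+1)%N by lia.
  by rewrite Hf; apply: eq_bigl => i; lia.
rewrite !scalerA -scalerDl; congr (_ *: _).
have -> : k.+1%:R = j.+1%:R + (k - j)%:R :> K by rewrite -natrD; congr _%:R; lia.
ring.
Qed.

End PowerSumRing.

(** * The Macdonald operator *)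

Section MacdonaldOperator.
Variables (K : fieldType) (D : nat).
Local Notation Lam := {mpoly K[D]}.
Hypothesis K0 : forall n : nat, n.+1%:R != 0 :> K.
Variables q t : K.
Local Notation hom d f := ((f : Lam) \is d.-homog for (@mnmwgt D)).

Lemma hom_ind (Q : nat -> Lam -> Prop) :
  Q 0%N 1 -> (forall d, Q d 0) -> (forall d c f g, Q d f -> Q d g -> Q d (c *: f + g)) ->
  (forall d (i : 'I_D) f, Q d f -> Q (i.+1 + d)%N ('X_i * f)) -> forall d f, hom d f -> Q d f.
Proof.
move=> Q1 Q0 QZ QX.
have QM : forall m : 'X_{1..D}, Q (mnmwgt m) 'X_[m].
  move=> m; have [k mk] : exists k, mdeg m = k by exists (mdeg m).
  elim: k m mk => [|k IH] m mk.
    by move/eqP: mk; rewrite mdeg_eq0 => /eqP ->; rewrite mnmwgt0 mpolyX0.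
  have [i mi] : exists i : 'I_D, (0 < m i)%N.
    case: (pickP (fun i => 0 < m i)%N) => [i mi|m0]; first by exists i.
    suff m_0 : m = 0%MM by rewrite m_0 mdeg0 in mk.
    by apply/mnmP => i; rewrite mnm0E; have := m0 i; case: (m i).
  have Um : (U_(i) <= m)%MM.
    apply/mnm_lepP => j; rewrite mnm1E; case: eqP => [<-|] //.
  rewrite -(submK Um) addmC mpolyXD mnmwgtD mnmwgt1; apply: QX; apply: IH.
  by move: mk; rewrite -{1}(submK Um) mdegD mdeg1 addn1 => -[].
move=> d f /dhomogP Hf; rewrite (mpolyE f).
elim: (msupp f) (Hf) => [|m s IH] Hs; first by rewrite big_nil.
rewrite big_cons; apply: QZ; last by apply: IH => x xs; apply: Hs; rewrite inE xs orbT.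
by rewrite -(Hs m) ?mem_head //; apply: QM.
Qed.

Lemma hom_pw r : (0 < r)%N -> hom r (pw K D r).
Proof.
case: (leqP r D) => [rD r0|Dr _]; last by rewrite pw_gt // dhomog0.
have /pwP[i ->] : (0 < r <= D)%N by rewrite r0.
by rewrite pwE dhomogX /= mnmwgt1.
Qed.

Lemma homM d e f g : hom d f -> hom e g -> hom (d + e)%N (f * g).
Proof. exact: dhomogM. Qed.

(** The two cases are proved together because multiplication by p_r in the induction moves k across
    the bound d. *)
Lemma hom_Tk_spec c d f : hom d f ->
  forall k, if (k <= d)%N then is_true (hom (d - k)%N (Tk c k f)) else Tk c k f = 0.
Proof.
apply: (@hom_ind (fun d f => forall k, if (k <= d)%N then is_true (hom (d - k)%N (Tk c k f))
   else Tk c k f = 0)) => {d f}.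
- by move=> k; rewrite Tk1; case: k => [|k] //=; rewrite dhomog1.
- by move=> d k; rewrite linear0; case: ifP => // _; rewrite dhomog0.
- move=> d a f g Hf Hg k; have {Hf} := Hf k; have {Hg} := Hg k.
  case: ifP => _ H1 H2; last by rewrite linearP /= H1 H2 scaler0 addr0.
  by rewrite linearP rpredD ?rpredZ.
move=> d i f Hf k; rewrite -pwE Tk_pwM ?ord_rng //.
have A : (k <= i.+1 + d)%N -> hom (i.+1 + d - k)%N (pw K D i.+1 * Tk c k f).
  move=> kd; have := Hf k; case: ifP => kd' H; last by rewrite H mulr0 dhomog0.
  by rewrite -addnBA //; apply: homM => //; apply: hom_pw.
have B : (k <= i.+1 + d)%N -> (i.+1 <= k)%N -> hom (i.+1 + d - k)%N (c i.+1 *: Tk c (k - i.+1) f).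
  move=> kd ik; have := Hf (k - i.+1)%N; rewrite leq_subLR kd => H.
  rewrite rpredZ //; have -> : (i.+1 + d - k = d - (k - i.+1))%N by lia.
  exact: H.
case: ifP => kd.
  by case: ifP => ik; [rewrite rpredD ?A ?B | rewrite addr0 A].
have -> : Tk c k f = 0 by have := Hf k; have -> : (k <= d)%N = false by lia.
rewrite mulr0 add0r; case: ifP => // ik.
have := Hf (k - i.+1)%N; have -> : (k - i.+1 <= d)%N = false by lia.
by move=> ->; rewrite scaler0.
Qed.

Lemma hom_Tk c d k f : hom d f -> (k <= d)%N -> hom (d - k)%N (Tk c k f).
Proof. by move=> Hf kd; have := hom_Tk_spec c Hf k; rewrite kd. Qed.

Lemma Tk_gt c d k f : hom d f -> (d < k)%N -> Tk c k f = 0.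
Proof. by move=> Hf dk; have := hom_Tk_spec c Hf k; rewrite leqNgt dk. Qed.

Lemma hom_GN b k : hom k (GN D b k).
Proof.
elim/ltn_ind: k => -[|k] IH.
  by have [-> _] := GNP D K0 b 0; rewrite dhomog1.
have [_ /(_ k (ltnSn k)) H] := GNP D K0 b k.+1.
have -> : GN D b k.+1 = k.+1%:R^-1 *: \sum_(r < k.+1) (b r.+1 *: pw K D r.+1) * GN D b (k - r).
  by rewrite -H -scaler_nat -scalerAl mul1r scalerA mulVf // scale1r.
rewrite rpredZ // rpred_sum // => r _; have Hr := ltn_ord r.
have A : hom r.+1 (b r.+1 *: pw K D r.+1) by rewrite rpredZ ?hom_pw.
have B : hom (k - r)%N (GN D b (k - r)) by apply: IH; lia.
by have := homM A B; have -> : (r.+1 + (k - r))%N = k.+1 by lia.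
Qed.

(** The [G k] have generating series prod_i (1 - x_i s / t) / (1 - x_i s); its partial fractions
    produce the coefficients A_i of the q-difference operator. *)
Local Notation G := (GN D (fun r => 1 - t^-1 ^+ r)).
Local Notation U := (@Tk K D (fun r => q ^+ r - 1)).
Local Notation H := (@Tk K D (fun=> 1)).

(* Macdonald's operator E; on n variables t^n E is (t - 1) sum_i A_i(x; t) T_(q, x_i) + 1. *)
Definition EE_def (f : Lam) : Lam := \sum_(k < D.+1) G k * U k f.
(* The commutator of E with multiplication by p_1 is (q - 1) En. *)
Definition En_def (f : Lam) : Lam := \sum_(k < D) G k.+1 * U k f.
Fact EE_key : unit. Proof. by []. Qed.
Fact En_key : unit. Proof. by []. Qed.
Definition EE := locked_with EE_key EE_def.
Definition En := locked_with En_key En_def.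
Lemma EE_E f : EE f = \sum_(k < D.+1) G k * U k f.
Proof. by rewrite /EE locked_withE. Qed.
Lemma En_E f : En f = \sum_(k < D) G k.+1 * U k f.
Proof. by rewrite /En locked_withE. Qed.

Lemma EE_is_linear : linear EE.
Proof.
move=> a f g; rewrite !EE_E scaler_sumr -big_split; apply: eq_bigr => k _ /=.
by rewrite linearP mulrDr scalerAr.
Qed.
HB.instance Definition _ := GRing.isLinear.Build K Lam Lam _ EE EE_is_linear.

Lemma En_is_linear : linear En.
Proof.
move=> a f g; rewrite !En_E scaler_sumr -big_split; apply: eq_bigr => k _ /=.
by rewrite linearP mulrDr scalerAr.
Qed.
HB.instance Definition _ := GRing.isLinear.Build K Lam Lam _ En En_is_linear.

Lemma hom_EE d f : hom d f -> hom d (EE f).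
Proof.
move=> Hf; rewrite EE_E rpred_sum // => k _.
have [kd|dk] := leqP k d; last by rewrite (Tk_gt _ Hf dk) mulr0 dhomog0.
by rewrite -(subnKC kd) homM ?hom_GN // hom_Tk // subnKC.
Qed.

Lemma G0 : G 0 = 1. Proof. by have [] := GNP D K0 (fun r => 1 - t^-1 ^+ r) 0. Qed.

Lemma EE1 : EE 1 = 1.
Proof.
rewrite EE_E (bigD1 ord0) //= big1 => [|i i0]; last first.
  by rewrite Tk1; case: i i0 => -[] //= *; rewrite mulr0.
by rewrite G0 Tk1 mulr1 addr0.
Qed.

Lemma G1 : (0 < D)%N -> G 1 = (1 - t^-1) *: pw K D 1.
Proof.
move=> D0; have [_ /(_ 0%N isT)] := GNP D K0 (fun r => 1 - t^-1 ^+ r) 1.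
by rewrite mul1r big_ord1 /= G0 mulr1 expr1.
Qed.

Lemma EE_pw1 f : (0 < D)%N -> EE (pw K D 1 * f) = pw K D 1 * EE f + (q - 1) *: En f.
Proof.
move=> D0; rewrite !EE_E En_E mulr_sumr scaler_sumr.
under eq_bigr => k _ do rewrite Tk_pwM // mulrDr.
rewrite big_split /=; congr (_ + _); first by apply: eq_bigr => k _; rewrite mulrCA.
rewrite big_ord_recl /= mulr0 add0r; apply: eq_bigr => k _ /=.
by rewrite /bump /= add1n expr1 subn1 -scalerAr.
Qed.

(** Adjoining the variable y multiplies the series of the [G k] by (1 - s y / t) / (1 - s y), whose
    coefficients are 1, 1 - 1/t, 1 - 1/t, and so on. *)
Lemma H_G j k : (k <= D)%N -> H j (G k) =
  if (j <= k)%N then (if j == 0%N then 1 else 1 - t^-1) *: G (k - j) else 0.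
Proof.
move=> kD; pose nu j := if j is j'.+1 then 1 ^+ j - t^-1 * 1 ^+ j' else 1 : K.
have Hnu : newton D (fun r => (1 - t^-1 ^+ r) * 1) nu.
  apply: eq_newton (newton_geom 1 t^-1 D) => // r _.
  by rewrite expr1n mulr1.
rewrite (Tk_GN K0 _ Hnu kD); case: ifP => // _.
by case: j => //= j; rewrite !expr1n mulr1.
Qed.

(** Adjoining y and then replacing it by q y amounts to adjoining q y, as 1 + (q^r - 1) = q^r. *)
Lemma UH n f : \sum_(i < n.+1) U i (H (n - i) f) = q ^+ n *: H n f.
Proof.
rewrite Tk_add -Tk_scale; apply: eq_Tk => r _.
by rewrite mul1r subrK.
Qed.

Lemma U_H i j f : U i (H j f) = H j (U i f).
Proof. exact: Tk_comm. Qed.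

(** The coefficient of y^n in E f after a variable y is adjoined. Every correction term contains
    some [H j f] with j >= n, so the formula closes up at the highest exponents that occur in f. *)
Lemma H_EE d n f : hom d f -> (d <= D)%N ->
  H n (EE f) = t^-1 *: EE (H n f) + (1 - t^-1) *:
    \sum_(l < D.+1) G l * (q ^+ (n + l) *: H (n + l) f - \sum_(i < l) U i (H (n + l - i) f)).
Proof.
move=> Hf dD.
have U0 k j : (D < k)%N -> U k (H j f) = 0.
  move=> Dk; rewrite U_H (Tk_gt _ Hf) ?linear0 //; exact: leq_ltn_trans Dk.
have HGU k : (k <= D)%N -> H n (G k * U k f) = t^-1 *: (G k * U k (H n f)) +
    (1 - t^-1) *: \sum_(j < n.+1 | (j <= k)%N) G (k - j) * U k (H (n - j) f).
  move=> kD; rewrite TkM.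
  rewrite (eq_bigr (fun j : 'I_n.+1 => (if j == ord0 then t^-1 *: (G k * U k (H n f)) else 0) +
     (if (j <= k)%N then (1 - t^-1) *: (G (k - j) * U k (H (n - j) f)) else 0))); last first.
    move=> j _; rewrite H_G // -U_H -val_eqE /=.
    case: ifP => jk; last by rewrite mul0r; case: eqP jk => [->|] //; rewrite addr0.
    case: eqP => [->|_]; last by rewrite add0r scalerAl.
    by rewrite !subn0 scale1r -scalerDl addrC subrK scale1r.
  rewrite big_split /= -big_mkcond big_pred1_eq -big_mkcond /=.
  by rewrite scaler_sumr.
rewrite [in LHS]EE_E linear_sum /=.
under eq_bigr => k _ do rewrite (HGU k (leq_ord k)).
rewrite big_split /=.
rewrite -!scaler_sumr -EE_E; congr (_ + _ *: _).
(* The index is changed to l = k - j; the terms with l + j > D that this adds vanish by [U0]. *)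
transitivity (\sum_(j < n.+1) \sum_(l < D.+1) G l * U (l + j) (H (n - j) f)).
  rewrite (exchange_big_dep xpredT) //=; apply: eq_bigr => j _.
  rewrite -[RHS](big_mkord xpredT (fun l => G l * U (l + j) (H (n - j) f))).
  rewrite -(big_mkord (fun k => (j <= k)%N) (fun k => G (k - j) * U k (H (n - j) f))).
  have [jD|Dj] := leqP j D.+1; last first.
    rewrite big_nat_cond big_pred0; last by move=> i; lia.
    rewrite big_nat_cond big1 // => i Hi; rewrite U0 ?mulr0 //; lia.
  rewrite (@big_cat_nat _ _ _ j) //= big_nat_cond big_pred0 ?add0r; last by move=> i; lia.
  rewrite [RHS](@big_cat_nat _ _ _ (D.+1 - j)) ?leq_subr //=.
  rewrite [X in _ = _ + X]big_nat_cond [X in _ = _ + X]big1 ?addr0; last first.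
    move=> i Hi; rewrite U0 ?mulr0 //; lia.
  rewrite -{1}[j : nat]add0n big_addn big_nat_cond [RHS]big_nat_cond.
  apply: eq_big => [i|i _]; first by lia.
  by rewrite addnK.
rewrite exchange_big; apply: eq_bigr => l _ /=.
rewrite -mulr_sumr; congr (_ * _).
have := UH (n + l) f.
rewrite -(big_mkord xpredT (fun i => U i (H (n + l - i) f))) (@big_cat_nat _ _ _ l) //=; last lia.
rewrite big_mkord => <-; rewrite addrAC subrr add0r.
rewrite [RHS](_ : _ = \sum_(0 + l <= i < (n + l).+1) U i (H (n + l - i) f)) // big_addn.
have -> : ((n + l).+1 - l = n.+1)%N by lia.
rewrite big_mkord; apply: eq_bigr => i _; rewrite addnC.
by congr (_ (H _ _)); lia.
Qed.

(** At the top exponent d only the term l = 0 survives. The two scalars are those of the recursion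
    for the eigenvalue, with d as first row. *)
Lemma H_EE_top d e f : hom e f -> (e <= D)%N -> (forall k, (d < k)%N -> H k f = 0) ->
  H d (EE f) = t^-1 *: EE (H d f) + ((1 - t^-1) * q ^+ d) *: H d f.
Proof.
move=> Hf eD f0; rewrite (H_EE d Hf eD); congr (_ + _).
rewrite big_ord_recl big_ord0 /= addn0 subr0 G0 mul1r big1 ?addr0 ?scalerA // => l _.
rewrite f0; last by rewrite /= /bump; lia.
rewrite scaler0 sub0r big1 ?oppr0 ?mulr0 // => i _.
rewrite f0 ?linear0 //; have := ltn_ord i; rewrite /= /bump; lia.
Qed.

(** One below the top exponent, the terms with l >= 1 involve only [H d.+1 f]; apart from the one
    with G_1 q^(d+1) they add up to [En]. This is the source of the Pieri coefficients. *)
Lemma H_EE_subtop d e f : hom e f -> (e <= D)%N -> (0 < D)%N ->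
  (forall k, (d.+1 < k)%N -> H k f = 0) ->
  H d (EE f) = t^-1 *: EE (H d f) + (1 - t^-1) *:
    (q ^+ d *: H d f + q ^+ d.+1 *: (G 1 * H d.+1 f) - En (H d.+1 f)).
Proof.
move=> Hf eD D0 f0; rewrite (H_EE d Hf eD); congr (_ + _ *: _).
rewrite big_ord_recl big_ord0 /= addn0 subr0 G0 mul1r -addrA; congr (_ + _).
rewrite En_E -sumrN; set X := q ^+ d.+1 *: _.
rewrite (eq_bigr (fun l : 'I_D => (if l == 0%N :> nat then X else 0) - G l.+1 * Tk (fun r => q ^+ r - 1) l (H d.+1 f))); last first.
  move=> l _; rewrite /= /bump /= add1n; have lD := ltn_ord l.
  rewrite big_ord_recr /= mulrBr.
  have -> : (d + l.+1 - l = d.+1)%N by lia.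
  rewrite [X in _ * (X + _)]big1 ?add0r => [|i _]; last first.
    by rewrite f0 ?linear0 //; have := ltn_ord i; lia.
  case: eqP => [->|/eqP l0]; first by rewrite addn1 -scalerAr.
  by rewrite f0 ?scaler0 ?mulr0 ?sub0r //; lia.
rewrite big_split /= -big_mkcond /= sumrN; congr (_ + _).
by rewrite (big_pred1 (Ordinal D0)).
Qed.
End MacdonaldOperator.

(** * Coefficients in the power sum basis and the scalar product *)

Lemma geq_trans : transitive geq.
Proof. by move=> y x z /= xy yz; apply: leq_trans yz xy. Qed.
Lemma geq_total : total geq.
Proof. by move=> x y; rewrite /= leq_total. Qed.
Lemma geq_anti : antisymmetric geq.
Proof. by move=> x y /=; rewrite andbC -eqn_leq => /eqP. Qed.

Lemma mem_seqs l b s : (s \in seqs l b) = (size s <= l)%N && all (fun x => 0 < x <= b)%N s.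
Proof.
elim: l s => [|l IH] [|x s] //=; rewrite ?inE //=.
apply/allpairsPdep/idP => [[y [u [yb ub [-> ->]]]]|/and3P[sl xb sb]].
  by move: yb ub; rewrite mem_iota add1n ltnS IH ltnS => -> /andP[-> ->].
by exists x, s; rewrite mem_iota add1n ltnS xb IH -ltnS sl sb.
Qed.

Lemma uniq_seqs l b : uniq (seqs l b).
Proof.
elim: l => //= l IH; apply/andP; split; first by apply/negP => /allpairsPdep[? [? []]].
by apply: allpairs_uniq_dep => //; rewrite ?iota_uniq // => -[a b'] [c d'] _ _ /= [-> ->].
Qed.

Lemma sumn_ge_size s : all (fun x => 0 < x)%N s -> (size s <= sumn s)%N.
Proof. by elim: s => //= x s IH /andP[x0 /IH]; lia. Qed.
Lemma sumn_ge_mem s x : x \in s -> (x <= sumn s)%N.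
Proof. by elim: s => //= y s IH; rewrite inE => /orP[/eqP ->|/IH]; lia. Qed.

Lemma mem_parts d s : (s \in parts d) = is_part s && (sumn s == d).
Proof.
rewrite mem_filter mem_seqs; apply: andb_idr => /andP[/andP[_ Hs] /eqP <-].
rewrite sumn_ge_size //=; apply/allP => x xs.
by rewrite (allP Hs) // sumn_ge_mem.
Qed.

Lemma uniq_parts d : uniq (parts d).
Proof. exact: filter_uniq (uniq_seqs _ _). Qed.

Lemma is_part_pos s : is_part s -> all (fun x => 0 < x)%N s.
Proof. by case/andP. Qed.
Lemma is_part_sorted s : is_part s -> sorted geq s.
Proof. by case/andP. Qed.

Lemma perm_part r s : is_part r -> is_part s -> perm_eq r s -> r = s.
Proof. by move=> /andP[Hr _] /andP[Hs _]; apply: (sorted_eq geq_trans geq_anti). Qed.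

Definition ins r s := sort geq (r :: s).
Lemma perm_ins r s : perm_eq (ins r s) (r :: s).
Proof. by rewrite /ins perm_sort. Qed.
Lemma is_part_sort s : all (fun x => 0 < x)%N s -> is_part (sort geq s).
Proof. by move=> Hs; rewrite /is_part (sort_sorted geq_total) all_sort. Qed.
Lemma is_part_ins r s : (0 < r)%N -> is_part s -> is_part (ins r s).
Proof. by move=> r0 /is_part_pos Hs; apply: is_part_sort; rewrite /= r0. Qed.
Lemma perm_sumn' (r s : seq nat) : perm_eq r s -> sumn r = sumn s.
Proof. by move=> /perm_sumn. Qed.
Lemma sumn_ins r s : sumn (ins r s) = (r + sumn s)%N.
Proof. by rewrite (perm_sumn' (perm_ins r s)). Qed.

Lemma parts_ins r d : (0 < r <= d)%N ->
  perm_eq [seq x <- parts d | r \in x] [seq ins r x | x <- parts (d - r)].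
Proof.
move=> /andP[r0 rd]; apply: uniq_perm; first exact: filter_uniq (uniq_parts d).
  rewrite map_inj_in_uniq ?uniq_parts // => x y; rewrite !mem_parts => /andP[Hx _] /andP[Hy _] E.
  apply: perm_part => //; rewrite -(perm_cons r).
  by have := perm_ins r x; rewrite E perm_sym => /perm_trans; apply; apply: perm_ins.
move=> x; rewrite mem_filter mem_parts; apply/andP/mapP => [[rx /andP[Hx /eqP dx]]|[y]].
  have Hy : is_part (rem r x).
    case/andP: Hx => H1 H2; apply/andP; split.
      exact: (subseq_sorted geq_trans (rem_subseq r x) H1).
    by apply/allP => z /mem_rem zx; apply: (allP H2).
  exists (rem r x); last first.
    apply: perm_part => //; first exact: is_part_ins.
    by rewrite (permPl (perm_to_rem rx)) perm_sym perm_ins.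
  rewrite mem_parts Hy /=; have := perm_sumn' (perm_to_rem rx) => /=; lia.
rewrite mem_parts => /andP[Hy /eqP dy] ->; split.
  by rewrite (perm_mem (perm_ins r y)) mem_head.
by rewrite is_part_ins //= sumn_ins; apply/eqP; lia.
Qed.

Section PowerSumBasis.
Variables (K : fieldType) (D : nat).
Local Notation Lam := {mpoly K[D]}.
Hypothesis K0 : forall n : nat, n.+1%:R != 0 :> K.
Local Notation hom d f := ((f : Lam) \is d.-homog for (@mnmwgt D)).

Definition mon (s : seq nat) : 'X_{1..D} := [multinom count_mem (nat_of_ord i).+1 s | i < D].
Definition cf (f : Lam) s : K := f@_(mon s).
Definition pp (s : seq nat) : Lam := \prod_(r <- s) pw K D r.
(** Passage from coefficient functions, the form of symmetric functions in the statement, to the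
    ring; [cf] goes back. *)
Definition toL d (c : seq nat -> K) : Lam := \sum_(s <- parts d) c s *: pp s.
Lemma toLE d c : toL d c = \sum_(s <- parts d) c s *: pp s. Proof. by []. Qed.

Lemma monE s (i : 'I_D) : mon s i = count_mem i.+1 s.
Proof. by rewrite mnmE. Qed.

Lemma mon_nil : mon [::] = 0%MM.
Proof. by apply/mnmP => i; rewrite monE. Qed.

Lemma mon_cons (i : 'I_D) s : mon (i.+1 :: s) = (U_(i) + mon s)%MM.
Proof. by apply/mnmP => j; rewrite mnmDE !monE mnm1E /= eqSS. Qed.

Lemma perm_mon r s : perm_eq r s -> mon r = mon s.
Proof. by move=> /permP H; apply/mnmP => i; rewrite !monE H. Qed.

Lemma mnmwgt_mon s : all (fun x => 0 < x <= D)%N s -> mnmwgt (mon s) = sumn s.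
Proof.
elim: s => [_|x s IH /= /andP[/pwP[i ->] Hs]]; last by rewrite mon_cons mnmwgtD mnmwgt1 IH.
by rewrite mon_nil mnmwgt0.
Qed.

Lemma pp_mon s : all (fun x => 0 < x <= D)%N s -> pp s = 'X_[mon s].
Proof.
elim: s => [_|x s IH /= /andP[/pwP[i ->] Hs]].
  by rewrite /pp big_nil mon_nil mpolyX0.
by rewrite /pp big_cons -/(pp s) IH // pwE mon_cons mpolyXD.
Qed.

Lemma hom_pp s : is_part s -> hom (sumn s) (pp s).
Proof.
move=> /is_part_pos; elim: s => [_|x s IH /= /andP[x0 Hs]]; rewrite /pp ?big_nil ?dhomog1 //.
by rewrite big_cons homM ?hom_pw // IH.
Qed.

Lemma parts_small d s : s \in parts d -> (d <= D)%N -> all (fun x => 0 < x <= D)%N s.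
Proof.
rewrite mem_parts => /andP[/is_part_pos Hs /eqP ds] dD; apply/allP => x xs.
by rewrite (allP Hs) //=; apply: leq_trans dD; rewrite -ds sumn_ge_mem.
Qed.

Lemma mon_inj r s : is_part r -> is_part s -> all (fun x => 0 < x <= D)%N r ->
  all (fun x => 0 < x <= D)%N s -> mon r = mon s -> r = s.
Proof.
move=> Pr Ps Hr Hs E; apply: perm_part => //; apply/allP => x.
rewrite mem_cat => xrs; have /pwP[i ->] : (0 < x <= D)%N.
  by case/orP: xrs => [/(allP Hr)|/(allP Hs)].
by move/mnmP: E => /(_ i); rewrite !monE => /eqP.
Qed.

Definition part_of (m : 'X_{1..D}) : seq nat :=
  sort geq (flatten [seq nseq (m i) (nat_of_ord i).+1 | i <- enum 'I_D]).

Lemma part_of_mem m x : x \in part_of m -> (0 < x <= D)%N.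
Proof.
rewrite mem_sort => /flattenP[s /mapP[i _ ->]]; rewrite mem_nseq => /andP[_ /eqP ->].
exact: ord_rng.
Qed.

Lemma is_part_of m : is_part (part_of m).
Proof.
by apply: is_part_sort; apply/allP => x; rewrite -(mem_sort geq) => /part_of_mem /andP[].
Qed.

Lemma mon_part_of m : mon (part_of m) = m.
Proof.
apply/mnmP => i; rewrite monE /part_of; set F := flatten _.
have /permP -> : perm_eq (sort geq F) F by rewrite perm_sort.
rewrite /F count_flatten -map_comp sumnE big_map big_enum /= (bigD1 i) //= count_nseq /= eqxx mul1n.
rewrite big1 ?addn0 // => j ji; rewrite count_nseq /= eqSS.
by have /negbTE -> : (j != i :> nat) by [].
Qed.

Lemma sumn_part_of m : sumn (part_of m) = mnmwgt m.
Proof.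
by rewrite -{2}(mon_part_of m) mnmwgt_mon //; apply/allP => x; apply: part_of_mem.
Qed.

Lemma cf_pp d s f : s \in parts d -> (d <= D)%N -> is_part f -> cf (pp f) s = (f == s)%:R.
Proof.
move=> sd dD Pf; have Hs := parts_small sd dD.
have Ps : is_part s by move: sd; rewrite mem_parts => /andP[].
have [HfD|HfD] := boolP (all (fun x => 0 < x <= D)%N f).
  rewrite /cf pp_mon // mcoeffX; congr (_%:R); congr nat_of_bool.
  by apply/eqP/eqP => [|-> //]; apply: mon_inj.
have /negbTE -> : f != s by apply: contraNneq HfD => ->.
suff -> : pp f = 0 by rewrite /cf mcoeff0.
case/allPn: HfD => x xf; rewrite (allP (is_part_pos Pf)) //= -ltnNge => Dx.
by rewrite /pp (big_rem x) //= pw_gt // mul0r.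
Qed.

Lemma cfD f g s : cf (f + g) s = cf f s + cf g s.
Proof. exact: mcoeffD. Qed.
Lemma cfZ a f s : cf (a *: f) s = a * cf f s.
Proof. exact: mcoeffZ. Qed.
Lemma cf_sum (I : Type) (r : seq I) (P : pred I) (F : I -> Lam) s :
  cf (\sum_(i <- r | P i) F i) s = \sum_(i <- r | P i) cf (F i) s.
Proof. exact: raddf_sum. Qed.

Lemma cf_toL d c s : s \in parts d -> (d <= D)%N -> cf (toL d c) s = c s.
Proof.
move=> sd dD; rewrite /toL cf_sum (bigD1_seq s) ?uniq_parts //= cfZ (cf_pp sd) //; last first.
  by move: sd; rewrite mem_parts => /andP[].
rewrite eqxx mulr1 big_seq_cond big1 ?addr0 // => r /andP[rd rs].
rewrite cfZ (cf_pp sd) ?(negbTE rs) ?mulr0 //.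
by move: rd; rewrite mem_parts => /andP[].
Qed.

Lemma hom_toL d c : hom d (toL d c).
Proof.
rewrite /toL big_seq rpred_sum // => s; rewrite mem_parts => /andP[Ps /eqP <-].
by rewrite rpredZ // hom_pp.
Qed.

Lemma hom_cf d f : hom d f -> (d <= D)%N -> f = toL d (cf f).
Proof.
move=> Hf dD; apply/mpolyP => m.
have [wm|wm] := eqVneq (mnmwgt m) d; last first.
  by rewrite (dhomog_nemf_coeff Hf wm) (dhomog_nemf_coeff (hom_toL d (cf f)) wm).
have Pd : part_of m \in parts d by rewrite mem_parts is_part_of sumn_part_of wm eqxx.
by rewrite -(mon_part_of m) -/(cf _ _) -/(cf _ _) cf_toL.
Qed.

Lemma cf_hom_eq d f g : hom d f -> hom d g -> (d <= D)%N ->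
  {in parts d, cf f =1 cf g} -> f = g.
Proof.
move=> Hf Hg dD E; rewrite (hom_cf Hf dD) (hom_cf Hg dD) /toL.
by apply: eq_big_seq => s sd; rewrite E.
Qed.

Lemma cf_hom0 d e f s : hom d f -> s \in parts e -> (e <= D)%N -> d != e -> cf f s = 0.
Proof.
move=> Hf se eD de; apply: (dhomog_nemf_coeff Hf).
rewrite /= mnmwgt_mon ?(parts_small se) //.
by move: se; rewrite mem_parts => /andP[_ /eqP ->]; rewrite eq_sym.
Qed.

Lemma cf_pwM (i : 'I_D) f s :
  cf ('X_i * f) (i.+1 :: s) = cf f s.
Proof. by rewrite /cf mon_cons mulrC mcoeffMX. Qed.

Lemma cf_pwM0 (i : 'I_D) f s : i.+1 \notin s -> cf ('X_i * f) s = 0.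
Proof.
move=> Hs; rewrite /cf; elim/mpolyind: f => [|c m f _ _ IH]; first by rewrite mulr0 mcoeff0.
rewrite mulrDr mcoeffD IH addr0 -scalerAr mcoeffZ -mpolyXD mcoeffX.
case: eqP => [E|]; last by rewrite mulr0.
by move/mnmP: E => /(_ i); rewrite mnmDE mnm1E eqxx monE => E; rewrite -has_pred1 has_count -E in Hs.
Qed.

Section Form.
Variables q t : K.

Definition zg (s : seq nat) : K :=
  (zfac s)%:R * \prod_(r <- s) ((1 - q ^+ r) / (1 - t ^+ r)).
Definition Bform d (f g : Lam) : K := \sum_(s <- parts d) cf f s * cf g s * zg s.
Definition zeta r : K := r%:R * ((1 - q ^+ r) / (1 - t ^+ r)).

(** Absent parts contribute i^0 0! = 1, so the product over distinct parts can run over a fixed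
    range, where it only sees multiplicities. *)
Lemma zfacE N s : all (fun x => x < N)%N s ->
  zfac s = (\prod_(i < N) (i ^ count_mem (i : nat) s * (count_mem (i : nat) s)`!))%N.
Proof.
move=> Hs; rewrite /zfac -(big_mkord xpredT (fun i => i ^ count_mem i s * (count_mem i s)`!)%N).
rewrite [RHS](bigID (fun i => i \in s)) /= [X in _ = (_ * X)%N]big1 ?muln1 => [|i Hi]; last first.
  by rewrite (count_memPn Hi).
rewrite -[RHS]big_filter; apply: perm_big; apply: uniq_perm.
- exact: undup_uniq.
- exact: filter_uniq (iota_uniq _ _).
move=> i; rewrite mem_undup mem_filter mem_index_iota /=.
by apply: esym; apply: andb_idr => /(allP Hs).
Qed.

Lemma perm_zg r s : perm_eq r s -> zg r = zg s.
Proof.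
move=> E; rewrite /zg (perm_big _ E) /=; congr (_%:R * _).
have HN u : all (fun x => x < (foldr maxn 0 u).+1)%N u.
  apply/allP => x; rewrite ltnS; elim: u => //= y u IH; rewrite inE leq_max.
  by case/orP => [/eqP ->|/IH ->]; rewrite ?leqnn ?orbT.
rewrite (zfacE (HN r)) (@zfacE (foldr maxn 0 r).+1%N); last by rewrite -(perm_all _ E).
by apply: eq_bigr => i _; rewrite (permP E).
Qed.

Lemma zg_cons r s : zg (r :: s) = zg s * zeta r * (count_mem r s).+1%:R.
Proof.
rewrite /zg big_cons /zeta.
suff -> : zfac (r :: s) = (zfac s * r * (count_mem r s).+1)%N by rewrite !natrM; ring.
pose N := (foldr maxn 0%N (r :: s)).+1.
have HN : all (fun x => x < N)%N (r :: s).
  apply/allP => x; rewrite /N ltnS; elim: (r :: s) => //= y u IH; rewrite inE leq_max.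
  by case/orP => [/eqP ->|/IH ->]; rewrite ?leqnn ?orbT.
have rN : (r < N)%N by case/andP: HN.
rewrite (zfacE HN) (@zfacE N); last by case/andP: HN.
rewrite (bigD1 (Ordinal rN)) //= eqxx add1n expnS factS [in RHS](bigD1 (Ordinal rN)) //=.
rewrite [X in (_ * X = _)%N](eq_bigr (fun i : 'I_N => i ^ count_mem (i : nat) s * (count_mem (i : nat) s)`!)%N).
  ring.
by move=> i /eqP ir; rewrite (_ : (r == i) = false) //; apply/eqP => E; apply: ir; apply: val_inj.
Qed.

Lemma B_D d f g h : Bform d (f + g) h = Bform d f h + Bform d g h.
Proof. by rewrite /Bform -big_split; apply: eq_bigr => s _; rewrite cfD !mulrDl. Qed.
Lemma B_Z d a f h : Bform d (a *: f) h = a * Bform d f h.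
Proof. by rewrite /Bform mulr_sumr; apply: eq_bigr => s _; rewrite cfZ !mulrA. Qed.
Lemma B_sym d f g : Bform d f g = Bform d g f.
Proof. by apply: eq_bigr => s _; rewrite [cf f s * _]mulrC. Qed.
Lemma B_sum d (I : Type) (r : seq I) (P : pred I) (F : I -> Lam) h :
  Bform d (\sum_(i <- r | P i) F i) h = \sum_(i <- r | P i) Bform d (F i) h.
Proof.
elim: r => [|i r IH]; rewrite ?big_nil ?big_cons.
  by rewrite /Bform big1 // => s _; rewrite /cf mcoeff0 !mul0r.
by case: (P i); rewrite ?B_D IH.
Qed.

(** Multiplication by p_r is adjoint to zeta_r d/dp_r: removing one part r is a bijection onto the
    partitions of d - r, and the multiplicity of r in z gives the factor brought down by
    differentiation. *)
Lemma B_adj d (i : 'I_D) f g :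
  Bform d ('X_i * f) g = if (i < d)%N then zeta i.+1 * Bform (d - i.+1) f g^`M(i) else 0.
Proof.
rewrite /Bform (bigID (fun s => i.+1 \in s)) /= [X in _ + X]big1 ?addr0; last first.
  by move=> s Hs; rewrite cf_pwM0 // !mul0r.
case: ifP => id; last first.
  rewrite big_seq_cond big1 // => s /andP[]; rewrite mem_parts => /andP[_ /eqP ds] /sumn_ge_mem.
  by rewrite ds id.
rewrite -big_filter (perm_big _ (parts_ins (_ : 0 < i.+1 <= d)%N)) //= big_map mulr_sumr.
apply: eq_bigr => s _.
rewrite (perm_zg (perm_ins _ _)) zg_cons /cf (perm_mon (perm_ins _ _)).
rewrite -/(cf _ _) cf_pwM mcoeff_deriv monE mon_cons addmC -mulr_natr; ring.
Qed.

End Form.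
End PowerSumBasis.

Lemma sum_ord_min (V : nmodType) (F : nat -> V) D k :
  (forall r, (D <= r)%N -> F r = 0) ->
  \sum_(r < k.+1) F r = \sum_(i < D | (i <= k)%N) F i.
Proof.
move=> F0; have [kD|Dk] := leqP k.+1 D.
  by rewrite (big_ord_widen_cond D xpredT F kD).
rewrite [RHS](eq_bigl xpredT) => [|i]; last by apply/idP; have := ltn_ord i; lia.
rewrite (big_ord_widen_cond k.+1 xpredT F (ltnW Dk)) [RHS]big_mkcond /=.
by apply: eq_bigr => i _; case: ltnP => // /F0.
Qed.

(** * Self-adjointness of the Macdonald operator *)

Section SelfAdjoint.
Variables (K : fieldType) (D : nat).
Local Notation Lam := {mpoly K[D]}.
Hypothesis K0 : forall n : nat, n.+1%:R != 0 :> K.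
Variables q t : K.
Hypothesis t0 : t != 0.
Hypothesis q1 : forall r : nat, q ^+ r.+1 != 1.
Hypothesis t1 : forall r : nat, t ^+ r.+1 != 1.
Local Notation hom d f := ((f : Lam) \is d.-homog for (@mnmwgt D)).
Local Notation G := (GN D (fun r => 1 - t^-1 ^+ r)).
Local Notation U := (@Tk K D (fun r => q ^+ r - 1)).
Local Notation H := (@Tk K D (fun=> 1)).
Local Notation EE := (@EE K D q t).
Local Notation En := (@En K D q t).
Local Notation B := (@Bform K D q t).

Lemma GN_rec (b : nat -> K) k :
  k.+1%:R *: GN D b k.+1 = \sum_(i < D | (i <= k)%N) b i.+1 *: ('X_i * GN D b (k - i)).
Proof.
have [_ /(_ k (ltnSn k))] := GNP D K0 b k.+1; rewrite mulr_natl scaler_nat => ->.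
rewrite (sum_ord_min (D := D) (F := fun r => b r.+1 *: pw K D r.+1 * GN D b (k - r))).
  by apply: eq_bigr => i _; rewrite pwE scalerAl.
by move=> r Dr; rewrite pw_gt // scaler0 mul0r.
Qed.

(** Since (1 - t^(-r)) zeta_r = t^(-r) r (q^r - 1), the recurrences [GN_rec] and [Tk_newton]
    correspond to each other under [B_adj]: multiplication by G_k is adjoint to t^(-k) U_k. *)
Lemma B_G k d f g :
  B d (G k * f) g = if (k <= d)%N then t^-1 ^+ k * B (d - k) f (U k g) else 0.
Proof.
elim/ltn_ind: k d f g => -[|k] IH d f g.
  by rewrite G0 // mul1r subn0 expr0 mul1r Tk0.
apply: (mulfI (K0 k)); rewrite -B_Z scalerAl GN_rec mulr_suml B_sum.
transitivity (\sum_(i < D | (i <= k)%N) if (k < d)%N then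
    t^-1 ^+ k.+1 * B (d - k.+1) f ((i.+1%:R * (q ^+ i.+1 - 1)) *: U (k - i) g^`M(i)) else 0).
  apply: eq_bigr => i ik; rewrite -scalerAl B_Z -mulrA B_adj.
  case: (ltnP k d) => kd; last first.
    case: ifP => id; last by rewrite mulr0.
    rewrite IH ?leq_subr //; last lia.
    have -> : (k - i <= d - i.+1)%N = false by apply/negbTE; lia.
    by rewrite !mulr0.
  have -> : (i < d)%N by lia.
  rewrite IH; last by have := ltn_ord i; lia.
  have -> : (k - i <= d - i.+1)%N by lia.
  have -> : (d - i.+1 - (k - i) = d - k.+1)%N by lia.
  rewrite ![B _ f _]B_sym B_Z !mulrA; congr (_ * _).
  have -> : k.+1 = (i.+1 + (k - i))%N by lia.
  rewrite /zeta exprD.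
  have ti : 1 - t ^+ i.+1 != 0 by rewrite subr_eq0 eq_sym t1.
  have tn : t ^+ i.+1 != 0 by rewrite expf_neq0.
  rewrite !exprVn; field.
  by rewrite ti tn expf_neq0.
case: ifP => kd; last by rewrite big1 ?mulr0.
rewrite -mulr_sumr mulrCA; congr (_ * _).
by rewrite B_sym -B_Z Tk_newton B_sum; apply: eq_bigr => i _; rewrite B_sym.
Qed.

(** By [B_G] the pairing of E f with g is sum_k t^(-k) <U_k f, U_k g>, visibly symmetric in f and
    g. *)
Lemma B_EE d f g : B d (EE f) g = B d f (EE g).
Proof.
have S a b : B d (EE a) b = \sum_(k < D.+1) if (k <= d)%N then t^-1 ^+ k * B (d - k) (U k a) (U k b) else 0.
  by rewrite EE_E B_sum; apply: eq_bigr => k _; rewrite B_G.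
rewrite S [RHS]B_sym S; apply: eq_bigr => k _.
by case: ifP => // _; rewrite B_sym.
Qed.

Lemma zg_neq0 s : is_part s -> zg q t s != 0.
Proof.
move=> /is_part_pos Hs; rewrite /zg mulf_eq0 negb_or; apply/andP; split.
  suff : (0 < zfac s)%N by case: (zfac s) => // n _; apply: K0.
  rewrite /zfac big_seq; apply: (big_ind (fun x => 0 < x)%N) => // [x y x0 y0|i].
    by rewrite muln_gt0 x0.
  by rewrite mem_undup => /(allP Hs) i0; rewrite muln_gt0 fact_gt0 expn_gt0 i0.
rewrite big_seq; apply: (big_ind (fun x : K => x != 0)); first exact: oner_neq0.
  by move=> x y x0 y0; rewrite mulf_neq0.
move=> [|r] /(allP Hs) // _; rewrite mulf_neq0 ?invr_eq0 // subr_eq0 eq_sym.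
  exact: q1.
exact: t1.
Qed.

Lemma B_pp d f s : s \in parts d -> (d <= D)%N -> B d f (pp K D s) = cf f s * zg q t s.
Proof.
move=> sd dD; rewrite /Bform (bigD1_seq s) ?uniq_parts //=.
have Ps : is_part s by move: sd; rewrite mem_parts => /andP[].
rewrite (cf_pp _ sd) // eqxx mulr1 big_seq_cond big1 ?addr0 // => r /andP[rd rs].
by rewrite (cf_pp _ rd) // eq_sym (negbTE rs) mulr0 mul0r.
Qed.

Lemma B_nondeg d f : hom d f -> (d <= D)%N -> (forall g, hom d g -> B d f g = 0) -> f = 0.
Proof.
move=> Hf dD H0; apply: (cf_hom_eq Hf) => //; first exact: rpred0.
move=> s sd; have := sd; rewrite mem_parts => /andP[Ps /eqP sd'].
have := H0 (pp K D s); rewrite -{1}sd' hom_pp // (B_pp _ sd dD) => /(_ isT) /eqP.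
by rewrite mulf_eq0 (negbTE (zg_neq0 Ps)) orbF => /eqP ->; rewrite /cf mcoeff0.
Qed.
End SelfAdjoint.

(** * Monomial coefficients *)

Section MonomialCoefficients.
Variables (K : fieldType) (D : nat).
Local Notation Lam := {mpoly K[D]}.
Hypothesis K0 : forall n : nat, n.+1%:R != 0 :> K.
Local Notation hom d f := ((f : Lam) \is d.-homog for (@mnmwgt D)).
Local Notation H := (@Tk K D (fun=> 1)).

(* [hc f s] is the coefficient of x^s in the symmetric function f. *)
Definition Hs (f : Lam) (s : seq nat) : Lam := foldr (fun k g => H k g) f s.
Definition hc (f : Lam) (s : seq nat) : K := (Hs f s)@_0%MM.

Lemma hcD f g s : hc (f + g) s = hc f s + hc g s.
Proof.
rewrite /hc; have -> : Hs (f + g) s = Hs f s + Hs g s by elim: s => //= k s ->; rewrite TkD.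
exact: mcoeffD.
Qed.
Lemma hcZ a f s : hc (a *: f) s = a * hc f s.
Proof.
rewrite /hc; have -> : Hs (a *: f) s = a *: Hs f s by elim: s => //= k s ->; rewrite TkZ.
exact: mcoeffZ.
Qed.
Lemma hc0 s : hc 0 s = 0.
Proof. by rewrite -[0](scale0r 0) hcZ mul0r. Qed.
Lemma hc_sum (I : Type) (r : seq I) (P : pred I) (F : I -> Lam) s :
  hc (\sum_(i <- r | P i) F i) s = \sum_(i <- r | P i) hc (F i) s.
Proof.
elim: r => [|i r IH]; rewrite ?big_nil ?big_cons ?hc0 //.
by case: (P i); rewrite ?hcD IH.
Qed.

Lemma Hs_H k f s : H k (Hs f s) = Hs (H k f) s.
Proof. by elim: s => //= j s IH; rewrite Tk_comm IH. Qed.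

Lemma hc_H k f s : hc (H k f) s = hc f (k :: s).
Proof. by rewrite /hc /= Hs_H. Qed.

Lemma perm_Hs f r s : perm_eq r s -> Hs f r = Hs f s.
Proof.
elim: r s => [|k r IH] s E.
  by move: E; rewrite perm_sym => /perm_small_eq ->.
have ks : k \in s by rewrite -(perm_mem E) mem_head.
case/splitPr: ks E => s1 s2 E.
have E' : perm_eq r (s1 ++ s2) by rewrite -(perm_cons k) (permPl E) perm_catC /= perm_cons perm_catC.
rewrite /= (IH _ E') /Hs !foldr_cat /= -/(Hs f s2).
by elim: s1 {E E'} => //= j s1 <-; rewrite Tk_comm.
Qed.

Lemma perm_hc f r s : perm_eq r s -> hc f r = hc f s.
Proof. by move=> /(perm_Hs f) E; rewrite /hc E. Qed.

Lemma hc_0cons f s : hc f (0%N :: s) = hc f s.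
Proof. by rewrite /hc /= Tk0. Qed.

Lemma hc_pos f s : hc f s = hc f [seq x <- s | 0 < x]%N.
Proof.
elim: s f => //= -[|k] s IH f /=; first by rewrite hc_0cons.
by rewrite -!hc_H IH.
Qed.

Lemma hc_sort f s : hc f s = hc f (sort geq s).
Proof. by apply: perm_hc; rewrite perm_sym perm_sort. Qed.

(** In finitely many variables p_r is sum_j x_j^r, so multiplying by it lowers one exponent of the
    monomial to be read off in f. *)
Lemma hc_pw r f s : (0 < r <= D)%N -> hc (pw K D r * f) s =
  \sum_(j < size s | (r <= nth 0 s j)%N) hc f (set_nth 0%N s j (nth 0%N s j - r)%N).
Proof.
move=> rD; have [i ri] := pwP rD; elim: s f => [|k s IH] f.
  rewrite big_pred0 => [|[]//]; rewrite /hc /= rmorphM /= ri pwE mcoeffX.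
  by rewrite -mdeg_eq0 mdeg1 mul0r.
rewrite -hc_H Tk_pwM // hcD IH /= scale1r big_mkcond /= [RHS]big_mkcond big_ord_recl /=.
rewrite addrC; congr (_ + _); last by case: (r <= k)%N; [rewrite hc_H | rewrite hc0].
by apply: eq_bigr => j _; rewrite add0n; case: ifP; rewrite ?hc_H.
Qed.

Lemma hcC a s : hc a%:MP s = if all (fun x => x == 0%N) s then a else 0.
Proof.
elim: s => [|k s IH] /=; first by rewrite /hc mcoeffC eqxx mulr1.
by rewrite -hc_H TkC; case: eqP => //= _; rewrite hc0.
Qed.

Section Eval.
Variable m : nat.

Definition xev : Lam -> {mpoly K[m]} := ev (@mpolyC m K) (fun r => \sum_(j < m) 'X_j ^+ r).
HB.instance Definition _ := GRing.RMorphism.copy xev (ev (@mpolyC m K) (fun r => \sum_(j < m) 'X_j ^+ r)).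
Definition sq (a : 'X_{1..m}) : seq nat := [seq a i | i <- enum 'I_m].

Lemma size_sq a : size (sq a) = m.
Proof. by rewrite size_map size_enum_ord. Qed.
Lemma nth_sq a (i : 'I_m) : nth 0%N (sq a) i = a i.
Proof. by rewrite (nth_map i) ?size_enum_ord // nth_ord_enum. Qed.

Lemma mcoeffXnM (j : 'I_m) r (g : {mpoly K[m]}) (a : 'X_{1..m}) :
  ('X_j ^+ r * g)@_a = if (r <= a j)%N then g@_(a - U_(j) *+ r) else 0.
Proof.
rewrite mpolyXn; case: ifP => ra.
  have Ua : (U_(j) *+ r <= a)%MM.
    apply/mnm_lepP => i; rewrite mulmnE mnm1E; case: eqP => [<-|_]; first by rewrite mul1n.
    by rewrite mul0n.
  by have := mcoeffMX g (U_(j) *+ r)%MM (a - U_(j) *+ r)%MM; rewrite addmC submK // mulrC.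
elim/mpolyind: g => [|c b g _ _ IH]; first by rewrite mulr0 mcoeff0.
rewrite mulrDr mcoeffD IH addr0 -scalerAr mcoeffZ -mpolyXD mcoeffX.
case: eqP => [E|]; last by rewrite mulr0.
by move: ra; rewrite -E mnmDE mulmnE mnm1E eqxx mul1n leq_addr.
Qed.

Lemma mcoeff_xev f a : (xev f)@_a = hc f (sq a).
Proof.
elim/Lam_ind: f a => [c|f g Hf Hg|i f Hf] a.
- rewrite /xev evC mcoeffC hcC; case: eqP => [->|/eqP a0].
    have -> : all (fun x => x == 0%N) (sq 0%MM) by apply/allP => x /mapP[j _ ->]; rewrite mnm0E.
    by rewrite mulr1.
  rewrite mulr0; case: ifP => // /allP Ha; case/eqP: a0; apply/mnmP => j; rewrite mnm0E.
  by apply/eqP/Ha/map_f; rewrite mem_enum.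
- by rewrite rmorphD mcoeffD Hf Hg hcD.
rewrite rmorphM /= /xev evX -/xev mulr_suml raddf_sum /= -pwE hc_pw ?ord_rng // size_sq.
rewrite [RHS]big_mkcond; apply: eq_bigr => j _; rewrite mcoeffXnM nth_sq.
case: ifP => // ia; rewrite -/(xev f) Hf; congr hc.
apply: (@eq_from_nth _ 0%N); first by rewrite size_set_nth !size_sq; apply/esym/maxn_idPr.
rewrite size_sq => k km; rewrite nth_set_nth /=.
have -> : k = Ordinal km by []. rewrite !nth_sq mnmBE mulmnE mnm1E -val_eqE /= eq_sym.
by case: eqP => [e|_]; rewrite ?mul1n ?mul0n ?subn0 //; congr (a _ - _)%N; apply: val_inj.
Qed.
End Eval.

(* Coefficient of x^s in p_r, from the expansion of a product of power sums over functions. *)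
Lemma hc_ppE r s : all (fun x => 0 < x <= D)%N r -> hc (pp K D r) s = (Rpm r s)%:R.
Proof.
move=> Hr; set m := size s.
pose a : 'X_{1..m} := [multinom nth 0%N s i | i < m].
have Es : s = sq a.
  apply: (@eq_from_nth _ 0%N); first by rewrite size_sq.
  by move=> k km; rewrite -[k]/(nat_of_ord (Ordinal km)) nth_sq mnmE.
rewrite {1}Es -mcoeff_xev /pp rmorph_prod /=.
have -> : \prod_(i <- r) xev m (pw K D i) = \prod_(i < size r) \sum_(j < m) 'X_j ^+ nth 0%N r i.
  rewrite (big_nth 0%N) big_mkord; apply: eq_bigr => i _.
  by rewrite /xev ev_pw // (allP Hr) ?mem_nth.
rewrite bigA_distr_bigA raddf_sum /= /Rpm.
rewrite (eq_bigr (fun f : {ffun 'I_(size r) -> 'I_m} =>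
   ([forall j : 'I_m, (\sum_(i | f i == j) nth 0 r i)%N == nth 0%N s j])%:R)); last first.
  move=> f _; rewrite (eq_bigr (fun i => 'X_[U_(f i) *+ nth 0%N r i])) => [|i _]; last by rewrite mpolyXn.
  rewrite -(big_morph _ (@mpolyXD m K) (@mpolyX0 m K)) mcoeffX; congr (_%:R); congr nat_of_bool.
  have Hj j : (\sum_(i < size r) U_(f i) *+ nth 0%N r i)%MM j = (\sum_(i | f i == j) nth 0 r i)%N.
    rewrite mnm_sumE [RHS]big_mkcond; apply: eq_bigr => i _.
    by rewrite mulmnE mnm1E; case: eqP; rewrite ?mul1n ?mul0n.
  apply/eqP/forallP => [E j|E]; first by rewrite -Hj E mnmE.
  by apply/mnmP => j; rewrite Hj (eqP (E j)) mnmE.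
rewrite -natr_sum; congr (_%:R).
rewrite -sum1_card [RHS]big_mkcond /=; apply: eq_bigr => f _.
by rewrite inE; case: ifP.
Qed.
End MonomialCoefficients.

(** A nonzero count provides a map from the parts of r onto the parts of s, surjective because the
    parts of s are positive. If the numbers of parts agree it is a bijection, and no parts are
    merged. *)
Lemma Rpm_tri r s : all (fun x => 0 < x)%N s -> Rpm r s != 0%N ->
  (size s <= size r)%N /\ (size s = size r -> perm_eq s r).
Proof.
move=> Hs; rewrite -lt0n card_gt0 => /set0Pn[f]; rewrite inE => /forallP Hf.
have f_surj j : exists i, f i == j.
  case: (pickP (fun i => f i == j)) => [i fi|H0]; first by exists i.
  have := Hf j; rewrite big_pred0 // => /eqP E.
  by have := all_nthP 0%N Hs j (ltn_ord j); rewrite -E.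
pose g j := xchoose (f_surj j).
have gK : cancel g f by move=> j; apply/eqP; apply: xchooseP (f_surj j).
have g_inj := can_inj gK.
split=> [|E]; first by have := leq_card g g_inj; rewrite !card_ord.
have [h gh hg] : bijective g by apply: inj_card_bij; rewrite ?card_ord ?E.
have fE i j : (f i == j) = (i == g j).
  by apply/eqP/eqP => [<-|->]; [rewrite -{2}(hg i) gK hg | rewrite gK].
have E1 u : u = [seq nth 0%N u (i : 'I_(size u)) | i <- enum 'I_(size u)].
  by rewrite (map_comp (nth 0%N u)) val_enum_ord map_nth_iota0 // take_size.
rewrite (E1 s) (E1 r).
have -> : [seq nth 0%N s (i : 'I_(size s)) | i <- enum 'I_(size s)] =
          [seq nth 0%N r (i : 'I_(size r)) | i <- [seq g j | j <- enum 'I_(size s)]].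
  rewrite -[RHS]map_comp; apply: eq_map => j /=; rewrite -(eqP (Hf j)).
  by rewrite (big_pred1 (g j)) // => i; rewrite fE.
apply: perm_map; apply: uniq_perm.
- by rewrite map_inj_uniq // enum_uniq.
- exact: enum_uniq.
by move=> i; rewrite mem_enum inE -(hg i) map_f // mem_enum.
Qed.

Lemma Rpm_diag r : Rpm r r != 0%N.
Proof.
rewrite -lt0n card_gt0; apply/set0Pn; exists [ffun i => i]; rewrite inE.
by apply/forallP => j; rewrite (big_pred1 j) // => i; rewrite ffunE.
Qed.

(** * Triangularity of the Macdonald operator *)

Lemma filter_neq_rem (T : eqType) (s : seq T) x : uniq s -> [seq y <- s | y != x] = rem x s.
Proof. by move=> /rem_filter ->. Qed.

(* Lagrange interpolation, read off at the top coefficient. *)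
Lemma lagrange_lead (F : fieldType) (s : seq F) (Q : {poly F}) : uniq s -> (size Q <= size s)%N ->
  \sum_(w <- s) Q.[w] / \prod_(v <- s | v != w) (w - v) = Q`_(size s).-1.
Proof.
move=> us sQ.
pose l w : {poly F} := \prod_(v <- s | v != w) ('X - v%:P).
have lE w : l w = \prod_(v <- rem w s) ('X - v%:P) by rewrite /l -big_filter filter_neq_rem.
have sl w : w \in s -> size (l w) = size s.
  move=> ws; rewrite lE size_prod_XsubC size_rem // prednK //.
  by case: (s) ws.
pose P : {poly F} := \sum_(w <- s) (Q.[w] / \prod_(v <- s | v != w) (w - v)) *: l w.
have nz w : \prod_(v <- s | v != w) (w - v) != 0.
  by rewrite prodf_seq_neq0; apply/allP => v _; apply/implyP => vw; rewrite subr_eq0 eq_sym.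
have PQ w : w \in s -> P.[w] = Q.[w].
  move=> ws; rewrite /P horner_sum (bigD1_seq w) //= [X in _ + X]big_seq_cond [X in _ + X]big1 ?addr0 => [|v /andP[vs vw]].
    rewrite hornerZ /l horner_prod.
    rewrite [X in _ * X](eq_bigr (fun v => w - v)) => [|v _]; last by rewrite !hornerE.
    by rewrite divfK.
  suff lv : (l v).[w] == 0 by rewrite hornerZ (eqP lv) mulr0.
  rewrite /l horner_prod prodf_seq_eq0; apply/hasP; exists w => //.
  by rewrite eq_sym vw !hornerE subrr eqxx.
have sP : (size P <= size s)%N.
  rewrite /P big_seq (leq_trans (size_sum _ _ _)) //; apply/bigmax_leqP_seq => w ws _.
  by rewrite (leq_trans (size_scale_leq _ _)) // sl.
have E : Q - P = 0.
  apply/eqP; case: eqP => // /eqP QP0.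
  have /(max_poly_roots QP0) H : all (root (Q - P)) s.
    by apply/allP => w ws; rewrite rootE !hornerE PQ // subrr.
  have := H us; rewrite ltnNge (leq_trans (size_polyD _ _)) //.
  by rewrite size_polyN geq_max sQ sP.
have -> : Q = P by apply/eqP; rewrite -subr_eq0 E.
rewrite [in RHS]/P coef_sum; apply: eq_big_seq => w ws.
rewrite PQ // coefZ -(sl w ws) -lead_coefE lE (monicP (monic_prod_XsubC _ _ _)).
by rewrite mulr1.
Qed.

(** Multiplication of a series by (1 - y s)/(1 - x s), with the denominator cleared. *)
Lemma conv_geom (R : comNzRingType) (a g : nat -> R) x y k :
  g 0%N = 1 -> (forall j, g j.+1 = x ^+ j.+1 - y * x ^+ j) ->
  conv a g k.+1 - x * conv a g k = a k.+1 - y * a k.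
Proof.
move=> g0 gS; rewrite /conv big_ord_recr /= subnn g0 big_ord_recr /= subSnn gS expr1 expr0.
rewrite [X in _ - x * X]big_ord_recr /= subnn g0.
have -> : \sum_(i < k) a i * g (k.+1 - i)%N = x * \sum_(i < k) a i * g (k - i)%N.
  rewrite mulr_sumr; apply: eq_bigr => i _; have ik := ltn_ord i.
  rewrite subSn ?(ltnW ik) // (_ : (k - i = (k - i.+1).+1)%N); last lia.
  by rewrite !gS !exprS; ring.
ring.
Qed.

(** * Moments of the coefficients of the q-difference operator *)

Section Moments.
Variables (L : fieldType) (t : L).
Hypothesis t0 : t != 0.

(** Macdonald's A_i(x; t), indexed by the value of the variable instead of its number; it has this
    meaning for lists without repetition. *)
Definition Aco (xs : seq L) x : L := \prod_(y <- xs | y != x) ((t * x - y) / (x - y)).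

(** Interpolation of prod_y (t X - y) at 0 and at the points of [xs]: the top coefficient is t^n,
    the node 0 contributes 1, and the node x contributes (t - 1) A_x. *)
Lemma Aco_sum xs : uniq xs -> 0 \notin xs ->
  (t - 1) * (\sum_(x <- xs) Aco xs x) + 1 = t ^+ size xs.
Proof.
move=> us z0.
pose Q : {poly L} := \prod_(y <- xs) (t *: 'X - y%:P).
have sQ : (size Q <= (size xs).+1)%N /\ Q`_(size xs) = t ^+ size xs.
  rewrite /Q; elim: xs {us z0 Q} => [|y xs [IH1 IH2]]; first by rewrite big_nil size_poly1 coefC.
  rewrite big_cons mulrBl; split.
    rewrite (leq_trans (size_polyD _ _)) // geq_max size_polyN -scalerAl mul_polyC.
    rewrite !(leq_trans (size_scale_leq _ _)) ?(leq_trans IH1) //.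
    by rewrite mulrC (leq_trans (size_polyMleq _ _)) // size_polyX addn2.
  by rewrite coefB -scalerAl coefZ mulrC coefXM /= IH2 coefCM nth_default ?mulr0 ?subr0 -?exprSr.
have := @lagrange_lead _ (0 :: xs) Q; rewrite /= z0 us => /(_ isT sQ.1).
rewrite sQ.2 big_cons /= => <-; rewrite addrC; congr (_ + _).
  rewrite big_cons eqxx /= /Q horner_prod.
  rewrite [X in _ / X]big_seq_cond [X in _ / X](eq_bigl (fun v => (v \in xs) && true)).
    rewrite -[X in _ / X]big_seq_cond.
    rewrite (eq_bigr (fun v => 0 - v)) => [|v _]; last by rewrite !hornerE.
    rewrite divff // prodf_seq_neq0; apply/allP => v vs /=; rewrite sub0r oppr_eq0.
    by apply: contraNneq z0 => <-.
  by move=> v; case: (boolP (v \in xs)) => //= vs; apply: contraNneq z0 => <-.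
rewrite mulr_sumr; apply: eq_big_seq => x xs_x; rewrite big_cons.
have x0 : x != 0 by apply: contraNneq z0 => <-.
rewrite eq_sym x0 subr0 /Q horner_prod (bigD1_seq x) //= !hornerE /Aco.
rewrite [X in _ = _ * X / _](eq_bigr (fun y => t * x - y)) => [|y _]; last by rewrite !hornerE.
rewrite prodf_div; set P1 := \prod_(_ <- _ | _) _; set P2 := \prod_(_ <- _ | _) _.
have nz : P2 != 0 by rewrite prodf_seq_neq0; apply/allP => v _; apply/implyP => vw; rewrite subr_eq0 eq_sym.
by field; rewrite x0 nz.
Qed.

(** Partial fractions of prod_x (t - x s)/(1 - x s), coefficient by coefficient: the (t - 1) A_x are
    the weights of the terms 1/(1 - x s), and the value at s = infinity is the constant 1. One
    variable is adjoined at a time. *)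
Lemma moment (K : fieldType) (h : {rmorphism K -> L}) (K0 : forall n : nat, n.+1%:R != 0 :> K)
   xs D a : uniq xs -> 0 \notin xs ->
  newton D (fun r => (1 - t^-1 ^+ r) * \sum_(x <- xs) x ^+ r) a ->
  forall k, (k <= D)%N ->
  (t - 1) * (\sum_(x <- xs) Aco xs x * x ^+ k) + (k == 0%N)%:R = t ^+ size xs * a k.
Proof.
elim: xs a => [|x0 xs IH] a us z0 Ha k kD.
  rewrite big_nil mulr0 add0r mul1r; case: k kD => [|k] kD; first by case: Ha => ->.
  have Z : newton D (fun r => (1 - t^-1 ^+ r) * \sum_(x <- [::]) x ^+ r) (fun k => (k == 0%N)%:R).
    by split=> // j _; rewrite mulr0 big1 // => r _; rewrite big_nil mulr0 mul0r.
  by rewrite (newton_uniq h K0 Ha Z kD).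
case/andP: (us) => x0xs us'; move: (z0); rewrite inE negb_or eq_sym => /andP[x00 z0'].
have Hg := newton_geom x0 (x0 / t) D.
set g := (fun k : nat => match k with 0%N => 1 | _ => _ end) in Hg.
have Ha' := newtP h K0 (fun r => (1 - t^-1 ^+ r) * \sum_(x <- xs) x ^+ r) D.
set a' := newt h _ in Ha'.
have Hc : newton D (fun r => (1 - t^-1 ^+ r) * \sum_(x <- x0 :: xs) x ^+ r) (conv a' g).
  apply: eq_newton (newton_conv Ha' Hg) => // r _.
  by rewrite big_cons mulrDr addrC expr_div_n exprVn; congr (_ + _); ring.
rewrite (newton_uniq h K0 Ha Hc kD) {a Ha}.
have AE x : x \in xs -> Aco (x0 :: xs) x = (t * x - x0) / (x - x0) * Aco xs x.
  move=> xxs; rewrite /Aco big_cons; case: eqP => // e.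
  by move: x0xs; rewrite e xxs.
have xx0 x : x \in xs -> x - x0 != 0.
  by move=> xxs; rewrite subr_eq0; apply: contraNneq x0xs => <-.
elim: k kD => [|k IHk] kD.
  rewrite /conv big_ord1 /= (eq_bigr (Aco (x0 :: xs))) => [|x _]; last by rewrite mulr1.
  by rewrite Aco_sum //; case: Ha' => -> _; rewrite !mulr1.
have := @conv_geom L a' g x0 (x0 / t) k erefl (fun j => erefl : g j.+1 = x0 ^+ j.+1 - x0 / t * x0 ^+ j).
move=> /(canRL (subrK _)) ->; rewrite mulrDr mulrCA -IHk; last exact: ltnW.
have H1 := IH a' us' z0' Ha' k.+1 kD; have H2 := IH a' us' z0' Ha' k (ltnW kD).
rewrite /= exprS mulrBr -!mulrA -[t ^+ size xs * a' k.+1]H1.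
have -> : t * (t ^+ size xs * (x0 * (t^-1 * a' k))) = x0 * (t ^+ size xs * a' k).
  by field.
rewrite -H2 !big_cons !exprS.
have -> : \sum_(x <- xs) Aco (x0 :: xs) x * x ^+ k.+1 = x0 * (\sum_(x <- xs) Aco (x0 :: xs) x * x ^+ k)
   + (t * (\sum_(x <- xs) Aco xs x * x ^+ k.+1) - x0 * \sum_(x <- xs) Aco xs x * x ^+ k).
  rewrite !mulr_sumr -sumrB -big_split; apply: eq_big_seq => x xxs /=.
  by rewrite AE // exprS; field; apply: xx0.
rewrite /=; ring.
Qed.
End Moments.

Lemma size_prod_mono (R : idomainType) (I : Type) (r : seq I) (P : pred I) (F G : I -> {poly R}) :
  (forall i, P i -> G i != 0) -> (forall i, P i -> size (F i) <= size (G i))%N ->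
  (size (\prod_(i <- r | P i) F i)%R <= size (\prod_(i <- r | P i) G i)%R)%N.
Proof.
move=> G0 FG.
suff [] : \prod_(i <- r | P i) G i != 0 /\
  (size (\prod_(i <- r | P i) F i)%R <= size (\prod_(i <- r | P i) G i)%R)%N by [].
apply: (big_ind2 (fun x y : {poly R} => y != 0 /\ (size x <= size y)%N)).
- by rewrite oner_neq0.
- move=> x1 x2 y1 y2 [x20 sx] [y20 sy]; split; first exact: mulf_neq0.
  rewrite (leq_trans (size_polyMleq _ _)) // size_mul //.
  by rewrite -!subn1 leq_sub2r // leq_add.
by move=> i Pi; split; [exact: G0 | exact: FG].
Qed.

Lemma sum_shift (R : comNzRingType) (m : nat) (x : 'I_m -> R) (u : R) i r :
  \sum_j (if j == i then u * x j else x j) ^+ r = \sum_j x j ^+ r + (u ^+ r - 1) * x i ^+ r.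
Proof.
rewrite (eq_bigr (fun j => x j ^+ r + (if j == i then (u ^+ r - 1) * x i ^+ r else 0))).
  by rewrite big_split /= -big_mkcond big_pred1_eq.
move=> j _; case: eqP => [->|_]; last by rewrite addr0.
by rewrite exprMn mulrBl mul1r addrC subrK.
Qed.

(** The identity stands in for a division by prod (x_a - x_b). Each numerator product has size at
    most that of this product, so comparing the sizes of both sides bounds g without fractions. *)
Lemma size_cleared (P : idomainType) n m (x : 'I_m -> {poly P}) (u b c : P)
    (F : 'I_m -> {poly P}) (g f0 : {poly P}) :
  (forall i j, i != j -> x i - x j != 0) ->
  (forall i j, i != j -> (size (u%:P * x i - x j)%R <= size (x i - x j)%R)%N) ->
  b != 0 -> (forall i, (size (F i) <= n.+1)%N) -> (size f0 <= n.+1)%N ->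
  c%:P * (\sum_i (\prod_a \prod_(b | b != a) (if a == i then u%:P * x a - x b else x a - x b)) * F i) =
    (\prod_a \prod_(b | b != a) (x a - x b)) * (b%:P * g - f0) ->
  (size g <= n.+1)%N.
Proof.
move=> xd xsz b0 sF sf0.
pose Bi i := \prod_a \prod_(b | b != a) (if a == i then u%:P * x a - x b else x a - x b).
pose Dl := \prod_a \prod_(b | b != a) (x a - x b).
rewrite -/Dl -[X in _ * X = _]/(\sum_i Bi i * F i) => key.
have Dl0 : Dl != 0.
  by apply/prodf_neq0 => a _; apply/prodf_neq0 => d da; apply: xd; rewrite eq_sym.
have sB i : (size (Bi i) <= size Dl)%N.
  apply: size_prod_mono => a _.
    by apply/prodf_neq0 => d da; apply: xd; rewrite eq_sym.
  apply: size_prod_mono => d da; first by apply: xd; rewrite eq_sym.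
  by case: eqP => // _; apply: xsz; rewrite eq_sym.
suff sg : (size (b%:P * g - f0)%R <= n.+1)%N.
  have : (size (b%:P * g)%R <= n.+1)%N.
    rewrite -[_ * _](subrK f0) (leq_trans (size_polyD _ _)) //.
    by rewrite geq_max sg sf0.
  by rewrite mul_polyC size_scale.
set g' := _ - _ in key *.
have [->|g'0] := eqVneq g' 0; first by rewrite size_poly0.
have : (size (Dl * g')%R <= size Dl + n)%N.
  rewrite -key mul_polyC (leq_trans (size_scale_leq _ _)) //.
  rewrite (leq_trans (size_sum _ _ _)) //; apply/bigmax_leqP => i _.
  rewrite (leq_trans (size_polyMleq _ _)) //.
  have := sB i; have := sF i; lia.
by rewrite size_mul //; have : (0 < size Dl)%N by [rewrite size_poly_gt0]; lia.
Qed.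

(** * The operator on finitely many variables *)

Section Dominance.
Variables (K : fieldType) (D : nat).
Local Notation Lam := {mpoly K[D]}.
Hypothesis K0 : forall n : nat, n.+1%:R != 0 :> K.
Variables q t : K.
Hypothesis t0 : t != 0.
Local Notation hom d f := ((f : Lam) \is d.-homog for (@mnmwgt D)).
Local Notation G := (GN D (fun r => 1 - t^-1 ^+ r)).
Local Notation U := (@Tk K D (fun r => q ^+ r - 1)).
Local Notation H := (@Tk K D (fun=> 1)).
Local Notation EE := (@EE K D q t).

Lemma ev_shift (R : comNzRingType) (h : {rmorphism K -> R}) v c x d f : hom d f -> (d <= D)%N ->
  ev h (fun r => v r + h (c r) * x ^+ r) f = \sum_(k < D.+1) x ^+ k * ev h v (Tk c k f).
Proof.
move=> Hf dD.
pose phi : {rmorphism {poly Lam} -> R} := horner_eval x \o map_poly (ev h v).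
have -> : ev h (fun r => v r + h (c r) * x ^+ r) f = phi (tr c f).
  move: f {Hf}; apply: (@rm_ext _ _ _ (ev h _) (phi \o tr c)) => [a|i] /=.
    by rewrite evC trC /horner_eval map_polyC /= evC hornerC.
  rewrite evX trX /horner_eval rmorphD /= map_polyC map_polyZ map_polyXn /= evX evC.
  by rewrite hornerD hornerC hornerZ hornerXn.
rewrite /phi /= /horner_eval (@horner_coef_wide _ D.+1).
  by apply: eq_bigr => k _; rewrite coef_map mulrC TkE.
rewrite (leq_trans (size_poly _ _)) //.
have [//|sD] := leqP (size (tr c f)) D.+1.
have : (tr c f)`_(size (tr c f)).-1 == 0.
  by rewrite -TkE (Tk_gt _ Hf) //; lia.
by rewrite -lead_coefE lead_coef_eq0 => /eqP E; rewrite E size_poly0 in sD.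
Qed.

(* The action of EE on functions of finitely many variables is that of the
   Macdonald q-difference operator. *)
Lemma EE_points (L : fieldType) (h : {rmorphism K -> L}) xs d f :
  hom d f -> (d <= D)%N -> uniq xs -> 0 \notin xs ->
  let v := fun r => \sum_(x <- xs) x ^+ r in
  (h t - 1) * (\sum_(x <- xs) Aco (h t) xs x * ev h (fun r => v r + h (q ^+ r - 1) * x ^+ r) f)
    + ev h v f = h t ^+ size xs * ev h v (EE f).
Proof.
move=> Hf dD us z0 v.
have ht0 : h t != 0 by rewrite fmorph_eq0.
have Hn := @ev_GN K D K0 _ h v (fun r => 1 - t^-1 ^+ r).
have HM k : (k <= D)%N -> (h t - 1) * (\sum_(x <- xs) Aco (h t) xs x * x ^+ k) + (k == 0%N)%:R
   = h t ^+ size xs * ev h v (G k).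
  move=> kD; apply: (@moment _ _ ht0 _ h K0 _ D (fun k => ev h v (G k)) us z0 _ k kD).
  apply: eq_newton Hn => // r _.
  by rewrite rmorphB rmorph1 rmorphXn /= fmorphV.
rewrite EE_E rmorph_sum /= [RHS]mulr_sumr.
rewrite [RHS](eq_bigr (fun k : 'I_D.+1 =>
    (h t - 1) * (\sum_(x <- xs) Aco (h t) xs x * x ^+ k) * ev h v (U k f)
    + ((k : nat) == 0%N)%:R * ev h v (U k f))); last first.
  by move=> k _; rewrite rmorphM /= mulrA -HM ?leq_ord // mulrDl.
rewrite big_split /=; congr (_ + _); last first.
  rewrite big_ord_recl /= mul1r Tk0 big1 ?addr0 // => k _.
  by rewrite mul0r.
rewrite (eq_bigr (fun x => \sum_(k < D.+1) Aco (h t) xs x * (x ^+ k * ev h v (U k f)))); last first.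
  by move=> x _; rewrite (ev_shift _ _ _ _ Hf dD) mulr_sumr.
rewrite exchange_big mulr_sumr; apply: eq_bigr => k _ /=.
by rewrite -mulrA mulr_suml; congr (_ * _); apply: eq_bigr => x _; rewrite mulrA.
Qed.

(* The same identity with denominators cleared. *)
Lemma EE_domain (R : idomainType) (h : {rmorphism K -> R}) m (x : 'I_m -> R) d f :
  hom d f -> (d <= D)%N -> (forall i, x i != 0) -> (forall i j, i != j -> x i - x j != 0) ->
  h (t - 1) * (\sum_i (\prod_a \prod_(b | b != a) (if a == i then h t * x a - x b else x a - x b))
     * ev h (fun r => \sum_j (if j == i then h q * x j else x j) ^+ r) f) =
  (\prod_a \prod_(b | b != a) (x a - x b)) *
    (h (t ^+ m) * ev h (fun r => \sum_j x j ^+ r) (EE f) - ev h (fun r => \sum_j x j ^+ r) f).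
Proof.
move=> Hf dD x0 xd.
pose Bi i := \prod_a \prod_(b | b != a) (if a == i then h t * x a - x b else x a - x b).
pose Dl := \prod_a \prod_(b | b != a) (x a - x b).
rewrite -/Dl -[X in _ * X = _]/(\sum_i Bi i * ev h (fun r => \sum_j (if j == i then h q * x j else x j) ^+ r) f).
pose tf : {rmorphism R -> {fraction R}} := @tofrac R.
have tf_inj : injective tf by move=> a b /eqP; rewrite tofrac_eq => /eqP.
apply: (tf_inj _ _ _).
pose k : {rmorphism K -> {fraction R}} := tf \o h.
pose xs := [seq tf (x i) | i <- enum 'I_m].
have x_inj : injective x.
  by move=> i j e; apply/eqP; apply: contraT => /xd; rewrite e subrr eqxx.
have us : uniq xs by rewrite map_inj_uniq ?enum_uniq // => i j /tf_inj /x_inj.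
have z0 : 0 \notin xs.
  apply/mapP => -[i _ /eqP]; rewrite eq_sym -(rmorph0 tf) (inj_eq tf_inj).
  by rewrite (negbTE (x0 i)).
have := EE_points k Hf dD us z0.
set v := fun r => _ => E.
have vE r : v r = tf (\sum_i x i ^+ r).
  by rewrite /v /xs big_map big_enum /= rmorph_sum; apply: eq_bigr => i _; rewrite rmorphXn.
have ev1 (g : Lam) : ev k v g = tf (ev h (fun r => \sum_j x j ^+ r) g).
  by rewrite morph_ev; apply: eq_ev => r _; rewrite vE.
have ev2 i : ev k (fun r => v r + k (q ^+ r - 1) * tf (x i) ^+ r) f
   = tf (ev h (fun r => \sum_j (if j == i then h q * x j else x j) ^+ r) f).
  rewrite morph_ev; apply: eq_ev => r _; rewrite vE /= sum_shift.
  have -> : h (q ^+ r - 1) = h q ^+ r - 1 by rewrite rmorphB rmorphXn rmorph1.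
  by rewrite [in RHS]tofracD [in RHS]tofracM [in RHS]tofracXn.
rewrite {}/v in vE ev1 ev2 E *.
have szx : size xs = m by rewrite size_map size_enum_ord.
rewrite !ev1 szx {ev1} in E.
have Aco_E i : tf Dl * Aco (k t) xs (tf (x i)) = tf (Bi i).
  rewrite /Aco /xs big_map big_enum_cond /=.
  rewrite (eq_bigl (fun j => j != i)) => [|j]; last by rewrite (inj_eq tf_inj) (inj_eq x_inj).
  rewrite /Dl /Bi (bigD1 i) //= [in RHS](bigD1 i) //= eqxx !rmorphM /= mulrAC; congr (_ * _).
    rewrite !rmorph_prod -big_split /=; apply: eq_bigr => j ji.
    rewrite !rmorphB rmorphM /= mulrCA mulfV ?mulr1 // -rmorphB -(rmorph0 tf) (inj_eq tf_inj).
    by apply: xd; rewrite eq_sym.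
  congr (tf _); apply: eq_bigr => a ai; apply: eq_bigr => b ba.
  by rewrite (negbTE ai).
have E' : tf (h (t ^+ m)) = k t ^+ m by rewrite rmorphXn rmorphXn.
have tfM a b : tf (a * b) = tf a * tf b := rmorphM tf a b.
have tfB a b : tf (a - b) = tf a - tf b := rmorphB tf a b.
rewrite !tfM tfB tfM E' -E addrK mulrCA.
congr (_ * _); first by rewrite rmorphB rmorph1.
rewrite /xs big_map big_enum mulr_sumr rmorph_sum; apply: eq_bigr => i _.
by rewrite tfM -Aco_E ev2 mulrA.
Qed.

Lemma EE_size (P : idomainType) (g : {rmorphism K -> P}) n m (x : 'I_m -> {poly P}) d f :
  hom d f -> (d <= D)%N -> (forall i, x i != 0) -> (forall i j, i != j -> x i - x j != 0) ->
  (forall i j, i != j -> (size ((g t)%:P * x i - x j)%R <= size (x i - x j)%R)%N) ->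
  (forall i, (size (ev (polyC \o g) (fun r => \sum_j (if j == i then (g q)%:P * x j else x j) ^+ r) f)%R <= n.+1)%N) ->
  (size (ev (polyC \o g) (fun r => \sum_j x j ^+ r) f)%R <= n.+1)%N ->
  (size (ev (polyC \o g) (fun r => \sum_j x j ^+ r) (EE f))%R <= n.+1)%N.
Proof.
move=> Hf dD x0 xd xsz sF s0; have tm0 : g (t ^+ m) != 0 by rewrite fmorph_eq0 expf_neq0.
exact: (size_cleared xd xsz tm0 sF s0 (EE_domain (polyC \o g) Hf dD x0 xd)).
Qed.

Section Degrees.
Variables (k n m : nat).
Local Notation P := {mpoly K[m]}.
Local Notation R := {poly {mpoly K[m]}}.
(* Scaling the first k variables by X, the degree in X detects sum_(i < k) a_i,
   hence dominance. *)
Definition wk (a : 'X_{1..m}) : nat := \sum_(i < m | (i < k)%N) a i.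
(** The factors [c] allow one variable to be replaced by q times itself, independently of the
    scaling of the first k variables by X. *)
Definition pt (c : 'I_m -> K) (i : 'I_m) : R := (c i *: 'X_i)%:P * 'X^(i < k)%N.
Definition c1 : 'I_m -> K := fun=> 1.
Definition hR : {rmorphism K -> R} := polyC \o @mpolyC m K.
Definition phi c : {rmorphism P -> R} := mmap hR (pt c).

Lemma ptE c i : pt c i = hR (c i) * pt c1 i.
Proof.
by rewrite /pt /c1 scale1r mulrA /hR /= -polyCM mul_mpolyC.
Qed.

Lemma phiXm c (a : 'X_{1..m}) :
  phi c 'X_[a] = ((\prod_i c i ^+ a i) *: 'X_[a])%:P * 'X^(wk a).
Proof.
rewrite /phi /= mmapX /mmap1 /pt.
rewrite (eq_bigr (fun i : 'I_m => (c i ^+ a i *: 'X_i ^+ a i)%:P * 'X^((i < k) * a i)%N)); last first.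
  by move=> i _; rewrite exprMn_comm -?rmorphXn ?exprZn -?exprM //; apply: mulrC.
rewrite big_split /= -rmorph_prod /=; congr (_%:P * _).
  by rewrite scaler_prod -mpolyXE_id.
rewrite prodrXr; congr ('X^_); rewrite /wk [RHS]big_mkcond; apply: eq_bigr => i _.
by case: (i < k)%N; rewrite ?mul1n.
Qed.

Lemma phiE c g : phi c g =
  \sum_(a <- msupp g) (g@_a *: ((\prod_i c i ^+ a i) *: 'X_[a]))%:P * 'X^(wk a).
Proof.
rewrite {1}(mpolyE g) rmorph_sum; apply: eq_bigr => a _.
by rewrite -mul_mpolyC rmorphM phiXm /= mmapC mulrA /hR /= -polyCM mul_mpolyC.
Qed.

Lemma size_phi c (g : P) : (forall a, a \in msupp g -> (wk a <= n)%N) -> (size (phi c g) <= n.+1)%N.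
Proof.
move=> Hg; rewrite phiE big_seq (leq_trans (size_sum _ _ _)) //; apply/bigmax_leqP_seq => a ag _.
rewrite mul_polyC (leq_trans (size_scale_leq _ _)) // size_polyXn ltnS.
exact: Hg.
Qed.

Lemma phi_size (g : P) : (size (phi c1 g) <= n.+1)%N -> forall a, a \in msupp g -> (wk a <= n)%N.
Proof.
move=> sg a ag; rewrite leqNgt; apply/negP => na.
have : (phi c1 g)`_(wk a) = 0 by rewrite nth_default //; apply: leq_trans sg na.
move=> /(congr1 (mcoeff a)); rewrite mcoeff0 phiE coef_sum raddf_sum /=.
rewrite (bigD1_seq a) ?msupp_uniq //= [X in _ + X]big1 ?addr0 => [|b ba].
  rewrite coefCM coefXn eqxx mulr1 !mcoeffZ mcoeffX eqxx mulr1 big1 ?mulr1 => [/eqP|i _].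
    by rewrite mcoeff_eq0 ag.
  by rewrite expr1n.
rewrite coefCM coefXn; case: eqP => _; last by rewrite mulr0 mcoeff0.
by rewrite mulr1 !mcoeffZ mcoeffX (negbTE ba) !mulr0.
Qed.

Lemma pt_neq (i j : 'I_m) : i != j -> pt c1 i - pt c1 j != 0.
Proof.
move=> ij; rewrite subr_eq0; apply/negP => /eqP /(congr1 (fun p : R => p.[1])).
rewrite /pt /c1 !hornerE !expr1n !mulr1 !scale1r => /(congr1 (mcoeff U_(i))).
rewrite !mcoeffXU eqxx eq_sym (negbTE ij) => /eqP.
by rewrite oner_eq0.
Qed.

Lemma pt_neq0 (i : 'I_m) : pt c1 i != 0.
Proof.
apply/negP => /eqP /(congr1 (fun p : R => p.[1])).
rewrite /pt /c1 !hornerE !expr1n !mulr1 !scale1r => /(congr1 (mcoeff U_(i))).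
by rewrite mcoeffXU eqxx mcoeff0 => /eqP; rewrite oner_eq0.
Qed.

Lemma size_pt_scale (i j : 'I_m) : i != j ->
  (size ((hR t * pt c1 i) - pt c1 j)%R <= size (pt c1 i - pt c1 j)%R)%N.
Proof.
move=> ij; have := pt_neq ij; rewrite /pt /c1 !scale1r.
have XU : 'X_i - 'X_j != 0 :> P.
  rewrite subr_eq0; apply/negP => /eqP /(congr1 (mcoeff U_(i))).
  by rewrite !mcoeffXU eqxx eq_sym (negbTE ij) => /eqP; rewrite oner_eq0.
have X0 (l : 'I_m) : 'X_l != 0 :> P.
  by apply/negP => /eqP /(congr1 (mcoeff U_(l))); rewrite mcoeffXU eqxx mcoeff0 => /eqP; rewrite oner_eq0.
have sX (l : 'I_m) : size (('X_l)%:P * 'X : R) = 2%N by rewrite mul_polyC size_scale // size_polyX.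
case: (i < k)%N; case: (j < k)%N; rewrite /= ?expr1 ?expr0 ?mulr1 => _.
- have -> : hR t * (('X_i)%:P * 'X) - ('X_j)%:P * 'X = (t%:MP * 'X_i - 'X_j) *: 'X :> R.
    by rewrite -mul_polyC rmorphB rmorphM /= mulrBl mulrA.
  have -> : ('X_i)%:P * 'X - ('X_j)%:P * 'X = ('X_i - 'X_j) *: 'X :> R.
    by rewrite -mul_polyC rmorphB mulrBl.
  by rewrite (leq_trans (size_scale_leq _ _)) // [X in (_ <= X)%N]size_scale.
- rewrite [X in (_ <= X)%N]size_polyDl; last first.
    by rewrite size_polyN mul_polyC size_scale // size_polyX ltnS size_polyC_leq1.
  have -> : hR t * (('X_i)%:P * 'X) = (t%:MP * 'X_i) *: 'X :> R.
    by rewrite -mul_polyC rmorphM /= mulrA.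
  rewrite sX (leq_trans (size_polyD _ _)) // geq_max size_polyN.
  by rewrite (leq_trans (size_scale_leq _ _)) ?size_polyX // (leq_trans (size_polyC_leq1 _)).
- rewrite -(opprB (('X_j)%:P * 'X) ('X_i)%:P) [X in (_ <= X)%N]size_polyN.
  rewrite [X in (_ <= X)%N]size_polyDl ?size_polyN; last first.
    by rewrite sX ltnS size_polyC_leq1.
  rewrite sX (leq_trans (size_polyD _ _)) // geq_max size_polyN sX leqnn /=.
  by rewrite /hR /= -rmorphM (leq_trans (size_polyC_leq1 _)).
rewrite /hR /= -polyCM -!polyCB [X in (_ <= X)%N]size_polyC XU.
exact: size_polyC_leq1.
Qed.

Lemma ev_pt c (f : Lam) :
  ev hR (fun r => \sum_i pt c i ^+ r) f = phi c (xev m f).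
Proof.
move: f; apply: (@rm_ext _ _ _ (ev hR _) (phi c \o xev m)) => [a|i] /=.
  by rewrite evC /xev evC mmapC.
rewrite evX /xev evX -[mmap _ _ _]/(phi c _) rmorph_sum; apply: eq_bigr => j _.
by rewrite rmorphXn /phi /= mmapX mmap1U.
Qed.

(** The q-shifts in E do not change exponents, and its coefficients, products of (t x_a - x_b)/(x_a
    - x_b), have degree at most 0 in X; so the degree in X cannot grow. *)
Lemma EE_wk d f : hom d f -> (d <= D)%N ->
  (forall a, a \in msupp (xev m f) -> (wk a <= n)%N) ->
  (forall a, a \in msupp (xev m (EE f)) -> (wk a <= n)%N).
Proof.
move=> Hf dD Hw; apply: phi_size.
pose c (i j : 'I_m) : K := if j == i then q else 1.
rewrite -ev_pt; apply: (EE_size Hf dD pt_neq0 pt_neq size_pt_scale); last first.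
  by rewrite ev_pt; apply: size_phi.
move=> i; rewrite (_ : ev _ _ _ = phi (c i) (xev m f)); first exact: size_phi.
rewrite -ev_pt; apply: eq_ev => r _; apply: eq_bigr => j _; congr (_ ^+ r).
rewrite (ptE (c i)) [c i j]/c; case: (j == i) => //.
by rewrite rmorph1 mul1r.
Qed.
End Degrees.
End Dominance.

(** * The dominance order *)

Lemma sumn_take_rem s y k : sorted geq s -> y \in s ->
  (y + sumn (take k (rem y s)) <= sumn (take k.+1 s))%N.
Proof.
elim: s k => // x s IH k /= Hs; rewrite inE eq_sym.
case: eqP => [->|_] //= ys.
have /andP[/allP xs ss] : all (geq x) s && sorted geq s by rewrite -path_sortedE //; exact: geq_trans.
case: k => [|k] /=; first by rewrite take0 /= addn0 (leq_trans (xs _ ys)) // leq_addr.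
by rewrite addnCA leq_add2l IH.
Qed.

Lemma sumn_take_perm r s k : sorted geq s -> perm_eq r s ->
  (sumn (take k r) <= sumn (take k s))%N.
Proof.
elim: r s k => [|y r IH] s [|k] Hs E /=; rewrite ?take0 //.
have ys : y \in s by rewrite -(perm_mem E) mem_head.
apply: leq_trans (sumn_take_rem k Hs ys); rewrite leq_add2l IH //.
  apply: subseq_sorted Hs; [exact: geq_trans | exact: rem_subseq].
by rewrite -(perm_cons y) (permPl E) perm_to_rem.
Qed.

Lemma sumn_take_le k s : (sumn (take k s) <= sumn s)%N.
Proof. by rewrite -{2}(cat_take_drop k s) sumn_cat leq_addr. Qed.

Lemma dom_sumn mu la : dominated mu la -> sumn mu = sumn la.
Proof. by case/andP => /eqP. Qed.

Lemma dom_take mu la k : is_part la -> dominated mu la ->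
  (sumn (take k mu) <= sumn (take k la))%N.
Proof.
move=> Pla /andP[/eqP E /forallP H]; have [kd|dk] := ltnP k (sumn la).+1.
  exact: (H (Ordinal kd)).
rewrite [take k la]take_oversize -?E ?sumn_take_le //.
by have := sumn_ge_size (is_part_pos Pla); lia.
Qed.

Lemma domI mu la : sumn mu = sumn la -> (forall k, sumn (take k mu) <= sumn (take k la))%N ->
  dominated mu la.
Proof. by move=> E H; rewrite /dominated E eqxx; apply/forallP => k. Qed.

Lemma dom_refl la : dominated la la.
Proof. exact: domI. Qed.

Lemma dom_trans la nu mu : is_part la -> is_part nu -> dominated mu nu -> dominated nu la -> dominated mu la.
Proof.
move=> Pl Pn H1 H2; apply: domI => [|k]; first by rewrite (dom_sumn H1) (dom_sumn H2).
exact: leq_trans (dom_take k Pn H1) (dom_take k Pl H2).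
Qed.

Lemma sumn_take_inj r s : is_part r -> is_part s ->
  (forall k, sumn (take k r) = sumn (take k s)) -> r = s.
Proof.
elim: r s => [|x r IH] [|y s] //.
- by move=> _ /is_part_pos /= /andP[y0 _] /(_ 1%N) /=; rewrite take0 /=; lia.
- by move=> /is_part_pos /= /andP[y0 _] _ /(_ 1%N) /=; rewrite take0 /=; lia.
move=> /andP[/path_sorted Hr /andP[_ Pr]] /andP[/path_sorted Hs /andP[_ Ps]] H.
have xy : x = y by have := H 1%N; rewrite /= !take0 /=; lia.
rewrite xy (IH s) //; [exact/andP | exact/andP|].
by move=> k; have := H k.+1; rewrite /= xy; lia.
Qed.

(** Numerical measure for inductions along the dominance order on the partitions of d. *)
Definition rnk d s := (\sum_(k < d.+1) sumn (take k s))%N.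

Lemma rnk_le d mu la : is_part la -> dominated mu la -> (rnk d mu <= rnk d la)%N.
Proof. by move=> Pl H; apply: leq_sum => k _; apply: dom_take. Qed.

Lemma rnk_inj d mu la : mu \in parts d -> la \in parts d -> dominated mu la ->
  rnk d mu = rnk d la -> mu = la.
Proof.
rewrite !mem_parts => /andP[Pm /eqP md] /andP[Pl /eqP ld] H E.
apply: sumn_take_inj => // k; have [kd|dk] := ltnP k d.+1.
  have L (i : 'I_d.+1) : (true : bool) -> (sumn (take i mu) <= sumn (take i la))%N by move=> _; exact: dom_take.
  have [_ H2] := leqif_sum (fun i Hi => leqif_eq (L i Hi)).
  by move/eqP: E; rewrite /rnk H2 => /forall_inP /(_ (Ordinal kd) isT) /eqP.
have sz s : is_part s -> sumn s = d -> take k s = s.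
  move=> Ps sd; rewrite take_oversize // (leq_trans (sumn_ge_size (is_part_pos Ps))) //; lia.
by rewrite !sz // md ld.
Qed.

Lemma dom_anti la mu : is_part la -> is_part mu -> dominated mu la -> dominated la mu -> mu = la.
Proof.
move=> Pl Pm H1 H2; apply: sumn_take_inj => // k; apply/eqP.
by rewrite eqn_leq !dom_take.
Qed.

Lemma dom_size la mu : is_part la -> is_part mu -> dominated mu la -> (size la <= size mu)%N.
Proof.
move=> Pl Pm H; rewrite leqNgt; apply/negP => sml.
have := dom_take (size mu) Pl H; rewrite take_size (dom_sumn H).
rewrite -{1}(cat_take_drop (size mu) la) sumn_cat -{2}[sumn _]addn0 leq_add2l leqn0.
have := is_part_pos Pl; rewrite -{1}(cat_take_drop (size mu) la) all_cat => /andP[_ Hd].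
by have := sumn_ge_size Hd; rewrite size_drop; case: sumn => //; lia.
Qed.

Lemma dom_head la mu : is_part la -> dominated mu la -> (nth 0 mu 0 <= nth 0 la 0)%N.
Proof.
by move=> Pl /(dom_take 1 Pl); case: mu => [|x mu]; case: la {Pl} => [|y la] //=; rewrite ?take0 //=; lia.
Qed.

(** * Monomial symmetric functions and unitriangular families *)

Section MonomialBasis.
Variables (K : fieldType) (D : nat).
Local Notation Lam := {mpoly K[D]}.
Hypothesis K0 : forall n : nat, n.+1%:R != 0 :> K.
Local Notation hom d f := ((f : Lam) \is d.-homog for (@mnmwgt D)).
Local Notation H := (@Tk K D (fun=> 1%R)).

Lemma natr_neq0 n : n != 0%N -> n%:R != 0 :> K.
Proof. by case: n. Qed.

(* [mm r] is the monomial symmetric function: [Rpm] is triangular for the number of parts. *)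
Fixpoint mmn n (r : seq nat) : Lam :=
  (Rpm r r)%:R^-1 *: (pp K D r - \sum_(s <- parts (sumn r) | (size s < size r)%N)
     (Rpm r s)%:R *: (if n is n'.+1 then mmn n' s else 0)).
Definition mm r := mmn (size r) r.

Lemma mmnE n r : (size r <= n)%N -> mmn n r = mm r.
Proof.
suff H k : forall r, (size r <= k)%N -> forall n, (size r <= n)%N -> mmn n r = mmn (size r) r.
  by move=> rn; apply: (H (size r)).
elim: k => [|k IH] {}r rk {}n rn.
  have r0 : size r = 0%N by lia.
  rewrite r0; case: n rn => //= n _; congr (_ *: (_ - _)).
  by rewrite !big_pred0 // => s; rewrite r0.
case: n rn => [|n] rn; first by move: rn; rewrite leqn0 => /eqP ->.
case E : (size r) rn rk => [|l] rn rk /=; first by congr (_ *: (_ - _)); rewrite !big_pred0 // => s; rewrite E.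
congr (_ *: (_ - _)); apply: eq_bigr => s; rewrite E ltnS => sr; congr (_ *: _).
by rewrite IH ?[in RHS]IH //; lia.
Qed.

Lemma mm_rec r : mm r = (Rpm r r)%:R^-1 *: (pp K D r -
  \sum_(s <- parts (sumn r) | (size s < size r)%N) (Rpm r s)%:R *: mm s).
Proof.
rewrite -(@mmnE (size r).+1) //=; congr (_ *: (_ - _)); apply: eq_bigr => s sr.
by rewrite mmnE // ltnW.
Qed.

Lemma hom_mm r : is_part r -> hom (sumn r) (mm r).
Proof.
have [n] := ubnP (size r); elim: n r => // n IH r rn Pr.
rewrite mm_rec rpredZ // rpredB ?hom_pp // big_seq_cond rpred_sum // => s.
rewrite mem_parts => /andP[/andP[Ps /eqP <-] sr].
by rewrite rpredZ // IH //; apply: leq_trans sr _.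
Qed.

Lemma part_parts s : is_part s -> s \in parts (sumn s).
Proof. by rewrite mem_parts eqxx andbT. Qed.

(** The monomial x^s occurs in p_r only if s has at most as many parts as r, and with equally many
    only for s = r. Removing the monomials with fewer parts, as [mm] does recursively, therefore
    leaves a multiple of m_r. *)
Lemma hc_mm d r s : (d <= D)%N -> r \in parts d -> s \in parts d ->
  hc (mm r) s = (r == s)%:R.
Proof.
move=> dD; have [n] := ubnP (size r); elim: n r s => // n IH r s rn rd sd.
have := rd; rewrite mem_parts => /andP[Pr /eqP rsum].
have := sd; rewrite mem_parts => /andP[Ps _].
rewrite mm_rec hcZ -scaleN1r hcD hcZ hc_sum hc_ppE ?(parts_small rd) // rsum.
have -> : \sum_(u <- parts d | (size u < size r)%N) hc ((Rpm r u)%:R *: mm u) s =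
   if (size s < size r)%N then (Rpm r s)%:R else 0.
  have E u : u \in parts d -> (size u < size r)%N -> hc ((Rpm r u)%:R *: mm u) s = if u == s then (Rpm r s)%:R else 0.
    move=> ud ur; rewrite hcZ IH //; last by apply: leq_trans ur _.
    by case: eqP => [->|_]; rewrite ?mulr1 ?mulr0.
  rewrite big_seq_cond (eq_bigr (fun u => if u == s then (Rpm r s)%:R else 0)) => [|u /andP[]]; last exact: E.
  rewrite -big_seq_cond; case: ifP => sr.
    rewrite (big_rem s) //= sr eqxx big_seq_cond big1 ?addr0 // => u.
    by rewrite mem_rem_uniq ?uniq_parts // inE => /andP[/andP[/negbTE ->]].
  by rewrite big1 // => u ur; case: eqP => // e; rewrite -e ur in sr.
have [e|rs] := eqVneq r s.
  by rewrite e ltnn mulr0 addr0 mulVf // natr_neq0 // Rpm_diag.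
case: ltnP => sr; first by rewrite mulN1r subrr mulr0.
have [->|/Rpm_tri] := eqVneq (Rpm r s) 0%N; first by rewrite mulr0 addr0 mulr0.
case/(_ (is_part_pos Ps)) => sr' /(_ _) E; case/eqP: rs; apply: esym; apply: perm_part => //.
by apply: E; apply/eqP; rewrite eqn_leq sr sr'.
Qed.

Lemma hc_hom0 e f s : hom e f -> sumn s != e -> hc f s = 0.
Proof.
elim: s e f => [|k s IH] e f Hf /= ne.
  by rewrite /hc /=; apply: (dhomog_nemf_coeff Hf); rewrite /= mnmwgt0.
rewrite -hc_H; have [ke|ek] := leqP k e; last by rewrite (Tk_gt _ Hf ek) hc0.
by apply: (IH _ _ (hom_Tk _ Hf ke)); lia.
Qed.

Lemma pp_mm d r : (d <= D)%N -> r \in parts d -> pp K D r = \sum_(s <- parts d) (Rpm r s)%:R *: mm s.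
Proof.
move=> dD rd; have := rd; rewrite mem_parts => /andP[Pr /eqP rsum].
have : (Rpm r r)%:R *: mm r = pp K D r - \sum_(s <- parts d | (size s < size r)%N) (Rpm r s)%:R *: mm s.
  by rewrite {1}mm_rec rsum scalerA mulfV ?scale1r // natr_neq0 // Rpm_diag.
move/eqP; rewrite eq_sym subr_eq => /eqP ->.
rewrite [RHS](bigID (fun s => (size s < size r)%N)) /= addrC; congr (_ + _).
rewrite (big_rem r) //= ltnn big_seq_cond big1 ?addr0 // => s.
rewrite mem_rem_uniq ?uniq_parts // inE -leqNgt => /andP[/andP[sr sd] rs].
have := sd; rewrite mem_parts => /andP[Ps _].
have [->|/Rpm_tri] := eqVneq (Rpm r s) 0%N; first by rewrite scale0r.
case/(_ (is_part_pos Ps)) => sr' /(_ _) E; case/eqP: sr; apply: perm_part => //.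
by apply: E; apply/eqP; rewrite eqn_leq rs sr'.
Qed.

Lemma hom_mind (Q : Lam -> Prop) : Q 0 -> (forall f g, Q f -> Q g -> Q (f + g)) ->
  (forall d f, hom d f -> Q f) -> forall f, Q f.
Proof.
move=> Q0 QD Qh; elim/mpolyind => // c m f _ _ Hf; apply: QD => //; apply: (Qh (mnmwgt m)).
by rewrite rpredZ // dhomogX.
Qed.

Lemma hc_cf d (f : Lam) s : (d <= D)%N -> s \in parts d ->
  hc f s = \sum_(r <- parts d) cf f r * (Rpm r s)%:R.
Proof.
move=> dD sd; elim/hom_mind: f => [|f g Hf Hg|e f Hf].
- by rewrite hc0 big1 // => r _; rewrite /cf mcoeff0 mul0r.
- by rewrite hcD Hf Hg -big_split; apply: eq_bigr => r _; rewrite cfD mulrDl.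
have := sd; rewrite mem_parts => /andP[_ /eqP ssum].
have [ed|ed] := eqVneq e d.
  rewrite ed in Hf; rewrite {1}(hom_cf Hf dD) /toL hc_sum; apply: eq_big_seq => r rd.
  by rewrite hcZ hc_ppE // (parts_small rd).
rewrite (hc_hom0 Hf) ?ssum 1?eq_sym // big_seq big1 // => r rd.
by rewrite (cf_hom0 Hf rd dD ed) mul0r.
Qed.

Lemma hom_mm_exp d f : hom d f -> (d <= D)%N -> f = \sum_(s <- parts d) hc f s *: mm s.
Proof.
move=> Hf dD; rewrite {1}(hom_cf Hf dD) /toL.
transitivity (\sum_(r <- parts d) \sum_(s <- parts d) (cf f r * (Rpm r s)%:R) *: mm s).
  apply: eq_big_seq => r rd; rewrite (pp_mm dD rd) scaler_sumr.
  by apply: eq_bigr => s _; rewrite scalerA.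
rewrite exchange_big; apply: eq_big_seq => s sd; rewrite (hc_cf f dD sd) scaler_suml.
by apply: eq_bigr.
Qed.

Lemma hc_hom_eq d f g : hom d f -> hom d g -> (d <= D)%N -> {in parts d, hc f =1 hc g} -> f = g.
Proof.
move=> Hf Hg dD E; rewrite (hom_mm_exp Hf dD) (hom_mm_exp Hg dD).
by apply: eq_big_seq => s /E ->.
Qed.

(* Back-substitution along [rnk], which is strictly monotone for dominance. *)
Lemma tri_span d (F : seq nat -> Lam) (S : pred (seq nat)) f : (d <= D)%N ->
  {in parts d, forall la, hom d (F la)} ->
  {in parts d, forall la, hc (F la) la = 1} ->
  {in parts d &, forall la mu, hc (F la) mu != 0 -> dominated mu la} ->
  {in parts d &, forall la mu, dominated mu la -> S la -> S mu} ->
  hom d f -> {in parts d, forall mu, hc f mu != 0 -> S mu} ->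
  exists c, f = \sum_(mu <- parts d | S mu) c mu *: F mu.
Proof.
move=> dD HF F1 FT Sd Hf fS.
suff X n : forall g, hom d g -> {in parts d, forall mu, hc g mu != 0 -> S mu /\ (rnk d mu < n)%N} ->
    exists c, g = \sum_(mu <- parts d | S mu) c mu *: F mu.
  apply: (X (\sum_(mu <- parts d) (rnk d mu)).+1 f) => // mu mud Hmu; split; first exact: fS.
  by rewrite ltnS (big_rem mu) //= leq_addr.
elim: n => [|n IH] g Hg gS.
  exists (fun=> 0); rewrite big1 => [|mu _]; last exact: scale0r.
  apply: (@hc_hom_eq d) => //; first exact: rpred0.
  move=> mu mud; rewrite hc0; apply/eqP; apply: contraT => /(gS _ mud) [].
  by rewrite ltn0.
(* The part of the expansion at the highest remaining rank; subtracting it leaves a support of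
   smaller rank. *)
pose h := \sum_(mu <- parts d | rnk d mu == n) hc g mu *: F mu.
have Hh : hom d h.
  rewrite /h big_seq_cond rpred_sum // => mu /andP[mud _]; rewrite rpredZ //; exact: HF.
have hh mu : mu \in parts d -> (n <= rnk d mu)%N -> hc h mu = if rnk d mu == n then hc g mu else 0.
  move=> mud nm; rewrite /h hc_sum.
  have Z nu : nu \in parts d -> nu != mu -> rnk d nu == n -> hc (hc g nu *: F nu) mu = 0.
    move=> nud nmu /eqP nr; rewrite hcZ; apply/eqP; rewrite mulf_eq0 orbC; apply/orP; left.
    apply: contraT => /(FT _ _ nud mud) dom.
    have Pn : is_part nu by move: nud; rewrite mem_parts => /andP[].
    have := rnk_le d Pn dom => rl.
    by case/eqP: nmu; apply: esym; apply: (rnk_inj mud nud dom); lia.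
  case: ifP => rn; last first.
    rewrite big_seq_cond big1 // => nu /andP[nud rnu]; apply: Z => //.
    by apply: contraTneq rnu => ->; rewrite rn.
  rewrite (big_rem mu) //= rn hcZ F1 // mulr1 big_seq_cond big1 ?addr0 // => nu.
  by rewrite mem_rem_uniq ?uniq_parts // inE => /andP[/andP[nmu nud]]; apply: Z.
have [//||c Ec] := IH (g - h).
- by rewrite rpredB.
- move=> mu mud; rewrite -scaleN1r hcD hcZ mulN1r => Hne.
  have rn : (rnk d mu < n)%N.
    rewrite ltnNge; apply: contraNN Hne => nm; rewrite hh //.
    case: ifP => [_|/eqP rn]; first by rewrite subrr.
    rewrite subr0; apply: contraT => /(gS _ mud) [_]; lia.
  split=> //; have [g0|] := eqVneq (hc g mu) 0; last by case/(gS _ mud).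
  move: Hne; rewrite g0 add0r oppr_eq0 /h hc_sum => Hne.
  have [nu nud] : exists2 nu, nu \in parts d & (rnk d nu == n) && (hc (hc g nu *: F nu) mu != 0).
    apply/hasP; apply: contraNT Hne => /hasPn Hall; apply/eqP.
    rewrite big_seq_cond big1 // => nu /andP[nud rnu]; apply/eqP.
    by have := Hall nu nud; rewrite rnu negbK.
  rewrite hcZ mulf_eq0 negb_or => /and3P[_ /(gS _ nud) [Sn _] /(FT _ _ nud mud)] dom.
  exact: Sd dom Sn.
exists (fun mu => c mu + if rnk d mu == n then hc g mu else 0).
rewrite -[LHS](subrK h) Ec.
have -> : h = \sum_(mu <- parts d | S mu) (if rnk d mu == n then hc g mu else 0) *: F mu.
  rewrite /h [RHS]big_mkcond [LHS]big_mkcond; apply: eq_big_seq => mu mud /=.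
  case: ifP => // _; last by rewrite scale0r; case: ifP.
  case: ifP => // Sm; have [->|] := eqVneq (hc g mu) 0; first by rewrite scale0r.
  by case/(gS _ mud); rewrite Sm.
by rewrite -big_split; apply: eq_bigr => mu _; rewrite scalerDl.
Qed.
End MonomialBasis.

(** * Macdonald polynomials *)

Lemma sumn_takeS k s : (sumn (take k s) <= sumn (take k.+1 s))%N.
Proof. by elim: s k => //= x s IH [|k] /=; rewrite ?take0 // leq_add2l. Qed.

Lemma sumn_take_pos k s : (sumn (take k s) <= sumn (take k [seq x <- s | 0 < x]))%N.
Proof.
elim: s k => //= x s IH [|k] //=.
case: x => [|x] /=; last by rewrite leq_add2l.
by rewrite add0n (leq_trans (IH _)) // sumn_takeS.
Qed.

Lemma sum_ord_take k s : (\sum_(i < size s | (i < k)%N) nth 0 s i)%N = sumn (take k s).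
Proof.
elim: s k => [|x s IH] k /=; first by rewrite big_ord0.
rewrite big_mkcond big_ord_recl /=; case: k => [|k] /=; first by rewrite big1.
by rewrite -IH [in RHS]big_mkcond.
Qed.

Lemma sorted_head s x : sorted geq s -> x \in s -> (x <= nth 0 s 0)%N.
Proof.
case: s => //= y s; rewrite (path_sortedE geq_trans) inE => /andP[/allP H _].
by case/orP => [/eqP ->|/H].
Qed.

Lemma ins_cons r s : is_part s -> (nth 0 s 0 <= r)%N -> (0 < r)%N -> ins r s = r :: s /\ is_part (r :: s).
Proof.
move=> Ps sr r0; have P : is_part (r :: s).
  rewrite /is_part /= r0 is_part_pos // andbT (path_sortedE geq_trans) is_part_sorted // andbT.
  rewrite andbT; apply/allP => x /(sorted_head (is_part_sorted Ps)) xs; exact: leq_trans xs sr.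
by split=> //; apply: perm_part; rewrite ?is_part_ins // perm_ins.
Qed.

Section Eigen.
Variables (K : fieldType) (D : nat).
Local Notation Lam := {mpoly K[D]}.
Hypothesis K0 : forall n : nat, n.+1%:R != 0 :> K.
Variables q t : K.
Hypothesis t0 : t != 0.
(** The form in which independence of q and t separates the eigenvalues of E; for Q(q,t) it is
    [qt_spec]. *)
Hypothesis spec : forall n (a b : nat -> nat),
  \sum_(i < n) q ^+ a i * t ^+ i = \sum_(i < n) q ^+ b i * t ^+ i -> forall i, (i < n)%N -> a i = b i.
Local Notation hom d f := ((f : Lam) \is d.-homog for (@mnmwgt D)).
Local Notation H := (@Tk K D (fun=> 1%R)).
Local Notation EE := (@EE K D q t).
Local Notation En := (@En K D q t).
Local Notation B := (@Bform K D q t).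

(* 1 + (t - 1) sum_(i >= 1) (q^(s_i) - 1) t^(-i), the eigenvalue of E on P_s. *)
Fixpoint eg (s : seq nat) : K :=
  if s is x :: s' then t^-1 * eg s' + (1 - t^-1) * q ^+ x else 1.

Lemma eg_rec s : eg s = t^-1 * eg (behead s) + (1 - t^-1) * q ^+ (nth 0%N s 0).
Proof. by case: s => //=; rewrite mulr1 expr0 mulr1 addrC subrK. Qed.

(** Multiplying by t^n and numbering the rows from the bottom removes the negative powers of t, so
    that [spec] applies. *)
Lemma egE n s : (size s <= n)%N ->
  t ^+ n * eg s = 1 + (t - 1) * \sum_(i < n) q ^+ nth 0%N s (n.-1 - i) * t ^+ i.
Proof.
elim: n s => [|n IH] s sn.
  by rewrite big_ord0 mulr0 addr0 mul1r; case: s sn.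
rewrite eg_rec mulrDr mulrA exprSr mulfK // IH; last by rewrite size_behead; case: (size s) sn.
rewrite big_ord_recr /= subnn mulrDr addrA; congr (_ + _); last first.
  by rewrite -mulrA [t * _]mulrA mulrBr mulr1 mulfV //; ring.
congr (1 + _ * _); apply: eq_bigr => i _; rewrite nth_behead; congr (q ^+ nth _ _ _ * _).
by have := ltn_ord i; lia.
Qed.

Lemma t_neq1 : t != 1.
Proof.
(* At t = 1 the exponent sequences (0, 1) and (1, 0) would give the same sum. *)
apply/negP => /eqP t1; have := @spec 2 (fun i => i) (fun i => (1 - i)%N).
by rewrite !big_ord_recl !big_ord0 /= t1 !expr1n !mulr1 !addr0 addrC => /(_ erefl 0%N isT).
Qed.

Lemma eg_inj d : {in parts d &, injective eg}.
Proof.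
move=> r s; rewrite !mem_parts => /andP[Pr /eqP rd] /andP[Ps /eqP sd] E.
have sr : (size r <= d)%N by rewrite -rd sumn_ge_size // is_part_pos.
have ss : (size s <= d)%N by rewrite -sd sumn_ge_size // is_part_pos.
have := egE sr; rewrite E (egE ss) => /addrI /mulfI.
rewrite subr_eq0 t_neq1 => /(_ isT) /(@spec d (fun i => nth 0%N s (d.-1 - i)) (fun i => nth 0%N r (d.-1 - i))) N.
have Nn i : (i < d)%N -> nth 0%N r i = nth 0%N s i.
  move=> id; have := N (d.-1 - i)%N; have -> : (d.-1 - (d.-1 - i) = i)%N by lia.
  by move=> -> //; lia.
apply: sumn_take_inj => // k; rewrite -!sum_ord_take.
rewrite (big_ord_widen_cond d (fun i => i < k)%N (nth 0%N r) sr) (big_ord_widen_cond d (fun i => i < k)%N (nth 0%N s) ss).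
rewrite big_mkcond [RHS]big_mkcond; apply: eq_bigr => i _; rewrite Nn //.
case: (i < k)%N => //=; case: ltnP => ir; case: ltnP => is_ //; rewrite ?(nth_default _ is_) //.
by rewrite -Nn // nth_default.
Qed.

Definition tri d (f : Lam) la := {in parts d, forall mu, hc f mu != 0 -> dominated mu la}.

Lemma hc_ins (f : Lam) k s : hc (H k f) s = hc f (ins k s).
Proof. by rewrite hc_H; apply: perm_hc; rewrite perm_sym perm_ins. Qed.

Lemma head_H d f c k : hom d f -> (d <= D)%N ->
  {in parts d, forall mu, hc f mu != 0 -> (nth 0 mu 0 <= c)%N} -> (c < k)%N -> H k f = 0.
Proof.
move=> Hf dD fc ck; have [kd|dk] := leqP k d; last exact: Tk_gt Hf dk.
have k0 : (0 < k)%N by lia.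
apply: (@hc_hom_eq K D K0 (d - k)).
- exact: hom_Tk.
- exact: rpred0.
- lia.
move=> s; rewrite mem_parts => /andP[Ps /eqP ssum]; rewrite hc0 hc_ins.
apply/eqP; apply: contraTT ck => /fc; rewrite mem_parts is_part_ins // sumn_ins -leqNgt.
have -> : (k + sumn s == d)%N by apply/eqP; lia.
move=> /(_ isT); apply: leq_trans; apply: sorted_head; first by rewrite is_part_sorted // is_part_ins.
by rewrite (perm_mem (perm_ins _ _)) mem_head.
Qed.

Lemma tri_H_gt d f la k : hom d f -> (d <= D)%N -> is_part la -> tri d f la ->
  (nth 0 la 0 < k)%N -> H k f = 0.
Proof.
move=> Hf dD Pla T; apply: (head_H Hf dD) => mu mud /(T _ mud); exact: dom_head.
Qed.

(** Dominance bounds the first row of any s that occurs by l. Inserting l therefore puts it in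
    front, and the remaining partial sums can be compared. *)
Lemma tri_H d f l la : is_part (l :: la) -> (l <= d)%N -> tri d f (l :: la) -> tri (d - l) (H l f) la.
Proof.
move=> Pla ld T s; rewrite mem_parts => /andP[Ps /eqP ssum]; rewrite hc_ins => Hne.
have l0 : (0 < l)%N by case/is_part_pos/andP: Pla.
have Pi := is_part_ins l0 Ps.
have dom : dominated (ins l s) (l :: la).
  by apply: T Hne; rewrite mem_parts Pi sumn_ins; apply/eqP; lia.
have hl : (nth 0 s 0 <= l)%N.
  apply: leq_trans (dom_head Pla dom).
  case: s {Ps ssum Hne dom} Pi => // x s Pi; apply: sorted_head; first exact: is_part_sorted.
  by rewrite (perm_mem (perm_ins _ _)) !inE eqxx orbT.
move: dom; have [-> _] := ins_cons Ps hl l0 => dom; apply: domI.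
  by have := dom_sumn dom => /=; lia.
by move=> k; have := dom_take k.+1 Pla dom; rewrite /= leq_add2l.
Qed.

(** Each dominance inequality is a bound on the weight [wk] of the exponents, which [EE_wk]
    preserves; d variables suffice for partitions of d. *)
Lemma EE_tri d f la : hom d f -> (d <= D)%N -> la \in parts d -> tri d f la -> tri d (EE f) la.
Proof.
move=> Hf dD; rewrite mem_parts => /andP[Pla /eqP lad] T mu mud Hne.
have := mud; rewrite mem_parts => /andP[Pmu /eqP mu_d].
have ms : (size mu <= d)%N by rewrite -mu_d sumn_ge_size // is_part_pos.
have wkE k (a : 'X_{1..d}) : wk k a = sumn (take k (sq a)).
  rewrite -sum_ord_take size_sq; apply: eq_bigr => i _.
  by rewrite nth_sq.
pose a : 'X_{1..d} := [multinom nth 0%N mu i | i < d].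
have Ea : sq a = mu ++ nseq (d - size mu) 0%N.
  apply: (@eq_from_nth _ 0%N); first by rewrite size_sq size_cat size_nseq subnKC.
  rewrite size_sq => i id; rewrite -[i]/(nat_of_ord (Ordinal id)) nth_sq mnmE nth_cat /=.
  by case: ltnP => // im; rewrite nth_nseq if_same nth_default.
have Pos : [seq x <- mu | (0 < x)%N] = mu by apply/all_filterP/is_part_pos.
have Hc : hc (EE f) (sq a) = hc (EE f) mu.
  by rewrite hc_pos Ea filter_cat Pos filter_nseq /= cats0.
apply: domI => [|k]; first by rewrite mu_d lad.
have := @EE_wk K D K0 q t t0 k (sumn (take k la)) d d f Hf dD.
move=> /(_ _ a); rewrite mcoeff_msupp mcoeff_xev Hc wkE => W.
apply: (@leq_trans (sumn (take k (sq a)))).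
  rewrite Ea take_cat; case: ltnP => // km; rewrite take_oversize // sumn_cat.
  by rewrite leq_addr.
apply: W Hne => b; rewrite mcoeff_msupp mcoeff_xev wkE hc_pos hc_sort => Hb.
set p := sort geq _ in Hb *.
have Pp : is_part p by apply: is_part_sort; apply: filter_all.
have pd : sumn p = d by apply/eqP; apply: contraNT Hb => /(hc_hom0 Hf) ->.
have := dom_take k Pla (T p _ Hb); rewrite mem_parts Pp pd eqxx => /(_ isT); apply: leq_trans.
apply: leq_trans (sumn_take_pos _ _) _; apply: sumn_take_perm; first exact: is_part_sorted.
by rewrite perm_sym perm_sort.
Qed.

(** The first row is stripped off with [H_EE_top], whose scalars reproduce the recursion of [eg]. *)
Lemma EE_diag d f la : hom d f -> (d <= D)%N -> la \in parts d -> tri d f la ->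
  hc (EE f) la = eg la * hc f la.
Proof.
elim: la d f => [|l la IH] d f Hf dD; rewrite mem_parts => /andP[Pla /eqP lad] T.
  rewrite -lad in Hf; rewrite (hom_cf Hf) // /toL /parts /= big_seq1.
  by rewrite /pp big_nil linearZ /= EE1 // mul1r.
have ld : (l <= d)%N by rewrite -lad leq_addr.
have Pla' : is_part la by case/andP: Pla => /path_sorted S /andP[_ A]; apply/andP.
have H0 k : (l < k)%N -> H k f = 0 by move=> lk; apply: (tri_H_gt Hf dD Pla T).
rewrite -hc_H (H_EE_top _ _ _ Hf dD H0) // hcD !hcZ (IH (d - l)%N).
- by rewrite hc_H mulrA -mulrDl.
- exact: hom_Tk.
- lia.
- by rewrite mem_parts Pla' -lad /= addKn eqxx.
exact: tri_H.
Qed.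

Definition mac_eigen la (f : Lam) :=
  [/\ hom (sumn la) f, hc f la = 1, tri (sumn la) f la & EE f = eg la *: f].

Definition Pe la : Lam := epsilon (inhabits 0) (mac_eigen la).

Lemma mm_tri d la : (d <= D)%N -> la \in parts d -> tri d (mm K D la) la.
Proof.
move=> dD lad mu mud; rewrite (hc_mm K0 dD lad mud).
by case: (la =P mu) => [->|]; rewrite ?dom_refl // eqxx.
Qed.

(** Induction on the rank: E m_la - e_la m_la lies in the span of the P_mu with mu strictly below
    la, and it can be corrected away because these e_mu differ from e_la. *)
Lemma PeP la : is_part la -> (sumn la <= D)%N -> mac_eigen la (Pe la).
Proof.
move=> Pla dD; apply: epsilon_spec.
set d := sumn la; have : la \in parts d by apply: part_parts.
have [n] := ubnP (rnk d la); rewrite -/d in dD; move: d dD => d dD {Pla}.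
elim: n la => // n IH la; rewrite ltnS => rn lad.
have := lad; rewrite mem_parts => /andP[Pla /eqP las].
have gP nu : nu \in parts d -> (rnk d nu < rnk d la)%N -> mac_eigen nu (Pe nu).
  by move=> nud rnu; apply: epsilon_spec; apply: IH => //; apply: leq_trans rnu _.
(* The monomial functions at the other ranks only complete the family to all partitions of d, as
   [tri_span] wants; strictly below la every member is an eigenvector. *)
pose F nu := if (rnk d nu < rnk d la)%N then Pe nu else mm K D nu.
have dP nu : nu \in parts d -> is_part nu /\ sumn nu = d by rewrite mem_parts => /andP[? /eqP].
have Fg nu : nu \in parts d -> [/\ hom d (F nu), hc (F nu) nu = 1 & tri d (F nu) nu].
  move=> nud; have [Pn ns] := dP nu nud; rewrite /F; case: ifP => rnu.
    by have [] := gP nu nud rnu; rewrite ns.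
  split; [by rewrite -ns hom_mm | by rewrite (hc_mm K0 dD) ?eqxx | exact: mm_tri].
pose S mu := dominated mu la && (mu != la).
pose m := mm K D la; have Hm : hom d m by rewrite -las hom_mm.
have m1 : hc m la = 1 by rewrite (hc_mm K0 dD) ?eqxx.
have mT : tri d m la by apply: mm_tri.
have [||||||c Ec] := @tri_span K D K0 d F S (EE m - eg la *: m) dD.
- by move=> nu /Fg[].
- by move=> nu /Fg[].
- by move=> nu mu /Fg[_ _ T] mud; apply: T.
- move=> nu mu nud mud mn /andP[nl nnl]; have [Pn _] := dP nu nud; have [Pm _] := dP mu mud.
  rewrite /S (dom_trans Pla Pn mn nl) /=; apply: contraNneq nnl => ml.
  by rewrite ml in mn; rewrite (dom_anti Pla Pn nl mn).
- by rewrite rpredB ?rpredZ // hom_EE.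
- move=> mu mud; rewrite -scaleN1r !(hcD, hcZ) mulN1r => Hne; apply/andP; split; last first.
    by apply: contraNneq Hne => ->; rewrite (EE_diag Hm dD lad mT) subrr.
  have [e|] := eqVneq (hc m mu) 0; last exact: mT.
  by move: Hne; rewrite e mulr0 subr0; apply: (EE_tri Hm dD lad mT).
have Sr mu : mu \in parts d -> S mu -> (rnk d mu < rnk d la)%N.
  move=> mud /andP[ml nml]; rewrite ltn_neqAle rnk_le // andbT.
  by apply: contraNneq nml => /(rnk_inj mud lad ml) ->.
have eS mu : mu \in parts d -> S mu -> eg la - eg mu != 0.
  by move=> mud /andP[_ nml]; rewrite subr_eq0; apply: contraNneq nml => /(eg_inj lad mud) ->.
have FE mu : mu \in parts d -> S mu -> EE (F mu) = eg mu *: F mu.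
  by move=> mud Sm; rewrite /F Sr //; have [] := gP mu mud (Sr mu mud Sm).
(* On F_mu the operator E - e_la is the scalar e_mu - e_la, which fixes the coefficients. *)
exists (m + \sum_(mu <- parts d | S mu) (c mu / (eg la - eg mu)) *: F mu); rewrite /mac_eigen las; split.
- rewrite rpredD // big_seq_cond rpred_sum // => mu /andP[mud _].
  by rewrite rpredZ //; have [] := Fg mu mud.
- rewrite hcD m1 hc_sum big_seq_cond big1 ?addr0 // => mu /andP[mud /andP[ml nml]].
  rewrite hcZ; apply/eqP; rewrite mulf_eq0 orbC; apply/orP; left.
  have [_ _ T] := Fg mu mud; apply: contraNT nml => /(T _ lad) lm.
  by have [Pm _] := dP mu mud; rewrite (dom_anti Pla Pm ml lm).
- move=> nu nud; rewrite hcD => Hne; have [e|] := eqVneq (hc m nu) 0; last exact: mT.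
  rewrite e add0r hc_sum in Hne.
  have [mu mud] : exists2 mu, mu \in parts d & S mu && (hc (c mu / (eg la - eg mu) *: F mu) nu != 0).
    apply/hasP; apply: contraNT Hne => /hasPn Hall; apply/eqP.
    rewrite big_seq_cond big1 // => mu /andP[mud Sm]; apply/eqP.
    by have := Hall mu mud; rewrite Sm negbK.
  rewrite hcZ mulf_eq0 negb_or => /and3P[/andP[ml _] _ Hm'].
  have [_ _ T] := Fg mu mud; have [Pm _] := dP mu mud.
  exact: dom_trans Pla Pm (T _ nud Hm') ml.
rewrite linearD /= linear_sum /= scalerDr -{1}[EE m](subrK (eg la *: m)) Ec -addrA addrCA.
congr (_ + _); rewrite -big_split scaler_sumr big_seq_cond [RHS]big_seq_cond.
apply: eq_bigr => mu /andP[mud Sm] /=.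
rewrite linearZ /= FE // !scalerA -scalerDl; congr (_ *: _).
by field; apply: eS.
Qed.
End Eigen.

(** * Orthogonality, expansions and uniqueness *)

Section MacdonaldBasis.
Variables (K : fieldType) (D : nat).
Local Notation Lam := {mpoly K[D]}.
Hypothesis K0 : forall n : nat, n.+1%:R != 0 :> K.
Variables q t : K.
Hypothesis t0 : t != 0.
Hypothesis q1 : forall r : nat, q ^+ r.+1 != 1.
Hypothesis t1 : forall r : nat, t ^+ r.+1 != 1.
Hypothesis spec : forall n (a b : nat -> nat),
  \sum_(i < n) q ^+ a i * t ^+ i = \sum_(i < n) q ^+ b i * t ^+ i -> forall i, (i < n)%N -> a i = b i.
Local Notation hom d f := ((f : Lam) \is d.-homog for (@mnmwgt D)).
Local Notation H := (@Tk K D (fun=> 1%R)).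
Local Notation EE := (@EE K D q t).
Local Notation En := (@En K D q t).
Local Notation B := (@Bform K D q t).
Local Notation Pe := (@Pe K D q t).
Local Notation eg := (@eg K q t).

Lemma eg_eq r s : eg r = eg s -> forall i, nth 0%N r i = nth 0%N s i.
Proof.
move=> E i; pose n := maxn i.+1 (maxn (size r) (size s)).
have rn : (size r <= n)%N by rewrite /n; lia.
have sn : (size s <= n)%N by rewrite /n; lia.
have := egE q t0 rn; rewrite E (egE q t0 sn) => /addrI /mulfI.
rewrite subr_eq0 (t_neq1 spec) => /(_ isT) N.
have := @spec n (fun i => nth 0%N s (n.-1 - i)) (fun i => nth 0%N r (n.-1 - i)) N (n.-1 - i)%N.
have -> : (n.-1 - (n.-1 - i) = i)%N by rewrite /n; lia.
by move=> -> //; rewrite /n; lia.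
Qed.

Lemma B_0 d (g : Lam) : B d 0 g = 0.
Proof. by rewrite -(scale0r g) B_Z mul0r. Qed.

Lemma PeD la : is_part la -> (sumn la <= D)%N -> mac_eigen q t la (Pe la).
Proof. exact: PeP. Qed.

Lemma Pe_parts d la : (d <= D)%N -> la \in parts d ->
  [/\ hom d (Pe la), hc (Pe la) la = 1, tri d (Pe la) la & EE (Pe la) = eg la *: Pe la].
Proof. by move=> dD; rewrite mem_parts => /andP[Pla /eqP E]; have := PeD Pla; rewrite /mac_eigen E; apply. Qed.

Lemma Pe_orth d la mu : (d <= D)%N -> la \in parts d -> mu \in parts d -> la != mu -> B d (Pe la) (Pe mu) = 0.
Proof.
move=> dD lad mud lm.
have [_ _ _ El] := Pe_parts dD lad; have [_ _ _ Em] := Pe_parts dD mud.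
have := B_EE K0 q t0 t1 d (Pe la) (Pe mu).
rewrite El Em B_Z [in RHS]B_sym B_Z [in RHS]B_sym => /eqP.
rewrite -subr_eq0 -mulrBl mulf_eq0 subr_eq0 => /orP[/eqP /(eg_inj t0 spec lad mud) e|/eqP //].
by rewrite e eqxx in lm.
Qed.

Lemma Pe_span d (S : pred (seq nat)) f : (d <= D)%N -> hom d f ->
  {in parts d &, forall la mu, dominated mu la -> S la -> S mu} ->
  {in parts d, forall mu, hc f mu != 0 -> S mu} ->
  exists c, f = \sum_(mu <- parts d | S mu) c mu *: Pe mu.
Proof.
move=> dD Hf Sd fS; apply: (tri_span K0 dD) => //.
- by move=> la lad; have [] := Pe_parts dD lad.
- by move=> la lad; have [] := Pe_parts dD lad.
by move=> la mu lad mud; have [_ _ T _] := Pe_parts dD lad; apply: T.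
Qed.

Lemma Pe_norm d la : (d <= D)%N -> la \in parts d -> B d (Pe la) (Pe la) != 0.
Proof.
move=> dD lad; apply/negP => /eqP N; have [Hl hl _ _] := Pe_parts dD lad.
suff P0 : Pe la = 0 by move: hl; rewrite P0 hc0 => /eqP; rewrite eq_sym oner_eq0.
apply: (B_nondeg K0 q1 t1 Hl dD) => g Hg.
have [//|//|c ->] := @Pe_span d xpredT g dD Hg.
rewrite B_sym B_sum big_seq_cond big1 // => mu /andP[mud _]; rewrite B_Z.
have [->|ml] := eqVneq mu la; first by rewrite N mulr0.
by rewrite (Pe_orth dD mud lad ml) mulr0.
Qed.

(** The coefficient of P_la, expressed by orthogonality. The form reads only the degree |la|, so
    [pc] also applies to inhomogeneous elements such as Phi * Gamma P_mu. *)
Definition pc la (f : Lam) : K := B (sumn la) f (Pe la) / B (sumn la) (Pe la) (Pe la).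

Lemma pcD la f g : pc la (f + g) = pc la f + pc la g.
Proof. by rewrite /pc B_D mulrDl. Qed.
Lemma pcZ la a f : pc la (a *: f) = a * pc la f.
Proof. by rewrite /pc B_Z mulrA. Qed.
Lemma pcB la f g : pc la (f - g) = pc la f - pc la g.
Proof. by rewrite -scaleN1r pcD pcZ mulN1r. Qed.
Lemma pc0 la : pc la 0 = 0.
Proof. by rewrite /pc B_0 mul0r. Qed.
Lemma pc_sum la (I : Type) (r : seq I) (P : pred I) (F : I -> Lam) :
  pc la (\sum_(i <- r | P i) F i) = \sum_(i <- r | P i) pc la (F i).
Proof. by rewrite /pc B_sum mulr_suml. Qed.

Lemma pc_Pe d la mu : (d <= D)%N -> la \in parts d -> mu \in parts d -> pc mu (Pe la) = (la == mu)%:R.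
Proof.
move=> dD lad mud; have := mud; rewrite /pc mem_parts => /andP[_ /eqP ->].
have [->|ne] := eqVneq la mu; first by rewrite divff // Pe_norm.
by rewrite (Pe_orth dD lad mud ne) mul0r.
Qed.

Lemma pc_hom0 d la f : hom d f -> d != sumn la -> (sumn la <= D)%N -> pc la f = 0.
Proof.
move=> Hf dl lD; rewrite /pc /Bform big_seq big1 ?mul0r // => s sd.
by rewrite (cf_hom0 Hf sd) // !mul0r.
Qed.

Lemma pc_suppS d (S : pred (seq nat)) f : (d <= D)%N -> hom d f ->
  {in parts d &, forall la mu, dominated mu la -> S la -> S mu} ->
  {in parts d, forall mu, hc f mu != 0 -> S mu} ->
  {in parts d, forall mu, ~~ S mu -> pc mu f = 0}.
Proof.
move=> dD Hf Sd fS mu mud Sm; have [c ->] := Pe_span dD Hf Sd fS.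
rewrite pc_sum big_seq_cond big1 // => nu /andP[nud Sn]; rewrite pcZ (pc_Pe dD nud mud).
by case: eqP => [e|]; [rewrite -e Sn in Sm | rewrite mulr0].
Qed.

Lemma Pe_exp d f : (d <= D)%N -> hom d f -> f = \sum_(mu <- parts d) pc mu f *: Pe mu.
Proof.
move=> dD Hf; have [//|//|c Ec] := @Pe_span d xpredT f dD Hf.
rewrite [LHS]Ec; apply: eq_big_seq => mu mud; congr (_ *: _).
rewrite Ec pc_sum (big_rem mu) //= pcZ (pc_Pe dD mud mud) eqxx mulr1 big_seq_cond big1 ?addr0 // => nu.
rewrite mem_rem_uniq ?uniq_parts // inE => /andP[/andP[nm nud] _].
by rewrite pcZ (pc_Pe dD nud mud) (negbTE nm) mulr0.
Qed.

Lemma pc_EE la f : is_part la -> (sumn la <= D)%N -> pc la (EE f) = eg la * pc la f.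
Proof.
move=> Pla lD; rewrite /pc (B_EE K0 q t0 t1) B_sym.
by have [_ _ _ ->] := PeD Pla lD; rewrite B_Z B_sym mulrA.
Qed.

Lemma eigen_Pe d la f : (d <= D)%N -> la \in parts d -> hom d f -> EE f = eg la *: f -> f = hc f la *: Pe la.
Proof.
move=> dD lad Hf Ef.
have Z mu : mu \in parts d -> mu != la -> pc mu f = 0.
  move=> mud ml; have := mud; rewrite mem_parts => /andP[Pm /eqP md].
  have := pc_EE f Pm; rewrite md => /(_ dD); rewrite Ef pcZ => /eqP.
  rewrite -subr_eq0 -mulrBl mulf_eq0 subr_eq0 => /orP[/eqP /(eg_inj t0 spec lad mud) e|/eqP //].
  by rewrite e eqxx in ml.
have fE : f = pc la f *: Pe la.
  rewrite {1}(Pe_exp dD Hf) (big_rem la) //= big_seq big1 ?addr0 // => mu.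
  by rewrite mem_rem_uniq ?uniq_parts // inE => /andP[ml mud]; rewrite Z // scale0r.
rewrite {1}fE; congr (_ *: _); rewrite {2}fE hcZ.
by have [_ -> _ _] := Pe_parts dD lad; rewrite mulr1.
Qed.

(** For mu strictly below la, P_mu is a combination of Q_nu with nu below or equal to mu.
    Orthogonality among the Q alone then makes Q_la orthogonal to P_mu, so that only the term P_la
    is left in Q_la. *)
Lemma Pe_uniq d (Q : seq nat -> Lam) : (d <= D)%N ->
  {in parts d, forall la, [/\ hom d (Q la), hc (Q la) la = 1 & tri d (Q la) la]} ->
  {in parts d &, forall la mu, mu != la -> B d (Q la) (Q mu) = 0} ->
  {in parts d, Q =1 Pe}.
Proof.
move=> dD HQ OQ la lad; have [Hl hl Tl] := HQ _ lad.
have Sd nu : is_part nu -> {in parts d &, forall la mu, dominated mu la -> dominated la nu -> dominated mu nu}.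
  move=> Pn a b; rewrite !mem_parts => /andP[Pa _] /andP[Pb _] ba; exact: dom_trans Pn Pa ba.
have Pp mu : mu \in parts d -> is_part mu by rewrite mem_parts => /andP[].
have [c Ec] := Pe_span dD Hl (Sd la (Pp _ lad)) Tl.
have Z mu : mu \in parts d -> mu != la -> pc mu (Q la) = 0.
  move=> mud ml; have [dml|ndml] := boolP (dominated mu la); last first.
    exact: (pc_suppS dD Hl (Sd la (Pp _ lad)) Tl mud ndml).
  have [Hm _ Tm _] := Pe_parts dD mud.
  have [||||||c' Ec'] := @tri_span K D K0 d Q (fun nu => dominated nu mu) (Pe mu) dD.
  - by move=> nu /HQ[].
  - by move=> nu /HQ[].
  - by move=> a b /HQ[_ _ T] bd; apply: T.
  - exact: Sd (Pp _ mud).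
  - exact: Hm.
  - exact: Tm.
  have := mud; rewrite /pc mem_parts => /andP[_ /eqP ->].
  rewrite B_sym Ec' B_sum big_seq_cond big1 ?mul0r // => nu /andP[nud nm].
  rewrite B_Z OQ ?mulr0 //; apply: contraNneq ml => e; rewrite -e in nm.
  by rewrite (dom_anti (Pp _ mud) (Pp _ lad) nm dml).
have QE : Q la = pc la (Q la) *: Pe la.
  rewrite {1}(Pe_exp dD Hl) (big_rem la) //= big_seq big1 ?addr0 // => mu.
  by rewrite mem_rem_uniq ?uniq_parts // inE => /andP[ml mud]; rewrite Z // scale0r.
have := hl; rewrite QE hcZ; have [_ -> _ _] := Pe_parts dD lad.
by rewrite mulr1 => ->; rewrite scale1r.
Qed.

(** [H_EE_top] cancels the first row from the eigenvalue equation. The coefficient of the highest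
    power of a variable is thus an eigenvector for e_la, and its leading coefficient is still 1. *)
Lemma H_Pe d l la : (d <= D)%N -> l :: la \in parts d -> H l (Pe (l :: la)) = Pe la.
Proof.
move=> dD lad; have [Hl hl Tl El] := Pe_parts dD lad.
have := lad; rewrite mem_parts => /andP[Pla /eqP /= ld].
have ld' : (l <= d)%N by lia.
have Pla' : is_part la by case/andP: Pla => /path_sorted S /andP[_ A]; apply/andP.
have lad' : la \in parts (d - l) by rewrite mem_parts Pla' /=; apply/eqP; lia.
have H0 k : (l < k)%N -> H k (Pe (l :: la)) = 0 by move=> lk; apply: (tri_H_gt K0 t0 Hl dD Pla Tl).
have Hh := hom_Tk (fun=> 1) Hl ld'.
rewrite (@eigen_Pe (d - l) la (H l (Pe (l :: la))) _ lad' Hh) ?hc_H ?hl ?scale1r //; first lia.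
have := H_EE_top K0 q t Hl dD H0; rewrite El TkZ /= => /eqP.
rewrite scalerDl (inj_eq (addIr _)) -scalerA (inj_eq (scalerI _)) ?invr_eq0 //.
by move/eqP.
Qed.
End MacdonaldBasis.

(** * The Pieri rule for p_1 *)

Arguments pw : simpl never.

Lemma is_part_behead l s : is_part (l :: s) -> is_part s.
Proof. by case/andP => /path_sorted S /andP[_ A]; apply/andP. Qed.

Lemma sumn_incr s j : sumn (incr_nth s j) = (sumn s).+1.
Proof. by elim: s j => [|x s IH] [|j] //=; [elim: j | rewrite IH addnS]. Qed.

Lemma nth_part_le s i j : is_part s -> (i <= j)%N -> (nth 0 s j <= nth 0 s i)%N.
Proof.
move=> Ps ij; have [sj|js] := leqP (size s) j; first by rewrite nth_default.
have := sorted_leq_nth geq_trans leqnn 0%N (is_part_sorted Ps).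
by move=> /(_ i j); rewrite !inE; apply => //; apply: leq_ltn_trans js.
Qed.

Section Psi.
Variables (K : fieldType) (q t : K).
Definition gf (z w : K) : K := (z - t * w / q) * (z - w / t) / ((z - w / q) * (z - w)).
(* The coefficient of P_(s + eps_j) in p_1 P_s; it is the product over i < j of
   [gf z_j z_i] with z_i = q^(s_i) t^(-i), and [gf] is homogeneous of degree 0. *)
Fixpoint psi (s : seq nat) (j : nat) : K :=
  if j is j'.+1 then
    if s is l :: s' then gf (q ^+ nth 0%N s' j' * t^-1 ^+ j) (q ^+ l) * psi s' j' else 0
  else 1.
End Psi.

Section Pieri.
Variables (K : fieldType) (D : nat).
Local Notation Lam := {mpoly K[D]}.
Hypothesis K0 : forall n : nat, n.+1%:R != 0 :> K.
Variables q t : K.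
Hypothesis t0 : t != 0.
Hypothesis q0 : q != 0.
Hypothesis q1 : forall r : nat, q ^+ r.+1 != 1.
Hypothesis t1 : forall r : nat, t ^+ r.+1 != 1.
Hypothesis spec : forall n (a b : nat -> nat),
  \sum_(i < n) q ^+ a i * t ^+ i = \sum_(i < n) q ^+ b i * t ^+ i -> forall i, (i < n)%N -> a i = b i.
Local Notation hom d f := ((f : Lam) \is d.-homog for (@mnmwgt D)).
Local Notation H := (@Tk K D (fun=> 1%R)).
Local Notation EE := (@EE K D q t).
Local Notation En := (@En K D q t).
Local Notation B := (@Bform K D q t).
Local Notation Pe := (@Pe K D q t).
Local Notation eg := (@eg K q t).
Local Notation pc := (@pc K D q t).
Local Notation p1 := (pw K D 1).
Local Notation psi := (psi q t).

Lemma eg_incr s j : eg (incr_nth s j) - eg s = (1 - t^-1) * (q - 1) * (q ^+ nth 0%N s j * t^-1 ^+ j).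
Proof.
elim: j s => [|j IH] s; rewrite [eg (incr_nth _ _)]eg_rec [eg s in LHS]eg_rec.
  by case: s => [|x s] /=; rewrite ?exprS; ring.
have -> : behead (incr_nth s j.+1) = incr_nth (behead s) j by case: s => //; case: (j).
have -> : nth 0%N (incr_nth s j.+1) 0 = nth 0%N s 0 by case: s.
have -> : nth 0%N s j.+1 = nth 0%N (behead s) j by rewrite nth_behead.
rewrite opprD addrACA subrr addr0 -mulrBr IH exprS; ring.
Qed.

Lemma hom_deriv0 (i : 'I_D) d f : hom d f ->
  if (i < d)%N then is_true (hom (d - i.+1)%N f^`M(i)) else f^`M(i) = 0.
Proof.
move=> Hf; suff [] : hom d f /\ (if (i < d)%N then is_true (hom (d - i.+1)%N f^`M(i)) else f^`M(i) = 0) by [].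
move: d f Hf; apply: (@hom_ind K D (fun d (f : Lam) => hom d f /\ (if (i < d)%N then is_true (hom (d - i.+1)%N f^`M(i)) else f^`M(i) = 0))).
- by rewrite dhomog1 ltn0 -mpolyC1 mderivC.
- by move=> d; rewrite mderiv0 dhomog0; split=> //; case: ifP => // _; rewrite dhomog0.
- move=> d c f g [df Hf] [dg Hg]; split; first by rewrite rpredD ?rpredZ.
  rewrite mderivD mderivZ; case: ifP Hf Hg => id Hf Hg; first by rewrite rpredD ?rpredZ.
  by rewrite Hf Hg scaler0 addr0.
move=> d j f [Hd Hf]; split; first by rewrite -pwE homM // hom_pw.
rewrite mderivM mderivU.
have HX : (i < d)%N -> hom (j.+1 + d - i.+1)%N ('X_j * f^`M(i)).
  move=> id; rewrite id in Hf; rewrite -addnBA // homM //.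
  by rewrite -pwE hom_pw.
have HX0 : (i < d)%N = false -> 'X_j * f^`M(i) = 0.
  by move=> id; rewrite id in Hf; rewrite Hf mulr0.
have [e|ij] := eqVneq i j; last first.
  rewrite mul0r add0r; case: ifP => idj.
    have [id|di] := boolP (i < d)%N; first exact: HX.
    by rewrite HX0 ?dhomog0 //; apply: negbTE.
  by apply: HX0; lia.
rewrite mul1r; case: ifP => idj; last by move: idj; rewrite e; lia.
rewrite rpredD //; first by rewrite e addKn.
have [id|di] := boolP (i < d)%N; first exact: HX.
by rewrite HX0 ?dhomog0 //; apply: negbTE.
Qed.

Hypothesis D0 : (0 < D)%N.
Let i0 := Ordinal D0.

Lemma hom_deriv d f : hom d.+1 f -> hom d f^`M(i0).
Proof. by move=> /(hom_deriv0 i0) /=; rewrite subSS subn0. Qed.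

Lemma B_p1 d (g f : Lam) : B d.+1 (p1 * g) f = zeta q t 1 * B d g f^`M(i0).
Proof. by rewrite (@pwE K D i0) B_adj /= subSS subn0. Qed.

Lemma B_Pe_exp d (g h : Lam) : (d <= D)%N -> hom d h ->
  B d g h = \sum_(ka <- parts d) pc ka g * B d (Pe ka) h.
Proof.
move=> dD Hh; rewrite {1}(Pe_exp K0 t0 q1 t1 spec dD Hh) B_sym B_sum.
apply: eq_big_seq => ka kad; rewrite B_Z B_sym.
rewrite {2}(Pe_exp K0 t0 q1 t1 spec dD Hh) [B d (Pe ka) _]B_sym B_sum.
rewrite (big_rem ka) //= big_seq big1 ?addr0 => [|nu].
  rewrite B_Z; have := kad; rewrite /pc mem_parts => /andP[_ /eqP ->].
  by have := Pe_norm K0 t0 q1 t1 spec dD kad => N; rewrite divfK // mulrAC [RHS]mulrAC [X in X / _]mulrC.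
rewrite mem_rem_uniq ?uniq_parts // inE => /andP[nk nud].
by rewrite B_Z (Pe_orth K0 t0 t1 spec dD nud kad nk) mulr0.
Qed.

(** Multiplication by p_1 is adjoint to a derivative, and the derivative of P_la lies in degree d;
    hence only that degree of g matters and g may be inhomogeneous. *)
Lemma pc_p1 la d g : is_part la -> sumn la = d.+1 -> (d < D)%N ->
  pc la (p1 * g) = \sum_(ka <- parts d) pc ka g * pc la (p1 * Pe ka).
Proof.
move=> Pla ld dD; have lad : la \in parts d.+1 by rewrite mem_parts Pla ld eqxx.
have [Hl _ _ _] := Pe_parts K0 t0 spec dD lad.
rewrite /pc ld B_p1 (B_Pe_exp _ (ltnW dD) (hom_deriv Hl)) mulr_sumr mulr_suml.
by apply: eq_bigr => ka _; rewrite B_p1 mulrCA -!mulrA.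
Qed.

(** In the basis of the P_la a commutator with E multiplies matrix entries by differences of
    eigenvalues. *)
Lemma pc_En la d g : is_part la -> sumn la = d.+1 -> (d < D)%N ->
  (q - 1) * pc la (En g) = \sum_(ka <- parts d) (eg la - eg ka) * (pc ka g * pc la (p1 * Pe ka)).
Proof.
move=> Pla ld dD; rewrite -pcZ.
have := EE_pw1 q t g D0; rewrite addrC => /eqP; rewrite -subr_eq => /eqP <-.
rewrite pcB (pc_EE K0 t0 t1 spec) ?ld // !(pc_p1 _ Pla ld dD) mulr_sumr -sumrB.
rewrite big_seq [RHS]big_seq; apply: eq_bigr => ka; rewrite mem_parts => /andP[Pk /eqP kd].
rewrite (pc_EE K0 t0 t1 spec) ?kd //; last exact: ltnW.
by rewrite mulrBl !mulrA.
Qed.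

Lemma head_down c d : {in parts d &, forall la mu, dominated mu la -> (nth 0 la 0 <= c)%N -> (nth 0 mu 0 <= c)%N}.
Proof.
move=> la mu; rewrite !mem_parts => /andP[Pl _] _ /(dom_head Pl); exact: leq_trans.
Qed.

Lemma H_0_head d (f : Lam) c : (d <= D)%N -> hom d f -> (forall k, (c < k)%N -> H k f = 0) ->
  {in parts d, forall mu, ~~ (nth 0 mu 0 <= c)%N -> pc mu f = 0}.
Proof.
move=> dD Hf f0; apply: (pc_suppS K0 t0 q1 t1 spec dD Hf (S := fun mu => nth 0 mu 0 <= c)%N).
  exact: head_down.
move=> mu mud; apply: contraNT; rewrite -ltnNge; case: mu mud => // x mu _ /= cx.
by rewrite -hc_H f0 // hc0.
Qed.

Lemma H_Pe0 d la k : (d <= D)%N -> la \in parts d -> (nth 0 la 0 < k)%N -> H k (Pe la) = 0.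
Proof.
move=> dD lad; have [Hl _ Tl _] := Pe_parts K0 t0 spec dD lad.
apply: (tri_H_gt K0 t0 Hl dD) Tl; by move: lad; rewrite mem_parts => /andP[].
Qed.

(** The derivative by p_1 commutes with every [H k], so the derivative of P_mu involves only first
    rows at most mu_0; adjointness transfers this to p_1 P_la. *)
Lemma pieri_low d la mu : (d < D)%N -> la \in parts d -> mu \in parts d.+1 ->
  (nth 0 mu 0 < nth 0 la 0)%N -> pc mu (p1 * Pe la) = 0.
Proof.
move=> dD lad mud ml; have := mud; rewrite mem_parts => /andP[_ /eqP md].
have [Hm _ _ _] := Pe_parts K0 t0 spec dD mud.
have Hd := hom_deriv Hm.
rewrite /pc md B_p1 B_sym (Pe_exp K0 t0 q1 t1 spec (ltnW dD) Hd) B_sum (big_rem la) //= B_Z.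
rewrite (H_0_head (ltnW dD) Hd (c := nth 0 mu 0)%N) //; last by rewrite -ltnNge.
  rewrite mul0r add0r big_seq big1 ?mulr0 ?mul0r // => nu.
  rewrite mem_rem_uniq ?uniq_parts // inE => /andP[nl nud].
  by rewrite B_Z (Pe_orth K0 t0 t1 spec (ltnW dD) nud lad nl) mulr0.
by move=> k mk; rewrite -Tk_deriv (H_Pe0 dD mud mk) mderiv0.
Qed.

(** In [H_EE_subtop] for P_(l+1, la), E acts by scalars on both sides and [En] reduces to p_1 P_la.
    This ties the coefficient of the second highest power of a variable to the Pieri coefficients of
    la. *)
Lemma pc_sub d l la mu : (d <= D)%N -> l.+1 :: la \in parts d -> mu \in parts (d - l) ->
  (eg (l.+1 :: la) - eg (l :: mu)) * (q - 1) * pc mu (H l (Pe (l.+1 :: la))) =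
  (1 - t^-1) * ((q - 1) * (1 - t^-1) * q ^+ l.+1 - (eg mu - eg la)) * pc mu (p1 * Pe la).
Proof.
move=> dD lad mud; have [Hl _ _ El] := Pe_parts K0 t0 spec dD lad.
have := lad; rewrite mem_parts => /andP[Pla /eqP ld]; rewrite /= in ld.
have Pla' := is_part_behead Pla; have lad' := part_parts Pla'.
have := mud; rewrite mem_parts => /andP[Pmu /eqP md].
have md' : sumn mu = (sumn la).+1 by lia.
have lD : (sumn la < D)%N by lia.
have H0 k : (l.+1 < k)%N -> H k (Pe (l.+1 :: la)) = 0 by move=> lk; apply: (H_Pe0 dD lad).
have := H_EE_subtop K0 q t Hl dD D0 H0.
rewrite El TkZ (H_Pe K0 t0 q1 t1 spec dD lad) (G1 K0) // -scalerAl => /(congr1 (fun f => (q - 1) * pc mu f)).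
rewrite pcZ pcD !pcZ pcB pcD !pcZ (pc_EE K0 t0 t1 spec) //; last by rewrite md'.
have En_E : (q - 1) * pc mu (En (Pe la)) = (eg mu - eg la) * pc mu (p1 * Pe la).
  rewrite (pc_En _ Pmu md' lD) (big_rem la) //= (pc_Pe K0 t0 q1 t1 spec (ltnW lD)) // eqxx mul1r.
  rewrite big_seq big1 ?addr0 // => nu; rewrite mem_rem_uniq ?uniq_parts // inE => /andP[nl nud].
  by rewrite (pc_Pe K0 t0 q1 t1 spec (ltnW lD)) // eq_sym (negbTE nl) mul0r mulr0.
move: En_E; set X := pc mu (H l _); set P := pc mu (p1 * _); set N := pc mu (En _).
move=> NE E; rewrite [RHS](_ : _ = (1 - t^-1) * ((q - 1) * (1 - t^-1) * q ^+ l.+1 * P - (eg mu - eg la) * P)); last by ring.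
rewrite -NE; move: E; rewrite [eg (_ :: la)]/= [eg (_ :: mu)]/=; set e1 := eg la; set e2 := eg mu => E.
have -> : (t^-1 * e1 + (1 - t^-1) * q ^+ l.+1 - (t^-1 * e2 + (1 - t^-1) * q ^+ l)) * (q - 1) * X =
  (q - 1) * ((t^-1 * e1 + (1 - t^-1) * q ^+ l.+1) * X) - (t^-1 * e2 + (1 - t^-1) * q ^+ l) * (q - 1) * X by ring.
rewrite E; ring.
Qed.

Lemma pc_top d c mu f : (d < D)%N -> hom d.+1 f -> (forall k, (c < k)%N -> H k f = 0) ->
  c :: mu \in parts d.+1 -> pc (c :: mu) f = pc mu (H c f).
Proof.
move=> dD Hf f0 cmu; have := cmu; rewrite mem_parts => /andP[Pcmu /eqP cd]; rewrite /= in cd.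
rewrite [in RHS](Pe_exp K0 t0 q1 t1 spec dD Hf) linear_sum pc_sum /=.
rewrite (big_rem (c :: mu)) //= TkZ pcZ (H_Pe K0 t0 q1 t1 spec dD cmu).
have mud : mu \in parts (sumn mu) := part_parts (is_part_behead Pcmu).
have mD : (sumn mu <= D)%N by lia.
rewrite (pc_Pe K0 t0 q1 t1 spec mD) // eqxx mulr1 big_seq big1 ?addr0 // => nu.
rewrite mem_rem_uniq ?uniq_parts // inE => /andP[ne nud]; rewrite TkZ pcZ.
have [nc|cn|e] := ltngtP (nth 0%N nu 0) c.
- by rewrite (H_Pe0 dD nud nc) pc0 mulr0.
- by rewrite (H_0_head dD Hf f0 nud) ?mul0r // -ltnNge.
case: nu nud ne e => [|x nu] nud ne /= e.
  by move: nud; rewrite mem_parts.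
rewrite e in nud ne *; rewrite (H_Pe K0 t0 q1 t1 spec dD nud).
have := nud; rewrite mem_parts => /andP[Pn /eqP nd]; rewrite /= in nd.
have nud' : nu \in parts (sumn mu).
  by rewrite mem_parts (is_part_behead Pn); apply/eqP; lia.
rewrite (pc_Pe K0 t0 q1 t1 spec mD nud' mud); case: eqP => [e'|]; last by rewrite mulr0.
by rewrite e' eqxx in ne.
Qed.

Hypothesis indep : forall a b c d, q ^+ a * t ^+ b = q ^+ c * t ^+ d -> a = c /\ b = d.

Definition sfac L la mu : K :=
  (1 - t^-1) * ((q - 1) * (1 - t^-1) * q ^+ L.+1 - (eg mu - eg la)) /
  ((eg (L.+1 :: la) - eg (L :: mu)) * (q - 1)).

Lemma pc_subE d l la mu : (d <= D)%N -> l.+1 :: la \in parts d -> mu \in parts (d - l) ->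
  pc mu (H l (Pe (l.+1 :: la))) = sfac l la mu * pc mu (p1 * Pe la).
Proof.
move=> dD lad mud; rewrite /sfac mulrAC -(pc_sub dD lad mud) mulrC mulrA mulVf ?mul1r //.
apply: mulf_neq0; last by rewrite subr_eq0 -[q]expr1 q1.
rewrite subr_eq0; apply/negP => /eqP /(eg_eq t0 spec) /(_ 0%N) /=; lia.
Qed.

Lemma q_t_neq a b c : q ^+ a - q ^+ c * t^-1 ^+ b.+1 != 0.
Proof.
rewrite subr_eq0; apply/negP => /eqP /(congr1 (fun z => z * t ^+ b.+1)).
rewrite -mulrA -exprMn mulVf // expr1n => e.
have [] := @indep a b.+1 c 0%N; first by rewrite e expr0.
by [].
Qed.

(** The three contributions when a row l+1 is put on top of la: 1 from p_1 itself, [sfac l] from the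
    subleading coefficient of P_(l+1, la), and [sfac l.+1] from that of the P_(l+2, la) subtracted
    in [pieri]. *)
Lemma sfac_gf l la j : 1 + sfac l la (incr_nth la j) - sfac l.+1 la (incr_nth la j) =
  gf q t (q ^+ nth 0%N la j * t^-1 ^+ j.+1) (q ^+ l.+1).
Proof.
have Hq : q - 1 != 0 by rewrite subr_eq0 -[q]expr1 q1.
have Ht : t - 1 != 0 by rewrite subr_eq0 -[t]expr1 t1.
have t1' : 1 - t^-1 != 0 by rewrite subr_eq0 eq_sym -(inj_eq (mulfI t0)) mulfV // mulr1 eq_sym -subr_eq0.
set z := q ^+ nth 0%N la j * t^-1 ^+ j.+1.
have E : eg (incr_nth la j) - eg la = (1 - t^-1) * (q - 1) * (t * z).
  by rewrite eg_incr // /z exprS [t * _]mulrCA mulVKf.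
have S L : q ^+ L - z != 0 -> sfac L la (incr_nth la j) = (1 - t^-1) * (q ^+ L.+1 - t * z) / ((q - 1) * (q ^+ L - z)).
  move=> nz; rewrite /sfac /= E.
  have -> : t^-1 * eg la + (1 - t^-1) * q ^+ L.+1 - (t^-1 * eg (incr_nth la j) + (1 - t^-1) * q ^+ L)
     = (1 - t^-1) * (q - 1) * (q ^+ L - z).
    rewrite -[eg (incr_nth la j)](subrK (eg la)) E exprS; field; exact: t0.
  by field; rewrite nz Hq t0 Ht.
have z1 := q_t_neq l j (nth 0%N la j); have z2 := q_t_neq l.+1 j (nth 0%N la j).
rewrite -/z in z1 z2; rewrite !S // /gf !exprS; rewrite exprS in z2.
have z2' : z - q * q ^+ l != 0 by rewrite -opprB oppr_eq0.
move: z1 z2 z2' Hq t0 q0; clear; set w := q ^+ l => z1 z2 z2' Hq t0 q0.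
by field; rewrite q0 z2' t0 z2 Hq z1 -opprB oppr_eq0 z1.
Qed.

Lemma Pe_nil : Pe [::] = 1.
Proof.
rewrite (@eigen_Pe K D K0 q t t0 q1 t1 spec 0 [::] 1) //.
- by rewrite /hc /= mcoeff1 eqxx scale1r.
- exact: dhomog1.
- by rewrite EE1 //= scale1r.
Qed.

(** Induction on the rows of la, reading coefficients from the highest power of a variable. Only
    first rows l+1 and l+2 occur: l+2 forces the other rows to be la, with coefficient 1, and l+1
    reduces to the Pieri rule for la. *)
Lemma pieri la mu : is_part la -> (sumn la < D)%N -> mu \in parts (sumn la).+1 ->
  pc mu (p1 * Pe la) = \sum_(j < (size la).+1 | incr_nth la j == mu) psi la j.
Proof.
elim: la mu => [|l la IH] mu Pla lD mud.
  have H1 : hom 1 p1 by rewrite hom_pw.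
  have -> : mu = [:: 1%N] by move: mud; rewrite /parts /= inE => /eqP.
  rewrite Pe_nil mulr1 big_mkcond big_ord1 /=.
  have := Pe_exp K0 t0 q1 t1 spec D0 H1; rewrite {1}/parts [filter _ _]/= big_seq1.
  move=> /(congr1 (fun f => hc f [:: 1%N])); rewrite hcZ.
  have [_ -> _ _] := @Pe_parts K D K0 q t t0 spec 1 [:: 1%N] D0 isT.
  rewrite mulr1 => <-; rewrite -[p1]mulr1 hc_pw //= big_mkcond big_ord1 /=.
  by rewrite -mpolyC1 hcC /=.
case: l Pla lD mud => [|l] Pla lD mud; first by case/is_part_pos/andP: Pla.
have lad := part_parts Pla; have Pla' := is_part_behead Pla.
have dE : sumn (l.+1 :: la) = (l.+1 + sumn la)%N by [].
move: (sumn (l.+1 :: la)) dE lad lD mud => d dE lad lD mud.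
have [Hl _ _ _] := Pe_parts K0 t0 spec (ltnW lD) lad.
set f := p1 * Pe _; have Hf : hom d.+1 f by apply: (@homM K D 1 d) => //; apply: hom_pw.
have HH k : H k f = p1 * H k (Pe (l.+1 :: la)) + (if (0 < k)%N then H (k - 1) (Pe (l.+1 :: la)) else 0).
  by rewrite /f Tk_pwM // scale1r.
have low nu : nu \in parts d.+1 -> (nth 0 nu 0 < l.+1)%N -> pc nu f = 0.
  by move=> nud; apply: (pieri_low lD lad nud).
clearbody f; have f0 k : (l.+2 < k)%N -> H k f = 0.
  move=> lk; rewrite HH !(H_Pe0 (ltnW lD) lad) /= ?mulr0 ?add0r ?if_same //; clear -lk; lia.
have := mud; rewrite mem_parts; case: mu mud => [|x mu] mud // /andP[Pmu /eqP md].
rewrite /= in md.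
rewrite big_mkcond big_ord_recl /= eqseq_cons.
under eq_bigr => j _ do rewrite eqseq_cons.
have [xl|lx|e] := ltngtP x l.+1.
- rewrite (low _ mud) // big1 ?addr0 //.
  by have -> : (l.+2 == x) = false by clear -xl; apply/eqP; lia.
- rewrite big1 ?addr0 => [|j _] //.
  have [lx'|xl'] := ltnP l.+2 x.
    have -> : (l.+2 == x) = false by clear -lx'; apply/eqP; lia.
    by rewrite (H_0_head lD Hf f0 mud) // -ltnNge.
  have ex : x = l.+2 by clear -lx xl'; lia.
  rewrite ex in mud md *; rewrite eqxx (pc_top lD Hf f0 mud) HH /= subn1 /=.
  rewrite (H_Pe0 (ltnW lD) lad) // mulr0 add0r (H_Pe K0 t0 q1 t1 spec (ltnW lD) lad).
  have mud' : mu \in parts (sumn la) by rewrite mem_parts (is_part_behead Pmu); clear -md dE; apply/eqP; lia.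
  rewrite (pc_Pe K0 t0 q1 t1 spec _ _ mud') ?part_parts //; last by clear -dE lD; lia.
  by case: (_ == _).
rewrite e in mud md *; rewrite (_ : (l.+2 == l.+1) = false) ?add0r; last by clear; apply/eqP; lia.
have la2 : l.+2 :: la \in parts d.+1.
  rewrite mem_parts; apply/andP; split; last by rewrite dE.
  case/andP: Pla => Hs Hp; apply/andP; split=> //=.
  by case: (la) Hs => //= y s /andP[yl ->]; rewrite andbT; apply: leqW.
have [Hl2 _ _ _] := Pe_parts K0 t0 spec lD la2.
have mud' : mu \in parts (sumn la).+1 by rewrite mem_parts (is_part_behead Pmu); clear -md dE; apply/eqP; lia.
(* Subtracting P_(l+2, la) removes the coefficient of y^(l+2) without affecting this one, so
   [pc_top] applies at the exponent l+1. *)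
have -> : pc (l.+1 :: mu) f = pc (l.+1 :: mu) (f - Pe (l.+2 :: la)).
  rewrite pcB (pc_Pe K0 t0 q1 t1 spec lD la2 mud) eqseq_cons.
  by rewrite (_ : (l.+2 == l.+1) = false) ?subr0 //; clear; lia.
rewrite (pc_top lD _ _ mud); first last.
- move=> k; rewrite leq_eqVlt => /orP[/eqP <-|lk].
    rewrite linearB /= HH /= subn1 /= (H_Pe0 (ltnW lD) lad) // mulr0 add0r.
    by rewrite (H_Pe K0 t0 q1 t1 spec (ltnW lD) lad) (H_Pe K0 t0 q1 t1 spec lD la2) subrr.
  by rewrite linearB /= f0 // (H_Pe0 lD la2) // subrr.
- by rewrite rpredB.
rewrite linearB /= HH /= subn1 /= pcB pcD (H_Pe K0 t0 q1 t1 spec (ltnW lD) lad).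
have mud1 : mu \in parts (d - l) by rewrite (_ : (d - l = (sumn la).+1)%N) //; clear -dE; lia.
have mud2 : mu \in parts (d.+1 - l.+1) by rewrite (_ : (d.+1 - l.+1 = (sumn la).+1)%N) //; clear -dE; lia.
rewrite (pc_subE (ltnW lD) lad mud1) (pc_subE lD la2 mud2) -[X in X + _ - _]mul1r -mulrDl -mulrBl.
rewrite IH //; last by clear -dE lD; lia.
rewrite mulr_sumr big_mkcond; apply: eq_bigr => j _ /=.
by case: eqP => // <-; rewrite sfac_gf.
Qed.
End Pieri.

(** * The recurrences for the left-hand side *)

Section Gamma.
Variables (K : fieldType) (D : nat).
Local Notation Lam := {mpoly K[D]}.
Hypothesis K0 : forall n : nat, n.+1%:R != 0 :> K.
Variables q t : K.
Hypothesis t0 : t != 0.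
Hypothesis q1 : forall r : nat, q ^+ r.+1 != 1.
Hypothesis t1 : forall r : nat, t ^+ r.+1 != 1.
Variable N : nat.
Local Notation hom d f := ((f : Lam) \is d.-homog for (@mnmwgt D)).
Local Notation G := (GN D (fun r => 1 - t^-1 ^+ r)).
Local Notation U := (@Tk K D (fun r => q ^+ r - 1)).
Local Notation EE := (@EE K D q t).
Local Notation En := (@En K D q t).

Definition tau r : K := \sum_(i < N) t ^+ (i * r).

Definition Gam : Lam -> Lam := ev (@mpolyC D K) (fun r => t^-1 ^+ r *: pw K D r + (tau r)%:MP).
HB.instance Definition _ := GRing.RMorphism.copy Gam
  (ev (@mpolyC D K) (fun r => t^-1 ^+ r *: pw K D r + (tau r)%:MP)).

Lemma tauE r : (1 - t ^+ r) * tau r = 1 - (t ^+ N) ^+ r.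
Proof.
rewrite -exprM mulnC exprM -[1 in RHS](expr1n _ N) subrXX mulrC /tau mulr_suml mulr_sumr.
by apply: eq_bigr => i _; rewrite expr1n mul1r mulrC -exprM mulnC.
Qed.

Lemma GamZ c f : Gam (c *: f) = c *: Gam f.
Proof. by rewrite /Gam evZ mul_mpolyC. Qed.

Lemma GamC c : Gam c%:MP = c%:MP.
Proof. exact: evC. Qed.

Lemma GamX (i : 'I_D) : Gam 'X_i = t^-1 ^+ i.+1 *: 'X_i + (tau i.+1)%:MP.
Proof. by rewrite /Gam evX pwE. Qed.

Lemma Gam_pw1 : (0 < D)%N -> Gam (pw K D 1) = t^-1 *: pw K D 1 + (tau 1)%:MP.
Proof. by move=> D0; rewrite /Gam ev_pw //. Qed.

(** Gamma turns the series G(s) into G(s / t) (1 - s / t) / (1 - t^(N-1) s); this is the identity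
    with the denominator cleared. *)
Lemma Gam_G k : (k < D)%N -> Gam (G k.+1) - (t ^+ N / t) *: Gam (G k) = t^-1 ^+ k.+1 *: (G k.+1 - G k).
Proof.
move=> kD; pose T := t ^+ N.
have H1 : newton D (fun r => (t^-1 ^+ r * (1 - t^-1 ^+ r)) *: pw K D r) (fun k => t^-1 ^+ k *: G k).
  have [g0 gS] := GNP D K0 (fun r => 1 - t^-1 ^+ r) D; split; first by rewrite g0 scale1r.
  move=> i iD; rewrite -scalerAr gS // scaler_sumr; apply: eq_bigr => r _.
  have ri := ltn_ord r.
  rewrite -!scalerAl -scalerAr !scalerA; congr (_ *: _).
  have {1}-> : t^-1 ^+ i.+1 = t^-1 ^+ r.+1 * t^-1 ^+ (i - r).
    by rewrite -exprD; congr (_ ^+ _); lia.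
  by ring.
have H2 := newton_geom ((T / t)%:MP : Lam) (t^-1)%:MP D.
have H3 := newton_conv H1 H2.
pose v r := t^-1 ^+ r *: pw K D r + (tau r)%:MP : Lam.
have H4 : newton D (fun r => (t^-1 ^+ r * (1 - t^-1 ^+ r)) *: pw K D r + ((T / t)%:MP ^+ r - (t^-1)%:MP ^+ r))
   (fun k => ev (@mpolyC D K) v (G k)).
  apply: eq_newton (@ev_GN K D K0 _ (@mpolyC D K) v (fun r => 1 - t^-1 ^+ r)) => // r _.
  rewrite /v mulrDr mul_mpolyC scalerA [_ * t^-1 ^+ r]mulrC; congr (_ + _).
  rewrite -!rmorphXn -rmorphB -rmorphM /=; congr (_%:MP).
  have : (1 - t^-1 ^+ r) * tau r = - (t^-1 ^+ r) * ((1 - t ^+ r) * tau r).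
    rewrite mulrA; congr (_ * _); rewrite mulrBr mulNr mulr1 mulNr -exprMn mulVf // expr1n; ring.
  by rewrite tauE => ->; rewrite expr_div_n /T exprVn; field; rewrite expf_neq0.
set g := (fun k : nat => match k with 0%N => 1 | _ => _ end) in H3.
have cg := @conv_geom _ (fun k => t^-1 ^+ k *: G k) g (T / t)%:MP (t^-1)%:MP k erefl (fun j => erefl).
rewrite -[Gam (G k.+1)]/(ev _ v _) -[Gam (G k)]/(ev _ v _).
rewrite (newton_uniq (@mpolyC D K) K0 H4 H3 kD) (newton_uniq (@mpolyC D K) K0 H4 H3 (ltnW kD)).
rewrite -mul_mpolyC cg mul_mpolyC scalerA -exprS scalerBr.
by [].
Qed.

Lemma Gam_Tk c k f : Gam (Tk c k f) = t ^+ k *: Tk c k (Gam f).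
Proof.
rewrite -Tk_scale !TkE -coef_map.
suff : map_poly Gam (tr c f) = tr (fun r => c r * t ^+ r) (Gam f) by move=> <-; rewrite coef_map.
move: f; apply: (@rm_ext K D _ (map_poly Gam \o tr c) (tr (fun r => c r * t ^+ r) \o Gam)) => [b|i] /=.
  by rewrite trC map_polyC /= GamC trC.
have trD (f g : Lam) : tr (fun r => c r * t ^+ r) (f + g) = tr (fun r => c r * t ^+ r) f + tr (fun r => c r * t ^+ r) g := rmorphD _ _ _.
rewrite trX rmorphD /= map_polyC map_polyZ map_polyXn /= GamC GamX trD trC trZ trX polyCD.
rewrite scalerDr scalerA -rmorphM /= addrAC; congr (_ + _ + _).
  by rewrite -mul_polyC -polyCM mul_mpolyC.
congr (_%:MP *: _); rewrite mulrCA -exprMn mulVf // expr1n mulr1.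
by [].
Qed.

Lemma hom_En d f : hom d f -> hom d.+1 (En f).
Proof.
move=> Hf; rewrite En_E rpred_sum // => k _.
have [kd|dk] := leqP k d; last by rewrite (Tk_gt _ Hf dk) mulr0 dhomog0.
have -> : (d.+1 = k.+1 + (d - k))%N by lia.
by rewrite homM ?hom_GN // hom_Tk.
Qed.

(** In every summand the power of t from [Gam_G] cancels that from [Gam_Tk] up to one factor 1/t,
    independent of k, so the sum is again built from En and E. *)
Lemma Gam_En d f : hom d f -> (d < D)%N ->
  Gam (En f) - (t ^+ N / t) *: Gam (EE f) = t^-1 *: (En (Gam f) - EE (Gam f)).
Proof.
move=> Hf dD; rewrite !En_E !EE_E [in Gam (\sum_(k < D.+1) _)]big_ord_recr /= (Tk_gt _ Hf dD) mulr0 addr0.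
rewrite [X in _ = _ *: (_ - X)]big_ord_recr /=.
have -> : U D (Gam f) = 0.
  have := Gam_Tk (fun r => q ^+ r - 1) D f; rewrite (Tk_gt _ Hf dD) rmorph0 => /eqP.
  by rewrite eq_sym scaler_eq0 expf_eq0 (negbTE t0) andbF => /eqP.
rewrite mulr0 addr0 !rmorph_sum /= scaler_sumr -!sumrB scaler_sumr; apply: eq_bigr => k _.
rewrite !rmorphM /= scalerAl -mulrBl Gam_G // Gam_Tk -scalerAl -scalerAr scalerA -mulrBl.
by rewrite exprS -mulrA -exprMn mulVf // expr1n mulr1.
Qed.

Definition aa : K := q * t^-1 ^+ N.+1.
Definition Ph k : Lam := GN D (fun r => (1 - aa ^+ r) / (1 - q ^+ r)) k.
Definition Phi : Lam := \sum_(k < D.+1) Ph k.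
Lemma PhiE : Phi = \sum_(k < D.+1) Ph k. Proof. by []. Qed.

Lemma hom_Ph k : hom k (Ph k). Proof. exact: hom_GN. Qed.

Lemma Ph0 : Ph 0 = 1.
Proof. by have [] := GNP D K0 (fun r => (1 - aa ^+ r) / (1 - q ^+ r)) 0. Qed.

(** Coefficients of (1 - y)/(1 - a y), the factor that Phi acquires when p_r is shifted by (q^r - 1)
    y^r. *)
Definition nu_ j : K := if j is j'.+1 then aa ^+ j - 1 * aa ^+ j' else 1.

Lemma U_Ph j k : (k <= D)%N -> U j (Ph k) = if (j <= k)%N then nu_ j *: Ph (k - j) else 0.
Proof.
move=> kD; apply: (Tk_GN K0) => //; apply: eq_newton (newton_geom aa 1 D) => // r /andP[r0 _].
have nz : 1 - q ^+ r != 0 by case: r r0 => // r _; rewrite subr_eq0 eq_sym q1.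
by rewrite expr1n -[q ^+ r - 1]opprB mulrN divfK // opprB.
Qed.

Lemma U_PhM j k g : (k < D)%N ->
  U j.+1 (Ph k.+1 * g) - aa *: U j (Ph k * g) = Ph k.+1 * U j.+1 g - Ph k * U j g.
Proof.
move=> kD; rewrite !TkM big_ord_recl /= Tk0 subn0 -addrA; congr (_ + _).
rewrite scaler_sumr -sumrB.
have E i : U i.+1 (Ph k.+1) * U (j.+1 - i.+1) g - aa *: (U i (Ph k) * U (j - i) g) =
    if i == 0%N then - (Ph k * U j g) else 0.
  rewrite !subSS scalerAl -mulrBl (U_Ph _ kD) (U_Ph _ (ltnW kD)) ltnS subSS.
  case: ifP => ik; last first.
    by rewrite scaler0 subrr mul0r; case: eqP ik => // ->.
  rewrite scalerA -scalerBl; case: i ik => [|i] ik.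
    by rewrite /= !subn0 expr1 expr0 !mulr1 addrAC subrr add0r scaleN1r mulNr.
  have -> : nu_ i.+2 - aa * nu_ i.+1 = 0 by rewrite /nu_ !exprS; ring.
  by rewrite scale0r mul0r.
rewrite (eq_bigr (fun i : 'I_j.+1 => if i == 0%N :> nat then - (Ph k * U j g) else 0)); last first.
  by move=> i _; rewrite -E.
by rewrite big_ord_recl /= big1 ?addr0.
Qed.

(** Clearing 1 - a y couples U_(j+1) on one degree of Phi with U_j on the previous one. This pairs E
    in one degree with En in the previous one, hence the two indices of [Ph]. *)
Lemma EE_Ph k g : (k < D)%N ->
  EE (Ph k.+1 * g) - aa *: En (Ph k * g) = Ph k.+1 * EE g - Ph k * En g.
Proof.
move=> kD; rewrite !EE_E !En_E big_ord_recl [in X in _ = X - _]big_ord_recl /= !Tk0.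
rewrite mulrDr -!addrA; congr (_ + _); first by rewrite mulrCA.
rewrite scaler_sumr !mulr_sumr -!sumrB; apply: eq_bigr => j _.
rewrite /bump /= add1n scalerAr -mulrBr U_PhM // mulrBr.
by congr (_ - _); rewrite mulrCA.
Qed.
End Gamma.

(** * Adding and removing boxes *)

Lemma is_part_cons x s : is_part (x :: s) = [&& (0 < x)%N, (nth 0 s 0 <= x)%N & is_part s].
Proof.
apply/idP/and3P => [P|[x0 sx P]]; last by have [] := ins_cons P sx x0.
split; [by case/is_part_pos/andP: P | | exact: is_part_behead P].
by have := nth_part_le P (leq0n 1).
Qed.

Lemma part_eq r s : is_part r -> is_part s -> (forall i, nth 0 r i = nth 0 s i)%N -> r = s.
Proof.
elim: r s => [|x r IH] [|y s] //.
- by rewrite is_part_cons => _ /and3P[y0 _ _] /(_ 0%N) /=; lia.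
- by rewrite is_part_cons => /and3P[x0 _ _] _ /(_ 0%N) /=; lia.
rewrite !is_part_cons => /and3P[_ _ Pr] /and3P[_ _ Ps] H; congr (_ :: _); first exact: (H 0%N).
by apply: IH => // i; apply: (H i.+1).
Qed.

(** A row of length 1 is replaced by the end of the list, which is right only if no rows follow;
    this is ensured where row i is removable, as in [decrP]. *)
Fixpoint decr (s : seq nat) (i : nat) : seq nat :=
  if s is x :: s' then
    if i is i'.+1 then x :: decr s' i' else if (x <= 1)%N then [::] else x.-1 :: s'
  else [::].

Lemma decrP s i : is_part s -> (nth 0 s i.+1 < nth 0 s i)%N ->
  is_part (decr s i) /\ incr_nth (decr s i) i = s.
Proof.
elim: s i => [|x s IH] [|i] //; rewrite is_part_cons => /and3P[x0 sx Ps] /= Hi.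
  case: ltnP => x1.
    rewrite is_part_cons Ps /=; split; last by rewrite prednK.
    by rewrite andbT; apply/andP; split; lia.
  have -> : s = [::] by case: s Ps {IH sx} Hi => // y s; rewrite is_part_cons /= => /and3P[]; lia.
  by split=> //=; congr [:: _]; lia.
have [Pd E] := IH i Ps Hi; split; last by rewrite E.
rewrite is_part_cons x0 Pd andbT /=; apply: leq_trans sx.
by rewrite -[in X in (_ <= X)%N]E nth_incr_nth leq_addl.
Qed.

Lemma decrK ka s i : is_part ka -> is_part s -> incr_nth ka i = s ->
  ka = decr s i /\ (nth 0 s i.+1 < nth 0 s i)%N.
Proof.
move=> Pk Ps E; have lt : (nth 0 s i.+1 < nth 0 s i)%N.
  by rewrite -E !nth_incr_nth eqxx ltn_eqF //= add0n ltnS nth_part_le.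
split=> //; have [Pd Ed] := decrP Ps lt; apply: part_eq => // j.
by apply/eqP; rewrite -(eqn_add2l (i == j)) -!nth_incr_nth E Ed.
Qed.

Lemma nth_decr s i j : is_part s -> (nth 0 s i.+1 < nth 0 s i)%N ->
  (nth 0 s j = (i == j) + nth 0 (decr s i) j)%N.
Proof. by move=> Ps lt; have [_ {1}<-] := decrP Ps lt; rewrite nth_incr_nth. Qed.

Lemma sumn_decr s i : is_part s -> (nth 0 s i.+1 < nth 0 s i)%N -> sumn s = (sumn (decr s i)).+1.
Proof. by move=> Ps lt; have [_ {1}<-] := decrP Ps lt; rewrite sumn_incr. Qed.

Lemma size_decr s i : (size (decr s i) <= size s)%N.
Proof. by elim: s i => [|x s IH] [|i] //=; [case: ifP | rewrite ltnS]. Qed.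

Lemma incr_size ka i : is_part (incr_nth ka i) -> (i <= size ka)%N.
Proof.
move=> P; rewrite leqNgt; apply/negP => ki.
have := all_nthP 0%N (is_part_pos P) (size ka); rewrite size_incr_nth nth_incr_nth.
rewrite gtn_eqF // nth_default //= => H; suff : (0 < 0)%N by [].
by apply: H; case: ifP; lia.
Qed.

Lemma sum_incr (V : nmodType) mu (F : nat -> seq nat -> V) :
  \sum_(nu <- parts (sumn mu).+1) \sum_(j < (size mu).+1 | incr_nth mu j == nu) F j nu =
  \sum_(j < (size mu).+1 | is_part (incr_nth mu j)) F j (incr_nth mu j).
Proof.
rewrite (exchange_big_dep xpredT) //= [RHS]big_mkcond; apply: eq_bigr => j _ /=.
case: ifP => P; last first.
  rewrite big_seq_cond big1 // => nu /andP[nud /eqP e].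
  by move: nud; rewrite -e mem_parts P.
have nud : incr_nth mu j \in parts (sumn mu).+1 by rewrite mem_parts P sumn_incr eqxx.
rewrite big_mkcond (big_rem (incr_nth mu j)) //= eqxx big_seq big1 ?addr0 // => nu.
by rewrite mem_rem_uniq ?uniq_parts // inE eq_sym => /andP[/negbTE ->].
Qed.

Lemma sum_decr (V : nmodType) d la (F : nat -> seq nat -> V) : is_part la -> sumn la = d.+1 ->
  \sum_(ka <- parts d) \sum_(i < (size ka).+1 | incr_nth ka i == la) F i ka =
  \sum_(i < size la | (nth 0 la i.+1 < nth 0 la i)%N) F i (decr la i).
Proof.
move=> Pla ld.
transitivity (\sum_(ka <- parts d) \sum_(i < size la | incr_nth ka i == la) F i ka).
  apply: eq_big_seq => ka; rewrite mem_parts => /andP[Pk _].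
  set b := maxn (size ka).+1 (size la).
  rewrite (big_ord_widen_cond b (fun i => incr_nth ka i == la) (fun i => F i ka)) ?leq_maxl //.
  rewrite [RHS](big_ord_widen_cond b (fun i => incr_nth ka i == la) (fun i => F i ka)) ?leq_maxr //.
  apply: eq_bigl => i; apply: andb_id2l => /eqP e.
  have ik : (i <= size ka)%N by apply: incr_size; rewrite e.
  rewrite ltnS ik; apply/esym; rewrite -e size_incr_nth.
  by case: ifP => // _; apply: ltnSn.
rewrite (exchange_big_dep xpredT) //= [RHS]big_mkcond; apply: eq_bigr => i _ /=.
case: ifP => lt; last first.
  rewrite big_seq_cond big1 // => ka /andP[]; rewrite mem_parts => /andP[Pk _] /eqP e.
  by case: (decrK Pk Pla e); rewrite lt.
have [Pd E] := decrP Pla lt.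
have dd : decr la i \in parts d.
  by rewrite mem_parts Pd; apply/eqP; have := sumn_decr Pla lt; rewrite ld => -[].
rewrite big_mkcond (big_rem (decr la i)) //= E eqxx big_seq big1 ?addr0 // => ka.
rewrite mem_rem_uniq ?uniq_parts // inE => /andP[ne]; rewrite mem_parts => /andP[Pk _].
by case: eqP => // e; case: (decrK Pk Pla e) => ke; rewrite ke eqxx in ne.
Qed.

(** * The coefficients M(la, mu): recurrences and vanishing *)

Section Core.
Variables (K : fieldType) (D : nat).
Local Notation Lam := {mpoly K[D]}.
Hypothesis K0 : forall n : nat, n.+1%:R != 0 :> K.
Variables q t : K.
Hypothesis t0 : t != 0.
Hypothesis q0 : q != 0.
Hypothesis q1 : forall r : nat, q ^+ r.+1 != 1.
Hypothesis t1 : forall r : nat, t ^+ r.+1 != 1.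
Hypothesis spec : forall n (a b : nat -> nat),
  \sum_(i < n) q ^+ a i * t ^+ i = \sum_(i < n) q ^+ b i * t ^+ i -> forall i, (i < n)%N -> a i = b i.
Hypothesis indep : forall a b c d : nat, q ^+ a * t ^+ b = q ^+ c * t ^+ d -> a = c /\ b = d.
Hypothesis D0 : (0 < D)%N.
Variable N : nat.
Local Notation hom d f := ((f : Lam) \is d.-homog for (@mnmwgt D)).
Local Notation EE := (@EE K D q t).
Local Notation En := (@En K D q t).
Local Notation B := (@Bform K D q t).
Local Notation Pe := (@Pe K D q t).
Local Notation eg := (@eg K q t).
Local Notation pc := (@pc K D q t).
Local Notation p1 := (pw K D 1).
Local Notation psi := (psi q t).
Local Notation Gam := (@Gam K D t N).
Local Notation Phi := (@Phi K D q t N).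
Local Notation Ph := (@Ph K D q t N).
Local Notation aa := (@aa K q t N).
Local Notation tau := (@tau K t N).

(* The coefficient M(la, mu): the left-hand side of the theorem. *)
Definition MM la mu := pc la (Phi * Gam (Pe mu)).

(** Summing [EE_Ph] over the degrees of Phi leaves boundary terms of degree above D, which [pc la]
    does not see. *)
Lemma pc_Phi_EE la g : is_part la -> (sumn la <= D)%N ->
  pc la (EE (Phi * g)) - aa * pc la (En (Phi * g)) = pc la (Phi * EE g) - pc la (Phi * En g).
Proof.
move=> Pla lD; elim/hom_mind: g => [|f g Hf Hg|e g Hg].
- by rewrite !(linear0, mulr0) !pc0 mulr0.
- by rewrite mulrDr !linearD /= !mulrDr !pcD mulrDr opprD addrACA Hf Hg; ring.
rewrite /Phi mulr_suml !linear_sum !pc_sum /=.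
rewrite [in X in X - _]big_ord_recl /= (Ph0 D K0) mul1r.
rewrite [X in _ - aa * X]big_ord_recr /= (@pc_hom0 K D q t (D + e).+1 la (En (Ph D * _))); first last.
- exact: lD.
- by clear -lD; apply/eqP; lia.
- exact: (hom_En K0 q t0 (@homM K D D e _ _ (hom_Ph D K0 q t N D) Hg)).
rewrite addr0 !mulr_suml !pc_sum [in RHS]big_ord_recl /= (Ph0 D K0) mul1r.
rewrite [X in _ = _ - X]big_ord_recr /= (@pc_hom0 K D q t (D + e.+1) la (Ph D * _)); first last.
- exact: lD.
- by clear -lD; apply/eqP; lia.
- exact: (@homM K D D e.+1 _ _ (hom_Ph D K0 q t N D) (hom_En K0 q t0 Hg)).
rewrite addr0 -!addrA; congr (_ + _); rewrite mulr_sumr -!sumrB; apply: eq_bigr => k _.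
by rewrite -pcZ -!pcB /bump /= add1n (EE_Ph K0 t q1 N g (ltn_ord k)).
Qed.

Lemma pc_nil_p1 g : pc [::] (p1 * g) = 0.
Proof. by rewrite /pc /= (@pwE K D (Ordinal D0)) B_adj /= mul0r. Qed.

Lemma pc_p1_row la g : is_part la -> (sumn la <= D)%N ->
  pc la (p1 * g) = \sum_(i < size la | (nth 0 la i.+1 < nth 0 la i)%N)
     psi (decr la i) i * pc (decr la i) g.
Proof.
move=> Pla lD; case E : (sumn la) => [|d].
  have -> : la = [::] by case: la Pla lD E => // x la; rewrite is_part_cons /=; lia.
  by rewrite pc_nil_p1 big_ord0.
rewrite (pc_p1 K0 t0 q0 q1 t1 spec D0 g Pla E); last by rewrite -E.
rewrite -(sum_decr (fun i ka => psi ka i * pc ka g) Pla E); apply: eq_big_seq => ka.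
rewrite mem_parts => /andP[Pk /eqP kd].
rewrite (pieri K0 t0 q0 q1 t1 spec D0 indep Pk) ?kd -?E ?part_parts // mulr_sumr.
by apply: eq_bigr => i _; rewrite mulrC.
Qed.

Lemma q1n0 : q - 1 != 0. Proof. by rewrite subr_eq0 -[q]expr1 q1. Qed.

Lemma pc_En_row la g : is_part la -> (sumn la <= D)%N ->
  pc la (En g) = (1 - t^-1) * \sum_(i < size la | (nth 0 la i.+1 < nth 0 la i)%N)
     q ^+ (nth 0%N la i).-1 * t^-1 ^+ i * (psi (decr la i) i * pc (decr la i) g).
Proof.
move=> Pla lD; apply: (mulfI q1n0); case E : (sumn la) => [|d].
  have -> : la = [::] by case: la Pla lD E => // x la; rewrite is_part_cons /=; lia.
  rewrite big_ord0 !mulr0 -pcZ.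
  have := EE_pw1 q t g D0; rewrite addrC => /eqP; rewrite -subr_eq => /eqP <-.
  by rewrite pcB (pc_EE K0 t0 t1 spec) // !pc_nil_p1 mulr0 subrr.
rewrite (pc_En K0 t0 q0 q1 t1 spec D0 g Pla E); last by rewrite -E.
rewrite mulrA mulr_sumr.
rewrite [RHS](eq_bigr (fun i : 'I_(size la) => (q - 1) * (1 - t^-1) *
   (q ^+ nth 0%N (decr la i) i * t^-1 ^+ i * (psi (decr la i) i * pc (decr la i) g)))); last first.
  by move=> i lt; rewrite (nth_decr i Pla lt) eqxx.
rewrite -(sum_decr (fun i ka => (q - 1) * (1 - t^-1) * (q ^+ nth 0%N ka i * t^-1 ^+ i * (psi ka i * pc ka g))) Pla E).
apply: eq_big_seq => ka; rewrite mem_parts => /andP[Pk /eqP kd].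
rewrite (pieri K0 t0 q0 q1 t1 spec D0 indep Pk) ?kd -?E ?part_parts // !mulr_sumr.
by apply: eq_bigr => i /eqP <-; rewrite eg_incr //; ring.
Qed.

Lemma pieri_vec mu : is_part mu -> (sumn mu < D)%N ->
  p1 * Pe mu = \sum_(j < (size mu).+1 | is_part (incr_nth mu j)) psi mu j *: Pe (incr_nth mu j).
Proof.
move=> Pm mD; have [Hm _ _ _] := Pe_parts K0 t0 spec (ltnW mD) (part_parts Pm).
have Hf : hom (sumn mu).+1 (p1 * Pe mu) by apply: (@homM K D 1) => //; apply: hom_pw.
rewrite (Pe_exp K0 t0 q1 t1 spec mD Hf) -(sum_incr mu (fun j nu => psi mu j *: Pe nu)).
apply: eq_big_seq => nu nud.
by rewrite (pieri K0 t0 q0 q1 t1 spec D0 indep Pm mD nud) scaler_suml.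
Qed.

Lemma En_Pe mu : is_part mu -> (sumn mu < D)%N ->
  En (Pe mu) = (1 - t^-1) *: \sum_(j < (size mu).+1 | is_part (incr_nth mu j))
    (q ^+ nth 0%N mu j * t^-1 ^+ j * psi mu j) *: Pe (incr_nth mu j).
Proof.
move=> Pm mD; apply: (scalerI q1n0).
have := EE_pw1 q t (Pe mu) D0; rewrite addrC => /eqP; rewrite -subr_eq => /eqP <-.
have [_ _ _ ->] := Pe_parts K0 t0 spec (ltnW mD) (part_parts Pm).
rewrite -scalerAr pieri_vec // linear_sum /= !scaler_sumr -sumrB; apply: eq_bigr => j Pj.
have jd : incr_nth mu j \in parts (sumn mu).+1 by rewrite mem_parts Pj sumn_incr eqxx.
have [_ _ _ Ej] := Pe_parts K0 t0 spec mD jd.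
by rewrite linearZ /= Ej !scalerA -scalerBl; congr (_ *: _); rewrite mulrC -mulrBl eg_incr //; ring.
Qed.

Lemma MM_recurrence_p1 la mu : is_part la -> (sumn la <= D)%N -> is_part mu -> (sumn mu < D)%N ->
  t^-1 * (\sum_(i < size la | (nth 0 la i.+1 < nth 0 la i)%N) psi (decr la i) i * MM (decr la i) mu)
   + tau 1 * MM la mu =
  \sum_(j < (size mu).+1 | is_part (incr_nth mu j)) psi mu j * MM la (incr_nth mu j).
Proof.
move=> Pla lD Pm mD; rewrite -(pc_p1_row (Phi * Gam (Pe mu)) Pla lD).
transitivity (pc la (Phi * Gam (p1 * Pe mu))).
  rewrite rmorphM /= (Gam_pw1 t N D0) mulrDl mulrDr -scalerAl -scalerAr mul_mpolyC -scalerAr.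
  by rewrite pcD !pcZ [Phi * (p1 * _)]mulrCA.
rewrite pieri_vec // rmorph_sum mulr_sumr pc_sum; apply: eq_bigr => j _ /=.
by rewrite GamZ -scalerAr pcZ.
Qed.

Lemma pc_comb la (F x y : Lam) a b :
  pc la (F * (a *: (x - b *: y))) = a * (pc la (F * x) - b * pc la (F * y)).
Proof. by rewrite -scalerAr mulrBr -scalerAr pcZ pcB pcZ. Qed.

Lemma pc_ZM la (F x : Lam) a : pc la (F * (a *: x)) = a * pc la (F * x).
Proof. by rewrite -scalerAr pcZ. Qed.

Lemma MM_recurrence_EE la mu : is_part la -> (sumn la <= D)%N -> is_part mu -> (sumn mu < D)%N ->
  eg la * MM la mu - aa * (1 - t^-1) *
  (\sum_(i < size la | (nth 0 la i.+1 < nth 0 la i)%N)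
     q ^+ (nth 0%N la i).-1 * t^-1 ^+ i * (psi (decr la i) i * MM (decr la i) mu)) =
  t ^+ N * eg mu * MM la mu - (t - 1) *
  \sum_(j < (size mu).+1 | is_part (incr_nth mu j))
     q ^+ nth 0%N mu j * t^-1 ^+ j * (psi mu j * MM la (incr_nth mu j)).
Proof.
move=> Pla lD Pm mD; rewrite -mulrA -(pc_En_row (Phi * Gam (Pe mu)) Pla lD).
have [Hm _ _ Em] := Pe_parts K0 t0 spec (ltnW mD) (part_parts Pm).
(* Passing E through Phi leaves Phi (E - En) Gamma P_mu, and -t times [Gam_En] expresses (E - En)
   Gamma through Gamma En and Gamma E. *)
have L : eg la * MM la mu - aa * pc la (En (Phi * Gam (Pe mu))) =
    - t * (pc la (Phi * Gam (En (Pe mu))) - (t ^+ N / t) * pc la (Phi * Gam (EE (Pe mu)))).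
  rewrite /MM -(pc_EE K0 t0 t1 spec) // pc_Phi_EE // -pcB -mulrBr.
  have := Gam_En K0 q t0 N Hm mD => /(congr1 (fun f => - t *: f)).
  rewrite scalerA mulNr mulfV // scaleN1r opprB => <-.
  exact: pc_comb.
have EY : pc la (Phi * Gam (En (Pe mu))) = (1 - t^-1) *
    \sum_(j < (size mu).+1 | is_part (incr_nth mu j))
     q ^+ nth 0%N mu j * t^-1 ^+ j * (psi mu j * MM la (incr_nth mu j)).
  rewrite En_Pe // GamZ -scalerAr pcZ rmorph_sum mulr_sumr pc_sum; congr (_ * _).
  by apply: eq_bigr => j _ /=; rewrite GamZ -scalerAr pcZ mulrA.
have E1 : pc la (Phi * Gam (EE (Pe mu))) = eg mu * MM la mu.
  by rewrite Em; rewrite GamZ; apply: pc_ZM.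
apply: (etrans L); apply: (etrans (congr2 (fun x y => - t * (x - t ^+ N / t * y)) EY E1)).
by field.
Qed.

Lemma MM_nil : MM [::] [::] = 1.
Proof.
rewrite /MM (Pe_nil D K0 t0 q1 t1 spec) rmorph1 mulr1 /Phi pc_sum big_ord_recl /= (Ph0 D K0) big1 => [|k _].
  have := Pe_nil D K0 t0 q1 t1 spec => e; rewrite -e (pc_Pe K0 t0 q1 t1 spec (leq0n D)) //.
  by rewrite addr0.
by apply: (pc_hom0 q t (hom_Ph D K0 q t N _)).
Qed.

(** In m variables Gamma is the evaluation in m + N variables at x_1/t, ..., x_m/t, 1, t, ...,
    t^(N-1). *)
Lemma xev_Gam m f : xev m (Gam f) =
  mmap (@mpolyC m K) (fun i : 'I_(m + N) =>
    match split i with inl j => t^-1 *: 'X_j | inr k => (t ^+ k)%:MP end) (xev (m + N) f).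
Proof.
set w := fun _ => _.
move: f; apply: (@rm_ext K D _ (xev m \o Gam) (mmap (@mpolyC m K) w \o xev (m + N))) => [c|i] /=.
  by rewrite GamC /xev !evC mmapC.
have -> : xev m (Gam 'X_i) = (t^-1 ^+ i.+1)%:MP * (\sum_(j < m) 'X_j ^+ i.+1) + (tau i.+1)%:MP.
  by rewrite GamX /xev rmorphD /= evZ evX evC.
have -> : mmap (@mpolyC m K) w (xev (m + N) 'X_i) = \sum_(j < m + N) w j ^+ i.+1.
  rewrite /xev evX rmorph_sum /=; apply: eq_bigr => j _.
  by rewrite rmorphXn /= mmapX mmap1U.
rewrite big_split_ord /=; congr (_ + _).
  rewrite mulr_sumr; apply: eq_bigr => j _.
  rewrite /w (unsplitK (inl j : 'I_m + 'I_N)).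
  by rewrite exprZn mul_mpolyC.
rewrite /tau rmorph_sum; apply: eq_bigr => j _.
rewrite /w (unsplitK (inr j : 'I_m + 'I_N)).
by rewrite -rmorphXn -exprM.
Qed.

Lemma xev_hc m (f : Lam) s : xev m f = 0 -> (size s <= m)%N -> hc f s = 0.
Proof.
move=> f0 sm; pose a : 'X_{1..m} := [multinom nth 0%N s i | i < m].
have Ea : sq a = s ++ nseq (m - size s) 0%N.
  apply: (@eq_from_nth _ 0%N); first by rewrite size_sq size_cat size_nseq subnKC.
  rewrite size_sq => i id; rewrite -[i]/(nat_of_ord (Ordinal id)) nth_sq mnmE nth_cat /=.
  by case: ltnP => // im; rewrite nth_nseq if_same nth_default.
have : (xev m f)@_a = 0 by rewrite f0 mcoeff0.
rewrite mcoeff_xev hc_pos Ea filter_cat filter_nseq /= cats0.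
by rewrite -hc_pos.
Qed.

Lemma xev_Pe0 n mu : is_part mu -> (sumn mu <= D)%N -> (n < size mu)%N -> xev n (Pe mu) = 0.
Proof.
move=> Pm mD nm; apply/mpolyP => a; rewrite mcoeff0 mcoeff_xev hc_pos hc_sort.
have [Hm _ Tm _] := Pe_parts K0 t0 spec mD (part_parts Pm).
set p := sort geq _; have Pp : is_part p by apply: is_part_sort; apply: filter_all.
have sp : (size p <= n)%N by rewrite size_sort size_filter -[X in (_ <= X)%N](size_sq a) count_size.
apply/eqP; apply: contraTT nm => Hp; rewrite -leqNgt (leq_trans _ sp) //.
have Sp : sumn p == sumn mu by apply: contraNT Hp => /(hc_hom0 Hm) ->.
by apply: dom_size => //; apply: Tm Hp; rewrite mem_parts Pp.
Qed.

(** P_mu vanishes in m + N variables, so by [xev_Gam] the product vanishes in m variables and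
    involves only P_ka with more than m rows. The part of degree |la| is isolated because the
    triangularity argument needs homogeneity. *)
Lemma MM_vanish m la mu : is_part la -> (sumn la <= D)%N -> is_part mu -> (sumn mu <= D)%N ->
  (size la <= m)%N -> (m + N < size mu)%N -> MM la mu = 0.
Proof.
move=> Pla lD Pm mD lm nm; rewrite /MM; set f := Phi * _.
have f0 : xev m f = 0 by rewrite /f rmorphM /= xev_Gam xev_Pe0 // rmorph0 mulr0.
clearbody f; set d := sumn la.
have lad : la \in parts d := part_parts Pla.
have -> : pc la f = pc la (toL D d (cf f)).
  rewrite /pc /Bform; congr (_ / _); apply: eq_big_seq => s sd.
  by rewrite cf_toL.
apply: (pc_suppS K0 t0 q1 t1 spec lD (hom_toL D d (cf f)) (S := fun s => m < size s)%N) => //.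
- move=> a b; rewrite !mem_parts => /andP[Pa _] /andP[Pb _] ba ma.
  exact: leq_trans ma (dom_size Pa Pb ba).
- move=> s sd; apply: contraNT; rewrite -leqNgt => sm; apply/eqP.
  rewrite -[RHS](xev_hc f0 sm) !(hc_cf _ lD sd); apply: eq_big_seq => r rd.
  by rewrite cf_toL.
by rewrite -leqNgt.
Qed.
End Core.

(** * The recurrences for the right-hand side *)

Section PartialLagrange.
Variables (K : fieldType) (X : finType) (p r : X -> K).
(** Interpolation weights of prod_y (X - r_y) at the nodes p_x. The nodes may coincide outside [Z],
    which is why the interpolation itself is carried out on [Z] only. *)
Definition lw x := (\prod_y (p x - r y)) / (\prod_(y | y != x) (p x - p y)).

(* Pairs [y, s y] with [r y = p (s y)] cancel; [Z] is what remains. *)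
Variables (Z act : pred X) (s : X -> X).
Hypothesis sZ : forall y, ~~ Z y -> ~~ Z (s y).
Hypothesis ss : forall y, ~~ Z y -> s (s y) = y.
Hypothesis rs : forall y, ~~ Z y -> r y = p (s y).
Hypothesis pZ : {in Z &, injective p}.
Hypothesis p0 : forall x, p x != 0.
Hypothesis actZ : forall x y, Z x -> act x -> ~~ Z y -> p x != p y.
Hypothesis nactZ : forall x, Z x -> ~~ act x -> exists2 y, Z y & r y = p x.

Let ps := [seq p x | x <- enum Z].
Let us := [seq r x | x <- enum Z].
Let Q : {poly K} := \prod_(w <- us) ('X - w%:P).

Lemma uniq_ps : uniq ps.
Proof. by rewrite map_inj_in_uniq ?enum_uniq // => x y; rewrite !mem_enum; apply: pZ. Qed.

Definition lwZ x := (\prod_(y in Z) (p x - r y)) / (\prod_(y in Z | y != x) (p x - p y)).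

Lemma size_us : size us = size ps.
Proof. by rewrite !size_map. Qed.

Lemma lwZE (F : K -> K) :
  \sum_(w <- ps) Q.[w] / (\prod_(v <- ps | v != w) (w - v)) * F w = \sum_(x in Z) lwZ x * F (p x).
Proof.
rewrite big_map big_enum /=; apply: eq_bigr => x xZ; congr (_ / _ * _).
  rewrite /Q horner_prod big_map big_enum /=; apply: eq_bigr => y _.
  by rewrite !hornerE.
rewrite big_map big_enum_cond /=; apply: eq_bigl => y; apply: andb_id2l => yZ.
by congr (~~ _); apply/eqP/eqP => [|->] //; apply: pZ.
Qed.

Lemma Q_root w : w \in ps -> (\prod_(v <- ps) ('X - v%:P)).[w] = 0.
Proof. by move=> wp; apply/rootP; rewrite root_prod_XsubC. Qed.

(** Subtracting prod (X - p_x) changes no value at the nodes and lowers the degree of the numerator,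
    whose top coefficient is then the sum of the p - r. *)
Lemma lwZ_sum : \sum_(x in Z) lwZ x = \sum_(x in Z) (p x - r x).
Proof.
have := lwZE (fun=> 1); rewrite [X in _ = X](eq_bigr lwZ) => [<-|x _]; last by rewrite mulr1.
have [e|ne] := eqVneq (size ps) 0%N.
  have e0 : ps = [::] by apply: size0nil.
  rewrite e0 big_nil -big_enum /=; have : enum Z = [::] by apply: size0nil; rewrite -(size_map p).
  by move=> ->; rewrite big_nil.
pose Q1 := Q - \prod_(v <- ps) ('X - v%:P).
have sQ1 : (size Q1 <= size ps)%N.
  have : (size Q1 <= (size ps).+1)%N.
    by rewrite (leq_trans (size_polyD _ _)) // size_polyN /Q !size_prod_XsubC size_us maxnn.
  rewrite leq_eqVlt => /orP[/eqP sz|//]; have : lead_coef Q1 != 0.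
    by rewrite lead_coef_eq0 -size_poly_eq0 sz.
  rewrite lead_coefE sz /= coefB -[X in Q`_X]size_us.
  have l1 : Q`_(size us) = 1.
    by have /monicP := monic_prod_XsubC us xpredT id; rewrite lead_coefE size_prod_XsubC.
  have l2 : (\prod_(v <- ps) ('X - v%:P))`_(size ps) = 1.
    by have /monicP := monic_prod_XsubC ps xpredT id; rewrite lead_coefE size_prod_XsubC.
  by rewrite l1 l2 subrr eqxx.
have := lagrange_lead uniq_ps sQ1; rewrite coefB -[X in Q`_X.-1]size_us.
rewrite !coefPn_prod_XsubC ?size_us // opprK addrC !big_map !big_enum /= sumrB => <-.
apply: eq_bigr => x xZ; rewrite mulr1; congr (_ / _).
have wp : p x \in ps by rewrite map_f // mem_enum.
by rewrite /Q1 !hornerE Q_root // subr0.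
Qed.

(** Interpolation of the monic numerator with 0 as an additional node; that node contributes prod
    (r_x / p_x). *)
Lemma lwZ_sumV : \sum_(x in Z) lwZ x / p x = 1 - \prod_(x in Z) (r x / p x).
Proof.
rewrite -(lwZE (fun w => w^-1)).
have z0 : 0 \notin ps by apply/mapP => -[x _ /eqP]; rewrite eq_sym (negbTE (p0 x)).
have sQ : (size Q <= (size ps).+1)%N by rewrite /Q size_prod_XsubC size_us.
have := @lagrange_lead _ (0 :: ps) Q; rewrite /= z0 uniq_ps => /(_ isT sQ).
have -> : Q`_(size ps) = 1.
  by have /monicP := monic_prod_XsubC us xpredT id; rewrite lead_coefE size_prod_XsubC size_us.
rewrite big_cons big_cons eqxx /=.
have -> : Q.[0] / \prod_(j <- ps | j != 0) (0 - j) = \prod_(x in Z) (r x / p x).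
  rewrite /Q horner_prod !big_map !big_enum /= big_enum_cond /= prodf_div.
  rewrite [X in _ / X](eq_bigl (mem Z)) => [|x]; last by rewrite /= p0 andbT.
  rewrite [X in X / _](eq_bigr (fun x => -1 * r x)) => [|x _]; last by rewrite !hornerE mulN1r.
  rewrite [X in _ / X](eq_bigr (fun x => -1 * p x)) => [|x _]; last by rewrite sub0r mulN1r.
  rewrite !big_split /= -mulf_div divff ?mul1r //; apply/prodf_neq0 => x _.
  by rewrite oppr_eq0 oner_eq0.
move=> /(canRL (addKr _)); rewrite [RHS in _ = RHS -> _]addrC => <-; apply: eq_big_seq => w wp.
have w0 : w != 0 by apply: contraNneq z0 => <-.
by rewrite big_cons eq_sym w0 subr0 invfM mulrA mulrAC.
Qed.

Lemma lw_Z x : Z x -> act x -> lw x = lwZ x.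
Proof.
move=> xZ ax; rewrite /lw /lwZ (bigID (mem Z)) [X in _ / X](bigID (mem Z)) /=.
rewrite -mulf_div [X in _ * X](_ : _ = 1) ?mulr1.
  by congr (_ / _); apply: eq_bigl => y; rewrite andbC.
rewrite [X in _ / X](eq_bigl (fun y => ~~ Z y)) => [|y]; last first.
  by rewrite andbC; apply: andb_idr => nZ; apply: contraNneq nZ => ->.
rewrite [X in X / _](reindex_onto s s) => [|y ny]; last exact: ss.
rewrite [X in X / _](eq_big (fun y => ~~ Z y) (fun y => p x - p y)).
- rewrite divff //; apply/prodf_neq0 => y ny.
  by rewrite subr_eq0; apply: actZ.
- move=> y; apply/andP/idP => [[nsy /eqP e]|ny]; first by rewrite -e; apply: sZ.
  by split; [exact: sZ | exact/eqP/ss].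
by move=> y /andP[nsy /eqP e]; rewrite rs // e.
Qed.

(** Outside [Z] the weight vanishes, as the zero attached to s x is the node p_x. An inactive x in
    [Z] has a zero of the reduced numerator at its node. For an active x in [Z] the factors outside
    [Z] cancel. *)
Lemma lw_act (F : K -> K) : \sum_(x | act x) lw x * F (p x) = \sum_(x in Z) lwZ x * F (p x).
Proof.
rewrite (bigID Z) /= [X in _ + X]big1 ?addr0 => [|x /andP[_ nZ]]; last first.
  by rewrite /lw (bigD1 (s x)) //= rs ?sZ // ss // subrr !mul0r.
rewrite [RHS](bigID act) /= [X in _ = _ + X]big1 ?addr0 => [|x /andP[xZ nx]]; last first.
  have [y yZ e] := nactZ xZ nx.
  by rewrite /lwZ (bigD1 y) //= e subrr !mul0r.
apply: eq_big => [x|x /andP[ax xZ]]; first by rewrite andbC.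
by rewrite lw_Z.
Qed.

Lemma lw_sum : \sum_(x | act x) lw x = \sum_x (p x - r x).
Proof.
have := lw_act (fun=> 1); rewrite (eq_bigr lw) => [->|x _]; last by rewrite mulr1.
rewrite (eq_bigr lwZ) => [|x _]; last by rewrite mulr1.
rewrite lwZ_sum [RHS](bigID (mem Z)) /= -[LHS]addr0; congr (_ + _); apply: esym.
rewrite sumrB [X in X - _](reindex_onto s s) => [|y ny]; last exact: ss.
rewrite (eq_big (fun y => ~~ Z y) r) ?subrr // => y.
  apply/andP/idP => [[nsy /eqP e]|ny]; first by rewrite -e; apply: sZ.
  by split; [exact: sZ | exact/eqP/ss].
by move=> /andP[nsy /eqP e]; rewrite -[in RHS]e rs ?e // -e; apply: sZ.
Qed.

Lemma lw_sumV : \sum_(x | act x) lw x / p x = 1 - \prod_x (r x / p x).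
Proof.
rewrite (lw_act (fun w => w^-1)) lwZ_sumV [in RHS](bigID (mem Z)) /=.
rewrite [X in _ = 1 - _ * X](_ : _ = 1) ?mulr1 // prodf_div.
rewrite [X in _ / X](reindex_onto s s) => [|y ny]; last exact: ss.
rewrite [X in _ / X](eq_big (fun y => ~~ Z y) r).
- rewrite divff //; apply/prodf_neq0 => y ny.
  by rewrite rs.
- move=> y; apply/andP/idP => [[nsy /eqP e]|ny]; first by rewrite -e; apply: sZ.
  by split; [exact: sZ | exact/eqP/ss].
by move=> y /andP[nsy /eqP e]; rewrite -[in RHS]e rs ?e // -e; apply: sZ.
Qed.
End PartialLagrange.

(** * The explicit products under a change of one box *)

Lemma pairs_split (R : comNzRingType) n (F : 'I_n -> 'I_n -> R) j :
  \prod_a \prod_b F a b = F j j * (\prod_(k | k != j) (F j k * F k j)) *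
    \prod_(a | a != j) \prod_(b | b != j) F a b.
Proof.
rewrite (bigD1 j) //= (bigD1 j) //=.
rewrite [X in _ * X = _](eq_bigr (fun a => F a j * \prod_(b | b != j) F a b)) => [|a _]; last first.
  by rewrite (bigD1 j).
by rewrite !big_split /= !mulrA.
Qed.

(** Only pairs containing j change, and each factor g_k is absorbed by its pair, so a change in row
    j is checked for one k at a time. *)
Lemma pairs_mod (R : comNzRingType) n (F F' : 'I_n -> 'I_n -> R) (g c : 'I_n -> R) j :
  F' j j = F j j -> (forall a b, a != j -> b != j -> F' a b = F a b) ->
  (forall k, k != j -> g k * (F' j k * F' k j) = F j k * F k j * c k) ->
  (\prod_(k | k != j) g k) * (\prod_a \prod_b F' a b) =
  (\prod_a \prod_b F a b) * \prod_(k | k != j) c k.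
Proof.
move=> Ejj Eab Ec; rewrite !(pairs_split _ j) Ejj.
rewrite [X in _ * (_ * X) = _](eq_bigr (fun a => \prod_(b | b != j) F a b)) => [|a aj]; last first.
  by apply: eq_bigr => b bj; apply: Eab.
rewrite mulrA mulrCA -big_split /= (eq_bigr _ Ec) big_split /=; ring.
Qed.

Section Explicit.
Variables (K : fieldType) (q t : K).
Hypothesis t0 : t != 0.
Hypothesis q0 : q != 0.
Hypothesis indep : forall a b c d : nat, q ^+ a * t ^+ b = q ^+ c * t ^+ d -> a = c /\ b = d.
Local Notation psi := (psi q t).
Local Notation gf := (gf q t).

Definition node (s : seq nat) k : K := q ^+ nth 0%N s k * t^-1 ^+ k.

Lemma gf_scale c z w : c != 0 -> gf (z * c) (w * c) = gf z w.
Proof.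
move=> c0; rewrite /gf.
have -> : (z * c - t * (w * c) / q) * (z * c - w * c / t) = (c * c) * ((z - t * w / q) * (z - w / t)) by ring.
have -> : (z * c - w * c / q) * (z * c - w * c) = (c * c) * ((z - w / q) * (z - w)) by ring.
by rewrite -mulf_div divff ?mul1r // mulf_neq0.
Qed.

Lemma psiE s j : (j <= size s)%N -> psi s j = \prod_(k < j) gf (node s j) (node s k).
Proof.
elim: j s => [|j IH] [|l s] //= js; first by rewrite big_ord0.
  by rewrite big_ord0.
rewrite big_ord_recl IH // /node /= expr0 mulr1; congr (_ * _).
apply: eq_bigr => k _; rewrite /bump /= !exprSr !mulrA gf_scale //.
by rewrite invr_neq0.
Qed.

Definition gp (x y : K) d := \prod_(k < d) ((1 - x * q ^+ k) / (1 - y * q ^+ k)).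
Lemma gpS x y d : gp x y d.+1 = gp x y d * ((1 - x * q ^+ d) / (1 - y * q ^+ d)).
Proof. by rewrite /gp big_ord_recr. Qed.

Definition FP (c : K) (s : seq nat) (a b : nat) : K :=
  if (a < b)%N then t ^+ nth 0%N s b * gp (c * t ^+ (b - a)) (c * t ^+ (b - a).-1) (nth 0%N s a - nth 0%N s b)
  else 1.
(* [PP t n mu] is the value of P_mu at 1, t, ..., t^(n-1), and [PP q m la] is
   t^n(la) (q t^(m-1); q, t)_la / c'_la. *)
Definition PP c n s : K := \prod_(a < n) \prod_(b < n) FP c s a b.

Lemma qt_n1 a b : (0 < a + b)%N -> 1 - q ^+ a * t ^+ b != 0.
Proof.
move=> ab; rewrite subr_eq0; apply/negP => /eqP e.
have [] := @indep 0%N 0%N a b; first by rewrite !expr0 mulr1.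
lia.
Qed.

Lemma yy_incr s j k : k != j -> node (incr_nth s j) k = node s k.
Proof. by move=> kj; rewrite /node nth_incr_nth eq_sym (negbTE kj). Qed.

Lemma yy_part s a b : is_part s -> (a <= b)%N ->
  node s a = node s b * (q ^+ (nth 0%N s a - nth 0%N s b) * t ^+ (b - a)).
Proof.
move=> Ps ab; rewrite /node mulrACA -exprD subnKC ?nth_part_le //; congr (_ * _).
have -> : t^-1 ^+ b = t^-1 ^+ a * t^-1 ^+ (b - a) by rewrite -exprD subnKC.
by rewrite -mulrA -exprMn mulVf // expr1n mulr1.
Qed.

Lemma prodgf s j n : (j <= size s)%N -> (j < n)%N ->
  psi s j = \prod_(k < n | (k != j :> nat)) (if (k < j)%N then gf (node s j) (node s k) else 1).
Proof.
move=> js jn; rewrite psiE // (big_ord_widen n (fun k => gf (node s j) (node s k)) (ltnW jn)).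
rewrite [RHS]big_mkcond [LHS]big_mkcond; apply: eq_bigr => k _.
by case: (ltngtP k j).
Qed.

Lemma yy_neq0 s k : node s k != 0.
Proof. by rewrite mulf_neq0 // expf_neq0 // invr_neq0. Qed.

Lemma gfM y z : y != 0 -> gf y (y * z) = (1 - t * z / q) * (1 - z / t) / ((1 - z / q) * (1 - z)).
Proof.
move=> y0; have := gf_scale 1 z y0; rewrite mul1r mulrC => ->.
by rewrite /gf.
Qed.

Lemma div_scale (c a b : K) : c != 0 -> (c * a) / (c * b) = a / b.
Proof. by move=> c0; rewrite -mulf_div divff ?mul1r. Qed.

Lemma ratl_ y r : y != 0 -> (q * y - t * (y * r)) / (q * y - y * r) = (q - t * r) / (q - r).
Proof. by move=> y0; rewrite -(div_scale (q - t * r) (q - r) y0); congr (_ / _); ring. Qed.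
Lemma ratr_ y r : y != 0 -> (q * (y * r) - t * y) / (q * (y * r) - y) = (q * r - t) / (q * r - 1).
Proof. by move=> y0; rewrite -(div_scale (q * r - t) (q * r - 1) y0); congr (_ / _); ring. Qed.

(** The Pieri coefficient has factors for k < j only. Combined with the change of [PP] they become
    one expression for all k other than j, which has the shape of an interpolation weight. *)
Lemma PP_incr n s (j : 'I_n) : is_part s -> is_part (incr_nth s j) -> (j <= size s)%N ->
  psi s j * PP t n (incr_nth s j) =
  PP t n s * \prod_(k < n | k != j) ((t * node s j - node s k) / (node s j - node s k)).
Proof.
move=> Ps Ps' js; rewrite (prodgf js (ltn_ord j)).
apply: (pairs_mod (F' := fun a b : 'I_n => FP t (incr_nth s j) a b) (F := fun a b : 'I_n => FP t s a b)).
- by rewrite /FP ltnn.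
- by move=> a b aj bj; rewrite /FP !nth_incr_nth ![j == _ :> nat]eq_sym -!val_eqE /= in aj bj *; rewrite (negbTE aj) (negbTE bj).
move=> k; rewrite -val_eqE /= => kj; rewrite /FP.
have yj0 := yy_neq0 s j; have yk0 := yy_neq0 s k.
case: (ltngtP k j) kj => // [kj|jk] _.
  rewrite !nth_incr_nth eqxx (gtn_eqF kj) /= add0n add1n.
  have := nth_part_le Ps' (ltnW kj); rewrite !nth_incr_nth eqxx (gtn_eqF kj) /= add0n add1n => le.
  rewrite (yy_part Ps (ltnW kj)).
  have -> : (nth 0 s k - nth 0 s j = (nth 0 s k - (nth 0 s j).+1).+1)%N by clear -le; lia.
  set d := (nth 0 s k - (nth 0 s j).+1)%N.
  have -> : (j - k = (j - k).-1.+1)%N by clear -kj; lia.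
  rewrite gpS gfM // -[t * node s j]mulrC -mulrBr -{2}[node s j]mulr1 -mulrBr div_scale //.
  set e := (j - k).-1; rewrite /= !exprS; set P := gp _ _ _; set v := t ^+ nth 0%N s j.
  have n1 := @qt_n1 d e.+1; have n2 := @qt_n1 d.+1 e.+1 isT.
  have {}n1 : 1 - q ^+ d * t ^+ e.+1 != 0 by apply: n1; clear; lia.
  rewrite !exprS in n1 n2; move: n1 n2 t0 q0; clear.
  set x := q ^+ d; set u := t ^+ e => n1 n2 t0 q0.
  by field; rewrite n2 [t * u * x]mulrC n1 t0 q0.
rewrite !nth_incr_nth eqxx (ltn_eqF jk) /= add0n add1n.
have le := nth_part_le Ps (ltnW jk).
rewrite (yy_part Ps (ltnW jk)) subSn //.
set d := (nth 0 s j - nth 0 s k)%N.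
have -> : (k - j = (k - j).-1.+1)%N by clear -jk; lia.
rewrite gpS [t * (_ * _)]mulrCA -{2 4}[node s k]mulr1 -!mulrBr div_scale //.
set e := (k - j).-1; rewrite /= !exprS; set P := gp _ _ _; set v := t ^+ nth 0%N s k.
have n1 : 1 - q ^+ d * t ^+ e.+1 != 0 by apply: qt_n1; clear; lia.
rewrite !exprS in n1; move: n1 t0 q0; clear.
set x := q ^+ d; set u := t ^+ e => n1 t0 q0.
by field; rewrite -opprB oppr_eq0 n1 [t * u * x]mulrC n1.
Qed.

Lemma PP_decr n s (j : 'I_n) : is_part s -> is_part (incr_nth s j) -> (j <= size s)%N ->
  psi s j * PP q n s =
  PP q n (incr_nth s j) * \prod_(k < n | k != j) (t^-1 * ((q * node s j - t * node s k) / (q * node s j - node s k))).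
Proof.
move=> Ps Ps' js; rewrite (prodgf js (ltn_ord j)).
apply: (pairs_mod (F := fun a b : 'I_n => FP q (incr_nth s j) a b) (F' := fun a b : 'I_n => FP q s a b)).
- by rewrite /FP ltnn.
- by move=> a b aj bj; rewrite /FP !nth_incr_nth ![j == _ :> nat]eq_sym -!val_eqE /= in aj bj *; rewrite (negbTE aj) (negbTE bj).
move=> k; rewrite -val_eqE /= => kj; rewrite /FP.
have yj0 := yy_neq0 s j; have yk0 := yy_neq0 s k.
case: (ltngtP k j) kj => // [kj|jk] _.
  rewrite !nth_incr_nth eqxx (gtn_eqF kj) /= add0n add1n.
  have := nth_part_le Ps' (ltnW kj); rewrite !nth_incr_nth eqxx (gtn_eqF kj) /= add0n add1n => le.
  rewrite (yy_part Ps (ltnW kj)).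
  have -> : (nth 0 s k - nth 0 s j = (nth 0 s k - (nth 0 s j).+1).+1)%N by clear -le; lia.
  set d := (nth 0 s k - (nth 0 s j).+1)%N.
  have -> : (j - k = (j - k).-1.+1)%N by clear -kj; lia.
  rewrite gpS gfM // ratl_ //.
  set e := (j - k).-1; rewrite /= !exprS; set P := gp _ _ _; set v := t ^+ nth 0%N s j.
  have n1 : 1 - q ^+ d * t ^+ e.+1 != 0 by apply: qt_n1; clear; lia.
  have n2 := @qt_n1 d.+1 e.+1 isT; have n3 := @qt_n1 d.+1 e isT.
  rewrite !exprS in n1 n2 n3; move: n1 n2 n3 t0 q0; clear.
  set x := q ^+ d; set u := t ^+ e => n1 n2 n3 t0 q0.
  have n4 : q - q * x * (t * u) != 0 by rewrite -mulrA -{1}[q]mulr1 -mulrBr mulf_neq0.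
  by field; rewrite n4 t0 [q * u * x]mulrAC n3 q0 n2 n1.
rewrite !nth_incr_nth eqxx (ltn_eqF jk) /= add0n add1n.
have le := nth_part_le Ps (ltnW jk).
rewrite (yy_part Ps (ltnW jk)) subSn //.
set d := (nth 0 s j - nth 0 s k)%N.
have -> : (k - j = (k - j).-1.+1)%N by clear -jk; lia.
rewrite gpS ratr_ //.
set e := (k - j).-1; rewrite /= !exprS; set P := gp _ _ _; set v := t ^+ nth 0%N s k.
have n2 := @qt_n1 d.+1 e.+1 isT; have n3 := @qt_n1 d.+1 e isT.
rewrite !exprS in n2 n3; move: n2 n3 t0 q0; clear.
set x := q ^+ d; set u := t ^+ e => n2 n3 t0 q0.
by field; rewrite -opprB oppr_eq0 mulrA n2 t0 [q * u * x]mulrAC n3.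
Qed.

(** By independence of q and t this is the only way in which a point of mu can meet a point of la;
    all degenerate cases below come from it and its shifted form [vu_eq]. *)
Lemma vz_eq N la mu i j : t ^+ N * node mu j = node la i -> nth 0%N mu j = nth 0%N la i /\ j = (i + N)%N.
Proof.
rewrite /node => /(congr1 (fun z => z * (t ^+ i * t ^+ j))) E.
have [] := @indep (nth 0%N mu j) (i + N)%N (nth 0%N la i) j; last by [].
have ti a : t^-1 ^+ a * t ^+ a = 1 by rewrite -exprMn mulVf // expr1n.
move: E; rewrite [RHS](_ : _ = q ^+ nth 0%N la i * t ^+ j * (t^-1 ^+ i * t ^+ i)); last by ring.
rewrite ti mulr1 => <-.
rewrite [RHS](_ : _ = q ^+ nth 0%N mu j * t ^+ (i + N) * (t^-1 ^+ j * t ^+ j)); last by rewrite exprD; ring.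
by rewrite ti mulr1.
Qed.

Lemma vu_eq N la mu i j : t ^+ N * node mu j = node la i / t ->
  nth 0%N mu j = nth 0%N la i /\ j = (i.+1 + N)%N.
Proof.
move=> E; have [] := @vz_eq N (0%N :: la) mu i.+1 j; last by [].
by rewrite E /node /= exprSr mulrA.
Qed.

Definition qpz (b : K) (k : int) : K :=
  match k with
  | Posz n => \prod_(i < n) (1 - b * q ^+ i)
  | Negz n => (\prod_(i < n.+1) (1 - b * q ^ (- (n.+1)%:Z) * q ^+ i))^-1
  end.

Lemma qpz_rec b k : 1 - b * q ^ (k - 1) != 0 -> qpz b k = qpz b (k - 1) * (1 - b * q ^ (k - 1)).
Proof.
case: k => [[|n]|n].
- move=> /= nz; rewrite big_ord0 big_ord1 /= expr0 mulr1 mulVf //.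
- have -> : n.+1%:Z - 1 = n%:Z by lia.
  by move=> _; rewrite /= big_ord_recr.
have -> : Negz n - 1 = Negz n.+1 by lia.
move=> nz; rewrite /= [in RHS]big_ord_recl /= expr0 mulr1 invfM mulrAC mulVf ?mul1r //.
congr (_^-1); apply: eq_bigr => i _; rewrite /bump /= -!mulrA; congr (1 - b * _).
rewrite exprD expr1 mulrA; congr (_ * _); rewrite -[q in X in _ = _ * X]expr1z -expfzDr //.
by congr (q ^ _); lia.
Qed.

Definition gz (e k : int) : K := qpz (q * t ^ (e - 1)) k / qpz (q * t ^ e) k.

Lemma gz_step e k : 1 - q ^ k * t ^ (e - 1) != 0 -> 1 - q ^ k * t ^ e != 0 ->
  gz e (k - 1) = gz e k * ((1 - q ^ k * t ^ e) / (1 - q ^ k * t ^ (e - 1))).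
Proof.
have E x : q * x * q ^ (k - 1) = q ^ k * x.
  by rewrite mulrAC -{1}[q]expr1z -expfzDr // addrC subrK.
move=> n1 n2; rewrite /gz (@qpz_rec (q * t ^ (e - 1)) k) ?E // (@qpz_rec (q * t ^ e) k) ?E //.
move: n1 n2; set A := 1 - _; set B := 1 - _; set x := qpz _ _; set y := qpz _ _ => A0 B0.
rewrite -mulf_div -mulrA [A / B * _]mulrA divfK // divff ?mulr1 //.
Qed.
End Explicit.

Lemma addable s j : is_part s -> (j == 0%N) || (nth 0 s j < nth 0 s j.-1)%N -> is_part (incr_nth s j).
Proof.
elim: j s => [|j IH] [|x s] //.
- by rewrite !is_part_cons /= => /and3P[_ sx ->]; rewrite andbT; lia.
- by rewrite /= !nth_nil.
rewrite is_part_cons /= => /and3P[x0 sx Ps] H; rewrite is_part_cons x0 /=.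
case: j IH H => [|j] IH H.
  by rewrite nth_incr_nth eqxx IH //= andbT.
by rewrite nth_incr_nth IH //= andbT.
Qed.

(** * Interpolation points attached to a pair of partitions *)

Section Rational.
Variables (K : fieldType) (q t : K).
Hypothesis t0 : t != 0.
Hypothesis q0 : q != 0.
Hypothesis t1 : forall r : nat, t ^+ r.+1 != 1.
Hypothesis indep : forall a b c d : nat, q ^+ a * t ^+ b = q ^+ c * t ^+ d -> a = c /\ b = d.
Variables m N : nat.
Local Notation psi := (psi q t).
Local Notation node := (@node K q t).
Local Notation gz := (@gz K q t).
Local Notation eg := (@eg K q t).
Local Notation n := (m + N)%N.
Local Notation T := (t ^+ N).

Definition Gf la mu : K := \prod_(i < m) \prod_(j < n)
  gz (j%:Z - i%:Z - N%:Z) ((nth 0%N la i)%:Z - (nth 0%N mu j)%:Z).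
(* When [VV] fails the double product [Gf] has a factor with a zero denominator
   (1 / 0 = 0 in the factor with j = i + N), so it is 0, and the recurrences are consistent with this. *)
Definition VV la mu : bool := [forall i : 'I_m, (nth 0 mu (i + N) <= nth 0 la i)%N].
(* The right-hand side of the theorem, with N = n - m. *)
Definition Rf la mu : K :=
  if VV la mu then t^-1 ^+ (m * sumn mu) * PP q t t n mu * PP q t q m la * Gf la mu else 0.

Lemma expz_sub (x : K) a b : x != 0 -> x ^ (a%:Z - b%:Z) = x ^+ a / x ^+ b.
Proof. by move=> x0; rewrite expfzDr // -exprnN. Qed.

Lemma qzE la mu i j :
  q ^ ((nth 0%N la i)%:Z - (nth 0%N mu j)%:Z) * t ^ (j%:Z - i%:Z - N%:Z) = node la i / (T * node mu j).
Proof.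
rewrite /node -addrA -opprD -PoszD !expz_sub // exprD !exprVn.
by field; rewrite !expf_neq0.
Qed.

Lemma step_factor la mu i j : T * node mu j != node la i -> T * node mu j != node la i / t ->
  gz (j%:Z - i%:Z - N%:Z) ((nth 0%N la i)%:Z - (nth 0%N mu j)%:Z - 1) =
  gz (j%:Z - i%:Z - N%:Z) ((nth 0%N la i)%:Z - (nth 0%N mu j)%:Z) *
   ((T * node mu j - node la i) / (T * node mu j - node la i / t)).
Proof.
move=> n1 n2; have v0 : T * node mu j != 0 by rewrite mulf_neq0 ?expf_neq0 ?yy_neq0.
have E2 : q ^ ((nth 0%N la i)%:Z - (nth 0%N mu j)%:Z) * t ^ (j%:Z - i%:Z - N%:Z - 1) = node la i / t / (T * node mu j).
  by rewrite [X in _ * X]expfzDr // mulrA qzE exprN1 mulrAC.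
have nz x : T * node mu j != x -> 1 - x / (T * node mu j) != 0.
  move=> nx; rewrite subr_eq0; apply: contraNneq nx => e.
  by apply/eqP; rewrite -[LHS]mul1r e divfK.
rewrite gz_step // ?E2 ?qzE ?nz //; congr (_ * _).
rewrite -(div_scale (1 - _) (1 - _) v0) !mulrBr !mulr1.
by rewrite ![T * node mu j * (_ / _)]mulrC !divfK.
Qed.

Lemma Gf_incr la mu (j : 'I_n) : is_part la -> is_part mu -> is_part (incr_nth mu j) ->
  VV la (incr_nth mu j) ->
  Gf la (incr_nth mu j) = Gf la mu *
    \prod_(i < m) ((T * node mu j - node la i) / (T * node mu j - node la i / t)).
Proof.
move=> Pla Pm Pj /forallP V; rewrite /Gf -big_split; apply: eq_bigr => i _ /=.
rewrite (bigD1 j) //= [in RHS](bigD1 j) //= mulrAC; congr (_ * _); last first.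
  apply: eq_bigr => k kj; rewrite nth_incr_nth.
  by have /negbTE -> : (j != k :> nat) by rewrite eq_sym.
have -> : (nth 0%N la i)%:Z - (nth 0%N (incr_nth mu j) j)%:Z = (nth 0%N la i)%:Z - (nth 0%N mu j)%:Z - 1.
  by rewrite nth_incr_nth eqxx; clear; lia.
apply: step_factor.
  (* A coincidence at j = i + N would make row j of the enlarged mu exceed la_i. *)
  apply/eqP => /(vz_eq t0 indep) [e1 e2]; have := V i; rewrite nth_incr_nth -e2 eqxx; lia.
(* Here j = i + 1 + N and mu_j = la_i; as the enlarged mu is a partition, its row i + N would exceed
   la_i. *)
apply/eqP => /(vu_eq t0 indep) [e1 e2]; have := V i; rewrite nth_incr_nth.
have -> : (j == (i + N)%N :> nat) = false by apply/eqP; lia.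
have := @nth_part_le _ (i + N)%N j Pj; rewrite !nth_incr_nth eqxx.
have -> : (j == (i + N)%N :> nat) = false by apply/eqP; lia.
move=> /(_ _) H; have := H; have -> : (i + N <= j)%N by lia.
move=> /(_ isT); lia.
Qed.

Lemma Gf_decr ka mu (i : 'I_m) : is_part ka -> is_part mu -> is_part (incr_nth ka i) ->
  VV ka mu ->
  Gf ka mu = Gf (incr_nth ka i) mu *
    \prod_(j < n) ((T * node mu j - node (incr_nth ka i) i) / (T * node mu j - node (incr_nth ka i) i / t)).
Proof.
move=> Pk Pm Pi /forallP V; rewrite /Gf (bigD1 i) //= [in RHS](bigD1 i) //= mulrAC; congr (_ * _); last first.
  apply: eq_bigr => k ki; apply: eq_bigr => j _; rewrite nth_incr_nth.
  by have /negbTE -> : (i != k :> nat) by rewrite eq_sym.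
rewrite -big_split; apply: eq_bigr => j _ /=.
have e : nth 0%N (incr_nth ka i) i = (nth 0%N ka i).+1 by rewrite nth_incr_nth eqxx.
have -> : (nth 0%N ka i)%:Z - (nth 0%N mu j)%:Z = (nth 0%N (incr_nth ka i) i)%:Z - (nth 0%N mu j)%:Z - 1.
  by rewrite e; clear; lia.
apply: step_factor.
  by apply/eqP => /(vz_eq t0 indep) [e1 e2]; have := V i; rewrite e in e1; rewrite -e2; lia.
apply/eqP => /(vu_eq t0 indep) [e1 e2]; have := V i; rewrite e in e1.
have := @nth_part_le _ (i + N)%N j Pm; have -> : (i + N <= j)%N by lia.
move=> /(_ isT); lia.
Qed.

Lemma VV_incr la mu j : VV la (incr_nth mu j) -> VV la mu.
Proof.
move=> /forallP V; apply/forallP => i; apply: leq_trans (V i).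
by rewrite nth_incr_nth leq_addl.
Qed.

Lemma VV_decr ka mu i : VV ka mu -> VV (incr_nth ka i) mu.
Proof.
move=> /forallP V; apply/forallP => k; apply: leq_trans (V k) _.
by rewrite nth_incr_nth leq_addl.
Qed.

Section Sums.
Variables la mu : seq nat.
Hypotheses (Pla : is_part la) (Pm : is_part mu) (sla : (size la <= m)%N) (V : VV la mu).

Let X : finType := ('I_n + 'I_m)%type.
(** Left summands are the rows of mu and right summands the rows of la. With the zeros [rX] the
    weights at addable rows of mu and removable rows of la become, up to constants, ratios of
    neighbouring values of [Rf]. *)
Definition pX (x : X) : K := match x with inl j => T * node mu j | inr i => node la i / t end.
Definition rX (x : X) : K := match x with inl j => T * node mu j / t | inr i => node la i end.
Definition actX (x : X) : bool :=
  match x with inl j => is_part (incr_nth mu j) | inr i => (nth 0 la i.+1 < nth 0 la i)%N end.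

Lemma shiftP (i : 'I_m) : (i + N < n)%N. Proof. by rewrite ltn_add2r. Qed.
(** Row i of la is paired with row i + N of mu: when the two are equal, the zero of each is the node
    of the other. *)
Definition sX (x : X) : X :=
  match x with
  | inl j => if [pick i : 'I_m | (i + N)%N == j] is Some i then inr i else inl j
  | inr i => inl (Ordinal (shiftP i))
  end.
Definition ZX (x : X) : bool :=
  match x with
  | inl j => if [pick i : 'I_m | (i + N)%N == j] is Some i then nth 0%N la i != nth 0%N mu j else true
  | inr i => nth 0%N la i != nth 0%N mu (i + N)
  end.

Lemma pick_shift (i : 'I_m) : [pick k : 'I_m | (k + N)%N == (i + N)%N] = Some i.
Proof.
case: pickP => [k /eqP e|/(_ i)]; last by rewrite eqxx.
by congr Some; apply: val_inj; apply: (@addIn N).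
Qed.

Lemma ZXl j : ~~ ZX (inl j) -> exists2 i : 'I_m, nat_of_ord j = (i + N)%N & nth 0%N la i = nth 0%N mu j.
Proof.
by rewrite /=; case: pickP => // i /eqP e; rewrite negbK => /eqP e'; exists i.
Qed.

Lemma inl_shift (j : 'I_n) (i : 'I_m) : nat_of_ord j = (i + N)%N -> j = Ordinal (shiftP i).
Proof. by move=> e; apply: val_inj. Qed.

Lemma yy_inj s a b : node s a = node s b -> a = b.
Proof.
move=> e; have [] := @vz_eq K q t t0 indep 0 s s b a; first by rewrite expr0 mul1r.
by rewrite addn0.
Qed.

Lemma T0 : T != 0. Proof. exact: expf_neq0. Qed.

(** Sandwich: mu_(i+N) <= la_i = mu_(i+1+N) <= mu_(i+N). *)
Lemma ZX_V i : (nth 0 mu (i.+1 + N) = nth 0 la i)%N -> (i < m)%N -> nth 0%N la i = nth 0%N mu (i + N).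
Proof.
move=> e im; have := forallP V (Ordinal im) => /= H.
by apply/eqP; rewrite eqn_leq H andbT -e nth_part_le // leq_add2r.
Qed.

Lemma lwX_hyps :
  [/\ forall y, ~~ ZX y -> ~~ ZX (sX y), forall y, ~~ ZX y -> sX (sX y) = y &
      forall y, ~~ ZX y -> rX y = pX (sX y)].
Proof.
have L j : ~~ ZX (inl j) -> exists2 i : 'I_m, nth 0%N la i = nth 0%N mu j & j = Ordinal (shiftP i).
  by move=> /ZXl[i /inl_shift e1 e2]; exists i.
have E (s : seq nat) (u : seq nat) i : nth 0%N u i = nth 0%N s (i + N) -> T * node s (i + N) = node u i.
  move=> e; rewrite /node e mulrCA; congr (_ * _).
  by rewrite addnC exprD mulrA -exprMn mulfV // expr1n mul1r.
split=> -[j|i].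
- by move=> /L[i e ej]; move: e; rewrite ej /= pick_shift /= => e; rewrite negbK e.
- by rewrite /= negbK => /eqP e; rewrite pick_shift e eqxx.
- by move=> /L[i e ->] /=; rewrite pick_shift.
- by move=> _ /=; rewrite pick_shift.
- move=> /L[i e ej]; move: e; rewrite ej /= pick_shift /= => e.
  by rewrite (E _ _ _ e).
by rewrite /= negbK => /eqP e; rewrite (E _ _ _ e).
Qed.

Lemma pX_neq0 x : pX x != 0.
Proof. by case: x => [j|i] /=; rewrite mulf_neq0 ?T0 ?yy_neq0 ?invr_neq0. Qed.

Lemma pX_inj : {in ZX &, injective pX}.
Proof.
have X1 j (i : 'I_m) : ZX (inr i) -> T * node mu j != node la i / t.
  move=> /= Zi; apply: contraNneq Zi => /(vu_eq t0 indep) [e1 e2].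
  by apply/eqP; apply: ZX_V => //; rewrite -e2.
move=> [j|i] [j'|i'] Zx Zy /= e.
- by congr inl; apply: val_inj; apply: (@yy_inj mu); apply: (mulfI T0).
- by have := X1 j i' Zy; rewrite e eqxx.
- by have := X1 j' i Zx; rewrite e eqxx.
by congr inr; apply: val_inj; apply: (@yy_inj la); apply: (mulIf _ e); rewrite invr_neq0.
Qed.

Lemma pX_act x y : ZX x -> actX x -> ~~ ZX y -> pX x != pX y.
Proof.
case: x y => [j|i] [j'|i'] Zx ax nZ; apply: contraNneq nZ => e.
- suff -> : j' = j by []; apply: val_inj; apply: (@yy_inj mu); apply: (mulfI T0).
  exact: esym.
- have [e1 e2] := vu_eq t0 indep e; rewrite /=; have im := ltn_ord i'.
  have := @nth_part_le _ (i' + N)%N j ax; rewrite !nth_incr_nth eqxx.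
  have -> : (nat_of_ord j == (i' + N)%N) = false by apply/eqP; lia.
  have := @ZX_V i'; rewrite -e2 => /(_ e1 im) e3.
  have -> : (i' + N <= j)%N by lia.
  move=> /(_ isT); lia.
- have [e1 e2] := vu_eq t0 indep (esym e); rewrite /=.
  case: pickP => // k /eqP ek; have ke : nat_of_ord k = i.+1 by lia.
  rewrite ke; move: ax => /= ax; apply/negP => /eqP E; lia.
- suff -> : i' = i by []; apply: val_inj; apply: (@yy_inj la).
  by apply: (mulIf _ (esym e)); rewrite invr_neq0.
Qed.

Lemma yy_succ s a : nth 0%N s a.+1 = nth 0%N s a -> node s a.+1 = node s a / t.
Proof. by move=> e; rewrite /node e exprSr mulrA. Qed.

(** A row where no box can be added or removed equals a neighbouring row: the previous one in mu,
    the next one in la. The zero attached to that neighbour is the node of the row. *)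
Lemma rX_act x : ZX x -> ~~ actX x -> exists2 y, ZX y & rX y = pX x.
Proof.
case: x => [[j jn]|i] Zx nax.
  case: j jn Zx nax => [|j] jn Zx nax.
    by move: nax; rewrite /= addable.
  have e : nth 0%N mu j.+1 = nth 0%N mu j.
    apply/eqP; rewrite eqn_leq nth_part_le //= leqNgt; apply: contraNN nax => lt.
    by apply: addable.
  exists (inl (Ordinal (ltnW jn))); last by rewrite /= yy_succ // mulrA.
  apply: contraT => /ZXl[i /= ej el].
  have im : (i.+1 < m)%N by lia.
  have := forallP V (Ordinal im) => /= H.
  have := @nth_part_le _ i i.+1 Pla; have -> : (i <= i.+1)%N by []; move=> /(_ isT) H2.
  move: Zx => /=; case: pickP => [k /eqP ek|/(_ (Ordinal im))]; last by rewrite /= ej eqxx.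
  have -> : nat_of_ord k = i.+1 by lia.
  have ee : (i.+1 + N = j.+1)%N by lia.
  rewrite ee in H; rewrite e; apply: contraNeq => _; apply/eqP; lia.
have e : nth 0%N la i.+1 = nth 0%N la i.
  apply/eqP; rewrite eqn_leq nth_part_le //= leqNgt; exact: nax.
have Vi := forallP V i.
have [im|mi] := ltnP i.+1 m; last first.
  (* In row m - 1 a row that is not removable is empty, so [VV] makes mu_(i+N) zero too and the pair
     would have cancelled. *)
  have z : nth 0%N la i = 0%N by rewrite -e nth_default // (leq_trans sla).
  move/negP: Zx; case; rewrite z eq_sym -leqn0.
  by move: Vi; rewrite z.
exists (inr (Ordinal im)); last by rewrite /= yy_succ.
apply/negP => /eqP /= e2; move/negP: Zx; apply; apply/eqP; apply: ZX_V => //.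
by rewrite -e2.
Qed.

Lemma sum_act : \sum_(x | actX x) lw pX rX x = \sum_x (pX x - rX x).
Proof. by have [h1 h2 h3] := lwX_hyps; apply: (lw_sum h1 h2 h3 pX_inj pX_act rX_act). Qed.

Lemma sum_actV : \sum_(x | actX x) lw pX rX x / pX x = 1 - \prod_x (rX x / pX x).
Proof. by have [h1 h2 h3] := lwX_hyps; apply: (lw_sumV h1 h2 h3 pX_inj pX_neq0 pX_act rX_act). Qed.

Lemma tn1 : t - 1 != 0. Proof. by rewrite subr_eq0 -[t]expr1 t1. Qed.

Lemma prod_constl (I : finType) (P : pred I) (F : I -> K) c :
  \prod_(i | P i) (c * F i) = c ^+ #|P| * \prod_(i | P i) F i.
Proof. by rewrite big_split /= prodr_const. Qed.

Lemma regroup (x v a b c d : K) : v != 0 -> x * (v * a) * b / (c * d) / v = x * (a / c) * (b / d).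
Proof.
move=> v0; rewrite invfM.
rewrite (_ : _ / v = x * a * b * (c^-1 * d^-1) * (v / v)); last by ring.
by rewrite divff //; ring.
Qed.

(** Dividing by the node separates the weight into the factor of [PP_incr] and that of [Gf_incr],
    with a power of t. *)
Lemma lw_inl (j : 'I_n) : lw pX rX (inl j) / (T * node mu j) =
  (1 - t^-1) * (t^-1 ^+ n.-1 * \prod_(k < n | k != j) ((t * node mu j - node mu k) / (node mu j - node mu k))) *
  \prod_(i < m) ((T * node mu j - node la i) / (T * node mu j - node la i / t)).
Proof.
have v0 : T * node mu j != 0 by rewrite mulf_neq0 ?T0 ?yy_neq0.
have -> : n.-1 = #|[pred k | k != j]|.
  by have := cardC1 j; rewrite card_ord => <-; apply: eq_card.
rewrite -prod_constl /lw !big_sumType /= (bigD1 j) //= -mulf_div.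
rewrite [X in X * _ / _](_ : _ = (1 - t^-1) * (T * node mu j * \prod_(k | k != j) (T * node mu j - T * node mu k / t))); last by ring.
rewrite mulf_div regroup // -!prodf_div; congr (_ * _ * _).
apply: eq_bigr => k kj; have d0 : node mu j - node mu k != 0.
  by rewrite subr_eq0; apply: contraNneq kj => /yy_inj e; apply/eqP; apply: val_inj.
by rewrite -mulrBr; field; rewrite d0 t0 T0.
Qed.

Lemma lw_inr (i : 'I_m) : lw pX rX (inr i) / (node la i / t) =
  (1 - t) * (\prod_(k < m | k != i) ((node la i - t * node la k) / (node la i - node la k))) *
  (t^-1 ^+ n * \prod_(j < n) ((T * node mu j - node la i) / (T * node mu j - node la i / t))).
Proof.
have v0 : node la i / t != 0 by rewrite mulf_neq0 ?invr_neq0 ?yy_neq0.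
have := prod_constl (I := 'I_n) predT (fun j => (T * node mu j - node la i) / (T * node mu j - node la i / t)) t^-1.
rewrite cardT size_enum_ord => <-.
rewrite /lw !big_sumType /= [X in _ * X / _ / _](bigD1 i) //=.
rewrite [X in X / _ / _](_ : _ = (1 - t) * (node la i / t * \prod_(k | k != i) (node la i / t - node la k)) *
   \prod_(j < n) (node la i / t - T * node mu j / t)); last by rewrite mulrC; congr (_ * _); field.
rewrite [X in _ / X / (node la i / t)]mulrC regroup // -!prodf_div; congr (_ * _ * _).
  apply: eq_bigr => k ki; have d0 : node la i - node la k != 0.
    by rewrite subr_eq0; apply: contraNneq ki => /yy_inj e; apply/eqP; apply: val_inj.
  by rewrite -mulrBl; field; rewrite d0 t0.
apply: eq_bigr => j _; rewrite -opprB.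
rewrite -[node la i / t - T * node mu j]opprB invrN mulrNN.
by rewrite -mulrBl -mulrA mulrC -!mulrA; congr (_ * _); rewrite mulrC.
Qed.

Lemma Rf_incr (j : 'I_n) : (size mu <= n)%N -> is_part (incr_nth mu j) ->
  psi mu j * Rf la (incr_nth mu j) = Rf la mu * (T / (t - 1) * (lw pX rX (inl j) / (T * node mu j))).
Proof.
move=> sm Pj; have v0 : T * node mu j != 0 by rewrite mulf_neq0 ?T0 ?yy_neq0.
(* If [VV] fails for the enlarged mu, row i + N of mu equals la_i, and the zero attached to row i of
   la makes the weight vanish as well. *)
rewrite /Rf V; case: ifP => V'; last first.
  suff -> : lw pX rX (inl j) = 0 by rewrite mul0r !mulr0.
  move/negbT: V' => /forallPn[i]; rewrite nth_incr_nth => Hi; have Vi := forallP V i.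
  have ej : nat_of_ord j = (i + N)%N by move: Hi; case: eqP => // _; rewrite add0n Vi.
  rewrite /lw (bigD1 (inr i)) //= (_ : T * node mu j - node la i = 0) ?mul0r //.
  have [_ _ h3] := lwX_hyps; have := h3 (inr i); rewrite /= negbK.
  have e : nth 0%N la i == nth 0%N mu (i + N).
    by rewrite -ej in Hi Vi *; rewrite eqxx in Hi; apply/eqP; lia.
  by move=> /(_ e) ->; rewrite ej subrr.
have js := incr_size Pj.
rewrite sumn_incr mulnS exprD (Gf_incr Pla Pm Pj V') lw_inl.
have := PP_incr t0 q0 indep Pm Pj js.
set c1 := \prod_(k < n | _) _; set g1 := \prod_(i < m) _; set p1 := PP q t t n _; set ps := psi mu j => E.
have -> : t^-1 ^+ m = T / (t - 1) * (1 - t^-1) * t^-1 ^+ n.-1.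
  have n0 : (0 < n)%N by apply: leq_ltn_trans (ltn_ord j).
  rewrite [RHS](_ : _ = T * t^-1 ^+ n.-1.+1); last by rewrite exprS; field; rewrite t0 tn1.
  by rewrite prednK // exprD mulrC -mulrA -exprMn mulVf // expr1n mulr1.
transitivity (ps * p1 * (T / (t - 1) * (1 - t^-1) * t^-1 ^+ n.-1 * t^-1 ^+ (m * sumn mu) * PP q t q m la * (Gf la mu * g1))).
  by ring.
by rewrite E; ring.
Qed.

Lemma Rf_decr (i : 'I_m) : (nth 0 la i.+1 < nth 0 la i)%N ->
  psi (decr la i) i * Rf (decr la i) mu =
  Rf la mu * (t * T / (1 - t) * (lw pX rX (inr i) / (node la i / t))).
Proof.
move=> lt; have [Pk Ek] := decrP Pla lt.
(* If [VV] fails after the removal, la_i equals mu_(i+N), and the zero attached to row i + N of mu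
   is the node of row i of la. *)
rewrite /Rf V; case: ifP => V'; last first.
  suff -> : lw pX rX (inr i) = 0 by rewrite mul0r !mulr0.
  move/negbT: V' => /forallPn[k]; have Vk := forallP V k; have Ed := nth_decr k Pla lt.
  move=> Hk; have ki : nat_of_ord k = i.
    by apply: contraNeq Hk => ne; move: Vk; rewrite Ed eq_sym (negbTE ne).
  rewrite /lw (bigD1 (inl (Ordinal (shiftP i)))) //= (_ : node la i / t - T * node mu (i + N) / t = 0) ?mul0r //.
  have [_ _ h3] := lwX_hyps; have := h3 (inr i); rewrite /= negbK.
  have e : nth 0%N la i == nth 0%N mu (i + N).
    rewrite ki in Ed Vk Hk; rewrite eqxx in Ed; move: Hk Vk; rewrite Ed -ltnNge => h1 h2.
    by apply/eqP; lia.
  by move=> /(_ e) ->; rewrite subrr.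
have Pi : is_part (incr_nth (decr la i) i) by rewrite Ek.
have is_ := incr_size Pi.
rewrite (Gf_decr Pk Pm Pi V') Ek lw_inr.
have := PP_decr t0 q0 indep Pk Pi is_; rewrite Ek.
have yk k : k != i -> node (decr la i) k = node la k.
  by move=> ki; rewrite -[in RHS]Ek yy_incr // val_eqE.
have yi : q * node (decr la i) i = node la i.
  rewrite /node (nth_decr i Pla lt) eqxx exprS; ring.
rewrite yi (eq_bigr (fun k : 'I_m => t^-1 * ((node la i - t * node la k) / (node la i - node la k)))) => [|k ki]; last first.
  by rewrite yk.
have -> := prod_constl (fun k : 'I_m => k != i) (fun k => (node la i - t * node la k) / (node la i - node la k)) t^-1.
have -> : #|[pred k : 'I_m | k != i]| = m.-1.
  by have := cardC1 i; rewrite card_ord => <-; apply: eq_card.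
set c1 := \prod_(k < m | _) _; set g1 := \prod_(j < n) _; set p1 := PP q t q _ _; set ps := psi _ i => E.
have key : t^-1 ^+ m.-1 = t * T * t^-1 ^+ n.
  have m0 : (0 < m)%N by apply: leq_ltn_trans (ltn_ord i).
  rewrite -[in RHS](prednK m0) addSn exprS exprD.
  rewrite [RHS](_ : _ = t^-1 ^+ m.-1 * (t * t^-1) * (T * t^-1 ^+ N)); last by ring.
  by rewrite mulfV // -exprMn mulfV // expr1n !mulr1.
have t1n : 1 - t != 0 by rewrite -opprB oppr_eq0 tn1.
transitivity (ps * p1 * (t^-1 ^+ (m * sumn mu) * PP q t t n mu * (Gf la mu * g1))).
  by ring.
rewrite E key.
rewrite [RHS](_ : _ = t^-1 ^+ (m * sumn mu) * PP q t t n mu * PP q t q m la * Gf la mu * (t * T * (c1 * (t^-1 ^+ n * g1))) * ((1 - t) / (1 - t))); last by ring.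
by rewrite divff // mulr1; ring.
Qed.

End Sums.

Lemma eg_sum k s : (size s <= k)%N -> eg s = t^-1 ^+ k + (1 - t^-1) * \sum_(i < k) node s i.
Proof.
elim: k s => [|k IH] s sk.
  by case: s sk => // _; rewrite big_ord0 mulr0 addr0.
rewrite eg_rec IH; last by rewrite size_behead; lia.
rewrite big_ord_recl /node expr0 mulr1.
rewrite [X in _ = _ + _ * (_ + X)](eq_bigr (fun i : 'I_k => t^-1 * (q ^+ nth 0%N (behead s) i * t^-1 ^+ i))) => [|i _]; last first.
  by rewrite nth_behead exprS; ring.
by rewrite -mulr_sumr exprS; ring.
Qed.

(** The sum of the weights divided by their nodes, [sum_actV], gives the first recurrence. The sum
    of the weights, [sum_act], has the value t^N e_mu - e_la and gives the second. If [VV la mu]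
    fails it fails for all neighbours, and every term is zero. *)
Lemma Rf_recurrences la mu : is_part la -> is_part mu -> (size la <= m)%N -> (size mu <= n)%N ->
  t^-1 * (\sum_(i < m | (nth 0 la i.+1 < nth 0 la i)%N) psi (decr la i) i * Rf (decr la i) mu)
   + tau t N 1 * Rf la mu =
  \sum_(j < n | is_part (incr_nth mu j)) psi mu j * Rf la (incr_nth mu j)
  /\
  eg la * Rf la mu - q * t^-1 ^+ N.+1 * (1 - t^-1) *
  (\sum_(i < m | (nth 0 la i.+1 < nth 0 la i)%N)
     q ^+ (nth 0%N la i).-1 * t^-1 ^+ i * (psi (decr la i) i * Rf (decr la i) mu)) =
  T * eg mu * Rf la mu - (t - 1) *
  \sum_(j < n | is_part (incr_nth mu j))
     q ^+ nth 0%N mu j * t^-1 ^+ j * (psi mu j * Rf la (incr_nth mu j)).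
Proof.
move=> Pla Pm sla sm; have [V|nV] := boolP (VV la mu); last first.
  have Z1 j : Rf la (incr_nth mu j) = 0.
    by rewrite /Rf; case: ifP => // /VV_incr V; rewrite V in nV.
  have Z2 i : (nth 0 la i.+1 < nth 0 la i)%N -> Rf (decr la i) mu = 0.
    move=> lt; rewrite /Rf; case: ifP => // /(VV_decr i).
    by have [_ ->] := decrP Pla lt => V; rewrite V in nV.
  have -> : Rf la mu = 0 by rewrite /Rf (negbTE nV).
  split; rewrite !big1 ?mulr0 ?addr0 ?subr0 // => i Hi; rewrite ?Z1 ?Z2 ?mulr0 //.
have S := sum_act Pla Pm sla V; have SV := sum_actV Pla Pm sla V.
rewrite !big_sumType /= in S SV.
set A := \sum_(i < n | _) _ in S; set B := \sum_(i < m | _) _ in S.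
set AV := \sum_(i < n | _) _ in SV; set BV := \sum_(i < m | _) _ in SV.
have t1n : 1 - t != 0 by rewrite -opprB oppr_eq0 tn1.
have EB1 : \sum_(i < m | (nth 0 la i.+1 < nth 0 la i)%N) psi (decr la i) i * Rf (decr la i) mu =
    Rf la mu * (t * T / (1 - t)) * BV.
  rewrite mulr_sumr; apply: eq_bigr => i lt.
  by rewrite (Rf_decr Pla Pm sla V lt) mulrA.
have EA1 : \sum_(j < n | is_part (incr_nth mu j)) psi mu j * Rf la (incr_nth mu j) =
    Rf la mu * (T / (t - 1)) * AV.
  rewrite mulr_sumr; apply: eq_bigr => j Pj.
  by rewrite (Rf_incr Pla Pm sla V sm Pj) mulrA.
have EB2 : q * \sum_(i < m | (nth 0 la i.+1 < nth 0 la i)%N)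
     q ^+ (nth 0%N la i).-1 * t^-1 ^+ i * (psi (decr la i) i * Rf (decr la i) mu) =
    Rf la mu * (t * T / (1 - t)) * t * B.
  rewrite !mulr_sumr; apply: eq_bigr => i lt.
  rewrite (Rf_decr Pla Pm sla V lt).
  have -> : q * (q ^+ (nth 0%N la i).-1 * t^-1 ^+ i * (Rf la mu * (t * T / (1 - t) * (lw (pX la mu) (rX la mu) (inr i) / (node la i / t)))))
    = (q * q ^+ (nth 0%N la i).-1 * t^-1 ^+ i) * (Rf la mu * (t * T / (1 - t) * (lw (pX la mu) (rX la mu) (inr i) / (node la i / t)))) by ring.
  rewrite -exprS prednK; last by lia.
  rewrite -/(node la i); have y0 := yy_neq0 t0 q0 la i.
  by field; rewrite t0 t1n y0.
have EA2 : T * \sum_(j < n | is_part (incr_nth mu j))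
     q ^+ nth 0%N mu j * t^-1 ^+ j * (psi mu j * Rf la (incr_nth mu j)) =
    Rf la mu * (T / (t - 1)) * A.
  rewrite !mulr_sumr; apply: eq_bigr => j Pj.
  rewrite (Rf_incr Pla Pm sla V sm Pj) -/(node mu j); have y0 := yy_neq0 t0 q0 mu j.
  have T0' := T0; have tn1' := tn1.
  by field; rewrite tn1' T0' y0.
have T0' := T0; have tn1' := tn1.
have TN : T * t^-1 ^+ N = 1 by rewrite -exprMn mulfV // expr1n.
have tau1 : (1 - t) * tau t N 1 = 1 - T by have := tauE t N 1; rewrite !expr1.
have EP : AV + BV = 1 - t^-1 ^+ N.
  rewrite SV; congr (1 - _).
  rewrite (eq_bigr (fun=> t^-1)) => [|j _]; last first.
    by rewrite mulrAC divff ?mul1r // mulf_neq0 ?yy_neq0.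
  rewrite [X in _ * X](eq_bigr (fun=> t)) => [|i _]; last first.
    by rewrite invfM invrK mulrA divff ?mul1r // yy_neq0.
  rewrite !prodr_const !card_ord exprD mulrAC -exprMn mulVf // expr1n mul1r.
  by [].
have ES : A + B = T * eg mu - eg la.
  rewrite S (eg_sum sm) (eg_sum sla) mulrDr exprD mulrCA TN mulr1 opprD addrACA subrr add0r.
  congr (_ + _).
    by rewrite mulrCA !mulr_sumr; apply: eq_bigr => j _; ring.
  by rewrite -mulNr mulr_sumr; apply: eq_bigr => i _; ring.
rewrite EB1 EA1; split.
  apply: (mulfI t1n); rewrite mulrDr [(1 - t) * (tau t N 1 * _)]mulrA tau1.
  have -> : BV = 1 - t^-1 ^+ N - AV by rewrite -EP addrC addKr.
  rewrite (_ : (1 - t) * (t^-1 * (Rf la mu * (t * T / (1 - t)) * (1 - t^-1 ^+ N - AV))) =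
     Rf la mu * (T - T * t^-1 ^+ N - T * AV)); last by field; rewrite t0 t1n.
  rewrite TN; field.
  by [].
have EA3 : \sum_(j < n | is_part (incr_nth mu j))
     q ^+ nth 0%N mu j * t^-1 ^+ j * (psi mu j * Rf la (incr_nth mu j)) = Rf la mu * (1 / (t - 1)) * A.
  by apply: (mulfI T0'); rewrite EA2; ring.
rewrite EA3.
set SL := \sum_(i < m | _) _ in EB2 *.
rewrite (_ : q * t^-1 ^+ N.+1 * (1 - t^-1) * SL = t^-1 ^+ N.+1 * (1 - t^-1) * (q * SL)); last by ring.
have eB : B = T * eg mu - eg la - A by rewrite -ES addrC addKr.
rewrite EB2 eB exprS.
rewrite (_ : t^-1 * t^-1 ^+ N * (1 - t^-1) * (Rf la mu * (t * T / (1 - t)) * t * (T * eg mu - eg la - A)) =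
   (T * t^-1 ^+ N) * (Rf la mu * ((t - 1) / (1 - t)) * (T * eg mu - eg la - A))); last by field; rewrite t0 t1n.
rewrite TN; field.
by rewrite t1n tn1'.
Qed.
End Rational.

(** * Uniqueness *)

Lemma sum_resize (V : nmodType) (F : nat -> V) (P : pred nat) a b :
  (forall j, P j -> (j < a)%N -> (b <= j)%N -> F j = 0) ->
  (forall j, P j -> (j < b)%N -> (a <= j)%N -> F j = 0) ->
  \sum_(j < a | P j) F j = \sum_(j < b | P j) F j.
Proof.
move=> H1 H2.
have W c d : (c <= d)%N -> (forall j, P j -> (j < d)%N -> (c <= j)%N -> F j = 0) ->
    \sum_(j < d | P j) F j = \sum_(j < c | P j) F j.
  move=> cd H; rewrite [RHS](big_ord_widen_cond d P F cd).
  rewrite [LHS](bigID (fun j : 'I_d => (j < c)%N)) /= [X in _ + X]big1 ?addr0 // => j /andP[Pj].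
  by rewrite -leqNgt; apply: H.
have [ab|/ltnW ba] := leqP a b; first by rewrite (W a b).
exact: W.
Qed.

Lemma nfunE b s : (size s <= b)%N -> nfun s = (\sum_(i < b) i * nth 0 s i)%N.
Proof.
move=> sb; rewrite /nfun; apply: (sum_resize (P := xpredT) (F := fun i => (i * nth 0 s i)%N)) => j _ h1 h2.
  by move: h1 h2 sb; lia.
by rewrite nth_default // muln0.
Qed.

Lemma nfun_incr s j : nfun (incr_nth s j) = (nfun s + j)%N.
Proof.
pose b := maxn j.+1 (size s).
have b1 : (size (incr_nth s j) <= b)%N by rewrite size_incr_nth /b; case: ifP; lia.
have b2 : (size s <= b)%N by rewrite /b; lia.
have jb : (j < b)%N by rewrite /b; lia.
rewrite (nfunE b1) (nfunE b2).
rewrite (eq_bigr (fun i : 'I_b => (i * nth 0 s i + (if i == Ordinal jb then j else 0))%N)) => [|i _].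
  by rewrite big_split /= -big_mkcond big_pred1_eq.
rewrite nth_incr_nth mulnDr addnC; congr (_ + _)%N; rewrite eq_sym -val_eqE /=.
by case: eqP => [->|_]; rewrite ?muln1 ?muln0.
Qed.

Section Uniqueness.
Variables (K : fieldType) (D : nat).
Hypothesis K0 : forall n : nat, n.+1%:R != 0 :> K.
Variables q t : K.
Hypothesis t0 : t != 0.
Hypothesis q0 : q != 0.
Hypothesis q1 : forall r : nat, q ^+ r.+1 != 1.
Hypothesis t1 : forall r : nat, t ^+ r.+1 != 1.
Hypothesis spec : forall n (a b : nat -> nat),
  \sum_(i < n) q ^+ a i * t ^+ i = \sum_(i < n) q ^+ b i * t ^+ i -> forall i, (i < n)%N -> a i = b i.
Hypothesis indep : forall a b c d : nat, q ^+ a * t ^+ b = q ^+ c * t ^+ d -> a = c /\ b = d.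
Hypothesis D0 : (0 < D)%N.
Variables m N : nat.
Local Notation psi := (psi q t).
Local Notation node := (@node K q t).
Local Notation eg := (@eg K q t).
Local Notation n := (m + N)%N.
Local Notation T := (t ^+ N).
Local Notation MM := (@MM K D q t N).
Local Notation Rf := (@Rf K q t m N).

Lemma psi_neq0 s j : is_part s -> is_part (incr_nth s j) -> psi s j != 0.
Proof.
move=> Ps Ps'; rewrite psiE ?(incr_size Ps') //; apply/prodf_neq0 => k _.
have kj := ltn_ord k; have yj0 := yy_neq0 t0 q0 s j.
have := nth_part_le Ps' (ltnW kj); rewrite !nth_incr_nth eqxx (gtn_eqF kj) /= add0n add1n => le.
rewrite (yy_part q t0 Ps (ltnW kj)) gfM //.
have -> : (nth 0 s k - nth 0 s j = (nth 0 s k - (nth 0 s j).+1).+1)%N by clear -le; lia.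
set d := (nth 0 s k - (nth 0 s j).+1)%N.
have -> : (j - k = (j - k).-1.+1)%N by clear -kj; lia.
set e := (j - k).-1; rewrite !exprS.
have -> : t * (q * q ^+ d * (t * t ^+ e)) / q = q ^+ d * t ^+ e.+2 by rewrite !exprS; field.
have -> : q * q ^+ d * (t * t ^+ e) / t = q ^+ d.+1 * t ^+ e by rewrite !exprS; field.
have -> : q * q ^+ d * (t * t ^+ e) / q = q ^+ d * t ^+ e.+1 by rewrite !exprS; field.
have -> : q * q ^+ d * (t * t ^+ e) = q ^+ d.+1 * t ^+ e.+1 by rewrite !exprS.
have H a b : (0 < a + b)%N -> 1 - q ^+ a * t ^+ b != 0 by apply: qt_n1.
by rewrite mulf_neq0 ?invr_eq0 ?mulf_neq0 ?H //; rewrite ?addnS ?addSn.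
Qed.

Lemma recurrences_zero (F : seq nat -> seq nat -> K) :
  F [::] [::] = 0 ->
  (forall la mu, is_part la -> is_part mu -> (size la <= m)%N -> (size mu <= n)%N ->
    (sumn la <= D)%N -> (sumn mu < D)%N ->
  t^-1 * (\sum_(i < m | (nth 0 la i.+1 < nth 0 la i)%N) psi (decr la i) i * F (decr la i) mu)
   + tau t N 1 * F la mu =
  \sum_(j < n | is_part (incr_nth mu j)) psi mu j * F la (incr_nth mu j)
  /\
  eg la * F la mu - q * t^-1 ^+ N.+1 * (1 - t^-1) *
  (\sum_(i < m | (nth 0 la i.+1 < nth 0 la i)%N)
     q ^+ (nth 0%N la i).-1 * t^-1 ^+ i * (psi (decr la i) i * F (decr la i) mu)) =
  T * eg mu * F la mu - (t - 1) *
  \sum_(j < n | is_part (incr_nth mu j))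
     q ^+ nth 0%N mu j * t^-1 ^+ j * (psi mu j * F la (incr_nth mu j))) ->
  forall la mu, is_part la -> is_part mu -> (size la <= m)%N -> (size mu <= n)%N ->
    (sumn la <= D)%N -> (sumn mu <= D)%N -> F la mu = 0.
Proof.
move=> F0 rel.
have tn1 : t - 1 != 0 by rewrite subr_eq0 -[t]expr1 t1.
have base : forall la, is_part la -> (size la <= m)%N -> (sumn la <= D)%N -> F la [::] = 0.
  move=> la; have [k] := ubnP (sumn la); elim: k la => // k IH la lk Pla sla lD.
  have [->//|lne] := eqVneq la [::].
  have [R1 R2] := rel la [::] Pla isT sla (leq0n _) lD D0.
  have Z i : (nth 0 la i.+1 < nth 0 la i)%N -> F (decr la i) [::] = 0.
    move=> lt; have [Pd _] := decrP Pla lt; have sd := sumn_decr Pla lt.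
    by apply: IH; rewrite ?(leq_trans (size_decr _ _)) //; lia.
  rewrite big1 in R1; last by move=> i lt; rewrite Z // mulr0.
  rewrite [X in _ - _ * X]big1 in R2; last by move=> i lt; rewrite Z // !mulr0.
  rewrite (eq_bigr (fun j : 'I_n => psi [::] j * F la (incr_nth [::] j))) in R2; last first.
    move=> j Pj; have := incr_size Pj; rewrite leqn0 => /eqP j0.
    by rewrite nth_nil j0 !expr0 !mul1r.
  (* For mu empty a box can be added in row 0 only, whose point is 1, so both recurrences contain
     the same sum; eliminating it leaves (e_la - 1) F = 0. *)
  rewrite -R1 !mulr0 add0r subr0 /= mulr1 in R2.
  have E : (eg la - 1) * F la [::] = 0.
    rewrite mulrBl R2; have := tauE t N 1; rewrite !expr1 => tE.
    rewrite mulrA (_ : (t - 1) * tau t N 1 = T - 1); first by ring.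
    by rewrite -[T - 1]opprB -tE; ring.
  move/eqP: E; rewrite mulf_eq0 subr_eq0 => /orP[/eqP e|/eqP //].
  case: la lne Pla e {lk sla lD R1 R2 Z} => // x la _ Pla e.
  have := @eg_eq K q t t0 spec (x :: la) [::] e 0%N => /=.
  by move: Pla; rewrite is_part_cons => /and3P[]; lia.
move=> la mu; have [k] := ubnP (sumn mu); elim: k la mu => // k IHk la mu.
have [w] := ubnP (nfun mu); elim: w mu => // w IHw mu mw mk Pla Pm sla sm lD mD.
have [->|mne] := eqVneq mu [::]; first exact: base.
pose l := (size mu).-1.
have sz : size mu = l.+1 by rewrite /l prednK // lt0n size_eq0.
have lt : (nth 0 mu l.+1 < nth 0 mu l)%N.
  by rewrite [X in (X < _)%N]nth_default ?sz // (all_nthP 0%N (is_part_pos Pm)) // sz.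
have [Pd Ed] := decrP Pm lt; have sd := sumn_decr Pm lt.
set nu := decr mu l in Pd Ed sd.
have snu : (size nu <= l.+1)%N by rewrite -sz size_decr.
have nn : (size nu <= n)%N by rewrite (leq_trans (size_decr _ _)).
have nD : (sumn nu < D)%N by rewrite -sd.
have Z0 ka : is_part ka -> (size ka <= m)%N -> (sumn ka <= D)%N -> F ka nu = 0.
  by move=> Pk sk kD; apply: IHk => //; [rewrite -ltnS -sd | apply: ltnW].
have [R1 R2] := rel la nu Pla Pd sla nn lD nD.
have Z i : (nth 0 la i.+1 < nth 0 la i)%N -> F (decr la i) nu = 0.
  move=> lti; have [Pk _] := decrP Pla lti; have sk := sumn_decr Pla lti.
  by apply: Z0; rewrite ?(leq_trans (size_decr _ _)) //; lia.
rewrite big1 in R1; last by move=> i lti; rewrite Z // mulr0.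
rewrite [X in _ - _ * X]big1 in R2; last by move=> i lti; rewrite Z // !mulr0.
rewrite (Z0 la) // !mulr0 addr0 in R1; rewrite (Z0 la) // !mulr0 !sub0r in R2.
move/esym/eqP: R2; rewrite oppr0 oppr_eq0 mulf_eq0 (negbTE tn1) /= => /eqP R2.
(* The second recurrence minus the point of row l + 1 times the first removes the term with a new
   row below row l. Rows j < l give partitions with smaller [nfun], so only the box in row l is
   left. *)
have C : \sum_(j < n | is_part (incr_nth nu j)) (node nu j - node nu l.+1) * (psi nu j * F la (incr_nth nu j)) = 0.
  rewrite (eq_bigr (fun j : 'I_n => node nu j * (psi nu j * F la (incr_nth nu j)) - node nu l.+1 * (psi nu j * F la (incr_nth nu j)))) => [|j _]; last by rewrite mulrBl.
  by rewrite sumrB -mulr_sumr -R1 mulr0 subr0.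
have ln : (l < n)%N by rewrite -sz.
rewrite (bigD1 (Ordinal ln)) /= ?Ed // big1 ?addr0 in C; last first.
  move=> j /andP[Pj jl]; have jl' : nat_of_ord j != l by move: jl; rewrite -val_eqE.
  have := incr_size Pj => js.
  have [e|ne] := eqVneq (nat_of_ord j) l.+1; first by rewrite e subrr mul0r.
  have jlt : (j < l)%N by move: js snu jl' ne; lia.
  rewrite IHw ?mulr0 //.
  - by rewrite nfun_incr; move: mw; rewrite -Ed nfun_incr; lia.
  - by rewrite sumn_incr -sd.
  - by rewrite size_incr_nth; case: ifP => // _; lia.
  - by rewrite sumn_incr -sd.
move/eqP: C; rewrite !mulf_eq0 subr_eq0 => /or3P[/eqP e|/eqP e|/eqP //].
  by have := yy_inj t0 indep e; lia.
by have := psi_neq0 Pd (j := l); rewrite Ed e eqxx => /(_ Pm).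
Qed.

Lemma Rf_nil : Rf [::] [::] = 1.
Proof.
have V : VV m N [::] [::] by apply/forallP => i; rewrite !nth_nil.
have P1 c k : PP q t c k [::] = 1.
  by rewrite /PP big1 // => a _; rewrite big1 // => b _; rewrite /FP !nth_nil subnn /gp big_ord0 expr0 mulr1; case: ifP.
rewrite /Rf V !P1 /Gf big1 ?muln0 ?expr0 ?mulr1 // => i _; rewrite big1 // => j _.
by rewrite !nth_nil subrr /gz /= !big_ord0 divr1.
Qed.

Lemma MM_Rf la mu : is_part la -> is_part mu -> (size la <= m)%N -> (size mu <= n)%N ->
  (sumn la <= D)%N -> (sumn mu <= D)%N -> MM la mu = Rf la mu.
Proof.
move=> Pla Pm sla sm lD mD; apply/eqP; rewrite -subr_eq0; apply/eqP.
move: la mu Pla Pm sla sm lD mD; apply: (recurrences_zero (F := fun la mu => MM la mu - Rf la mu)).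
  by rewrite Rf_nil (MM_nil D K0 t0 q1 t1 spec N) subrr.
move=> la mu Pla Pm sla sm lD mD.
have [A1 A2] := Rf_recurrences t0 q0 t1 indep Pla Pm sla sm.
have B1 := @MM_recurrence_p1 K D K0 q t t0 q0 q1 t1 spec indep D0 N la mu Pla lD Pm mD.
have B2 := @MM_recurrence_EE K D K0 q t t0 q0 q1 t1 spec indep D0 N la mu Pla lD Pm mD.
have SL (F : nat -> K) : \sum_(i < size la | (nth 0 la i.+1 < nth 0 la i)%N) F i =
    \sum_(i < m | (nth 0 la i.+1 < nth 0 la i)%N) F i.
  apply: (sum_resize (P := fun i => (nth 0 la i.+1 < nth 0 la i)%N)) => j lt h1 h2; first by move: h1 h2 sla; lia.
  by move: lt; rewrite [X in (_ < X)%N]nth_default.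
have SM (F : nat -> K) : (forall j, is_part (incr_nth mu j) -> (n <= j)%N -> F j = 0) ->
    \sum_(j < (size mu).+1 | is_part (incr_nth mu j)) F j = \sum_(j < n | is_part (incr_nth mu j)) F j.
  move=> F0; apply: (sum_resize (P := fun j => is_part (incr_nth mu j))) => j Pj h1 h2; first exact: F0.
  by have := incr_size Pj; move: h2; clear; lia.
(* When mu already has n rows, the recurrences for M contain a term with one more row that those for
   [Rf] lack; it vanishes. *)
have MZ j : is_part (incr_nth mu j) -> (n <= j)%N -> MM la (incr_nth mu j) = 0.
  move=> Pj nj; apply: (@MM_vanish K D K0 q t t0 q1 t1 spec N m) => //; first by rewrite sumn_incr.
  by rewrite size_incr_nth; case: ifP; move: nj; clear; lia.
rewrite (SL (fun i => psi (decr la i) i * MM (decr la i) mu)) in B1.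
rewrite (SL (fun i => q ^+ (nth 0%N la i).-1 * t^-1 ^+ i * (psi (decr la i) i * MM (decr la i) mu))) in B2.
rewrite (SM (fun j => psi mu j * MM la (incr_nth mu j))) in B1; last by move=> j Pj nj; rewrite MZ // mulr0.
rewrite (SM (fun j => q ^+ nth 0%N mu j * t^-1 ^+ j * (psi mu j * MM la (incr_nth mu j)))) in B2;
  last by move=> j Pj nj; rewrite MZ // !mulr0.
have SB k (P : pred 'I_k) (G F1 F2 : 'I_k -> K) :
   \sum_(i < k | P i) G i * (F1 i - F2 i) = \sum_(i < k | P i) G i * F1 i - \sum_(i < k | P i) G i * F2 i.
  by rewrite -sumrB; apply: eq_bigr => i _; rewrite mulrBr.
have SB2 k (P : pred 'I_k) (G H F1 F2 : 'I_k -> K) :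
   \sum_(i < k | P i) G i * (H i * (F1 i - F2 i)) = \sum_(i < k | P i) G i * (H i * F1 i) - \sum_(i < k | P i) G i * (H i * F2 i).
  by rewrite -sumrB; apply: eq_bigr => i _; rewrite mulrBr mulrBr.
rewrite !SB !SB2; split.
  by rewrite -B1 -A1; ring.
have comb (e M R a SM' SR T' b UM UR : K) : e * M - a * SM' = T' * M - b * UM ->
    e * R - a * SR = T' * R - b * UR -> e * (M - R) - a * (SM' - SR) = T' * (M - R) - b * (UM - UR).
  move=> e1 e2; rewrite (_ : _ - _ = (e * M - a * SM') - (e * R - a * SR)); last by ring.
  by rewrite e1 e2; ring.
exact: (comb _ _ _ _ _ _ _ _ _ _ B2 A2).
Qed.
End Uniqueness.

(** * Evaluation of the explicit factors *)

Lemma lt_conjp la c M : is_part la -> (c < nth 0 la M)%N = (M < conjp la c)%N.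
Proof.
rewrite /is_part /conjp => /andP[so _]; elim: la so M => [|x la IH] so M /=; first by rewrite nth_nil.
have {}IH := IH (path_sorted so).
have tail : (x <= c)%N -> count (fun x => (c < x)%N) la = 0%N.
  move=> xc; apply/eqP; rewrite -leqn0 leqNgt -has_count; apply/hasPn => y yl.
  have := order_path_min (rev_trans leq_trans) so => /allP /(_ y yl) /= h.
  by rewrite -leqNgt (leq_trans h).
case: M => [|M] /=; first by case: ltnP => // xc; rewrite tail.
by rewrite IH; case: (ltnP c x) => // xc; rewrite (tail xc).
Qed.

Lemma conjp_size la c : (conjp la c <= size la)%N.
Proof. exact: count_size. Qed.

Lemma prod_telescope (F : fieldType) n (f : nat -> F) : (forall j, (j <= n)%N -> f j != 0) ->
  \prod_(j < n) (f j / f j.+1) = f 0%N / f n.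
Proof.
elim: n => [|n IH] f0; first by rewrite big_ord0 divff ?f0.
rewrite big_ord_recr IH => [|j jn]; last by rewrite f0 // ltnW.
by rewrite /= mulrA divfK // f0.
Qed.

Section Explicit.
Variables (K : fieldType) (q t : K).
Hypothesis t0 : t != 0.
Hypothesis q0 : q != 0.
Hypothesis indep : forall a b c d : nat, q ^+ a * t ^+ b = q ^+ c * t ^+ d -> a = c /\ b = d.
Local Notation qpz := (qpz q).
Local Notation gp := (gp q).

Definition qtz (b : K) (la : seq nat) : K :=
  \prod_(i < size la) qpz (b * t ^ (- (i%:Z))) (nth 0%N la i)%:Z.
Definition cpz (la : seq nat) : K :=
  \prod_(i < size la) \prod_(j < nth 0%N la i)
     (1 - q ^+ ((nth 0 la i - j.+1).+1) * t ^+ (conjp la j - i.+1)).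

Lemma qpzn b k : qpz b (Posz k) = \prod_(i < k) (1 - b * q ^+ i). Proof. by []. Qed.

Lemma gp_qpz x y d : gp x y d = qpz x d / qpz y d.
Proof. by rewrite /gp /= prodf_div. Qed.

Lemma qpz_split x d e :
  qpz (q * x) (d + e)%N = qpz (q * x) d * \prod_(c < e) (1 - q ^+ (d + e - c) * x).
Proof.
rewrite !qpzn big_split_ord /=; congr (_ * _).
rewrite (reindex_inj rev_ord_inj) /=; apply: eq_bigr => c _; congr (1 - _).
have ce := ltn_ord c; rewrite (_ : (d + e - c = (d + (e - c.+1)).+1)%N) ?exprS; first by ring.
by move: ce; clear; lia.
Qed.

Lemma qpz_neq0 (j : int) k : qpz (q * t ^ j) (Posz k) != 0.
Proof.
rewrite qpzn; apply/prodf_neq0 => i _; rewrite mulrAC -exprS.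
case: j => j; first exact: (@qt_n1 K q t t0 q0 indep i.+1 j isT).
rewrite subr_eq0; apply/negP => /eqP; rewrite NegzE -exprnN => e.
have h : t ^+ j.+1 != 0 by rewrite expf_neq0.
have := @indep i.+1 0 0 j.+1; rewrite !expr0 mulr1 mul1r => H.
by have [] // : i.+1 = 0%N /\ 0%N = j.+1; apply: H; rewrite -[LHS](mulfVK h) -e mul1r.
Qed.

Section Row.
Variables (la : seq nat) (a : nat).
Hypothesis Pla : is_part la.
Local Notation x := (nth 0%N la).

(** The factor of row a in c'_la when only the first M rows are counted in the legs; for M at least
    the number of rows it is the full factor. *)
Definition rowc M := \prod_(c < x a) (1 - q ^+ (x a - c) * t ^+ (minn M (conjp la c) - a.+1)).

Lemma rowcS M : (a < M)%N ->
  rowc M.+1 * \prod_(c < x M) (1 - q ^+ (x a - c) * t ^+ (M - a).-1) =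
  rowc M * \prod_(c < x M) (1 - q ^+ (x a - c) * t ^+ (M - a)).
Proof.
move=> aM; have le : (x M <= x a)%N := nth_part_le Pla (ltnW aM).
rewrite !(big_ord_widen _ (fun c => 1 - q ^+ (x a - c) * _) le).
rewrite ![X in _ * X = _]big_mkcond ![X in _ = _ * X]big_mkcond -!big_split /=.
apply: eq_bigr => c _; rewrite lt_conjp //; case: ifP => h; last first.
  by rewrite !mulr1; congr (1 - _ * t ^+ _); move: h; lia.
rewrite mulrC; congr ((1 - _ * t ^+ _) * (1 - _ * t ^+ _)); by move: h aM; clear; lia.
Qed.

(** Induction on M: the new factor trades (q t^(M-a-1); q) for (q t^(M-a); q) up to the columns that
    reach row M, and exactly these columns get a longer leg in [rowc]. *)
Lemma row_prod M : (a < M)%N ->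
  (\prod_(b < M) (if (a < b)%N then gp (q * t ^+ (b - a)) (q * t ^+ (b - a).-1) (x a - x b) else 1)) * rowc M
   = qpz (q * t ^+ (M - a.+1)) (x a).
Proof.
elim: M => // M IH; rewrite ltnS leq_eqVlt => /orP[/eqP e|aM].
  rewrite big1 => [|b _]; last first.
    by have bM := ltn_ord b; case: ifP => //; move: bM e; clear; lia.
  rewrite -e subnn expr0 !mulr1 mul1r.
  have := qpz_split 1 0 (x a); rewrite add0n [qpz _ 0%N]big_ord0 mul1r mulr1 => ->.
  apply: eq_bigr => c _; rewrite (_ : minn _ _ - _ = 0)%N ?expr0 //.
  by have : (a < conjp la c)%N; [rewrite -lt_conjp | lia].
rewrite big_ord_recr /= aM.
have le : (x M <= x a)%N := nth_part_le Pla (ltnW aM).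
set A := \prod_(b < M) _ in IH *; have {}IH := IH aM.
rewrite subSS.
have ne j k : qpz (q * t ^+ j) (Posz k) != 0 by exact: (qpz_neq0 j k).
set d := (x a - x M)%N; have E : x a = (d + x M)%N by rewrite /d subnK.
have ed : (x a - x M = d)%N by [].
have S1 := qpz_split (t ^+ (M - a)) d (x M).
have S2 := qpz_split (t ^+ (M - a).-1) d (x M).
rewrite -E in S1 S2.
have R := rowcS aM; rewrite (_ : (M - a.+1 = (M - a).-1)%N) in IH; last by rewrite subnS.
transitivity (qpz (q * t ^+ (M - a)) (x a)); last by [].
rewrite S1 gp_qpz; rewrite S2 in IH; move: IH R (ne (M - a).-1 d) (ne (M - a).-1 (x a)); rewrite S2.
set u := qpz _ _; set v := \prod_(c < x M) _; set v' := \prod_(c < x M) _; set u' := qpz (q * t ^+ (M - a)) _.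
move=> IH R u0; rewrite mulf_eq0 negb_or u0 /= => v0.
apply: (mulIf v0); rewrite -[LHS]mulrA R.
rewrite (_ : A * (u' / u) * (rowc M * v') = (A * rowc M) * v' * (u' / u)); last by ring.
rewrite IH; move: u0; clear; move: u v u' v' => u v u' v' u0; field.
by [].
Qed.
End Row.

Lemma rowc_neq0 la a M : rowc la a M != 0.
Proof. apply/prodf_neq0 => c _; apply: (@qt_n1 K q t t0 q0 indep); have := ltn_ord c; lia. Qed.

Lemma PP_q la m : is_part la -> (size la <= m)%N ->
  PP q t q m la = t ^+ nfun la * (qtz (q * t ^ (m%:Z - 1)) la / cpz la).
Proof.
move=> Pla lm.
have Ea (a : 'I_m) : \prod_(b < m) FP q t q la a b =
  (\prod_(b < m) (if (a < b)%N then t ^+ nth 0%N la b else 1)) *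
   (qpz (q * t ^+ (m - a.+1)) (nth 0%N la a) / rowc la a m).
  rewrite -(row_prod Pla (ltn_ord a)) mulfK ?rowc_neq0 // -big_split; apply: eq_bigr => b _ /=.
  by rewrite /FP; case: ifP; rewrite ?mulr1.
have mulcong (a b c d : K) : a = c -> b = d -> a * b = c * d by move=> -> ->.
rewrite /PP (eq_bigr _ (fun a _ => Ea a)) big_split; apply: mulcong.
  rewrite exchange_big /= (nfunE lm) expr_sum; apply: eq_bigr => b _.
  rewrite -big_mkcond -(big_ord_widen m (fun _ => t ^+ nth 0%N la b) (ltnW (ltn_ord b))).
  by rewrite prodr_const card_ord -exprM mulnC.
rewrite prodf_div /qtz /cpz; congr (_ / _).
  apply/esym; rewrite (big_ord_widen _ (fun i => qpz (q * t ^ (m%:Z - 1) * t ^ (- i%:Z)) (nth 0%N la i)) lm).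
  rewrite big_mkcond; apply: eq_bigr => i _; case: ifP => h; last by rewrite [nth _ _ _]nth_default ?qpzn ?big_ord0 // leqNgt h.
  rewrite -mulrA -expfzDr // exprnP; congr (qpz (q * t ^ _) _).
  by have := ltn_ord i; lia.
apply/esym; rewrite (big_ord_widen _ (fun i => \prod_(j < nth 0%N la i) (1 - q ^+ ((nth 0 la i - j.+1).+1) * t ^+ (conjp la j - i.+1))) lm).
rewrite big_mkcond; apply: eq_bigr => i _; rewrite /rowc; case: ifP => h; last by rewrite [nth _ _ _]nth_default ?big_ord0 // leqNgt h.
apply: eq_bigr => c _; have ci := ltn_ord c; have := conjp_size la c => cs.
congr (1 - q ^+ _ * t ^+ _); last by move: cs lm; clear; lia.
exact: (subnSK ci).
Qed.

(** As 1/(q; q)_(-p-1) = (q^(-p); q)_(p+1) = 0, the value obtained through the convention 0^-1 = 0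
    is the intended one. *)
Lemma gz_negz p : gz q t 0 (Negz p) = 0.
Proof.
rewrite /gz expr0z mulr1 /= [X in _ / X^-1]big_ord_recr /=.
have -> : q * q ^ (- p.+1%:Z) * q ^+ p = 1; last rewrite ?subrr ?mulr0 ?invr0 ?mulr0 //.
by rewrite -exprnN exprS; field; rewrite q0 expf_neq0.
Qed.

Lemma Gf_nVV m N la mu : ~~ VV m N la mu -> Gf q t m N la mu = 0.
Proof.
rewrite negb_forall => /existsP[i]; rewrite -ltnNge => lt.
have iN : (i + N < m + N)%N by rewrite ltn_add2r.
rewrite /Gf (bigD1 i) //= (bigD1 (Ordinal iN)) //=.
rewrite (_ : _ - _ - _ = 0); last by lia.
have -> : (nth 0%N la i)%:Z - (nth 0%N mu (i + N))%:Z = Negz (nth 0%N mu (i + N) - nth 0%N la i).-1 by move: lt; clear; lia.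
by rewrite gz_negz !mul0r.
Qed.

Lemma PP_nil c n : PP q t c n [::] = 1.
Proof.
by rewrite /PP big1 // => a _; rewrite big1 // => b _; rewrite /FP !nth_nil subnn /gp big_ord0 expr0 mulr1; case: ifP.
Qed.

Lemma Rf_expl m N la mu : is_part la -> (size la <= m)%N ->
  Rf q t m N la mu = t ^ ((nfun la)%:Z - (m * sumn mu)%:Z) * PP q t t (m + N) mu
   * (qtz (q * t ^ (m%:Z - 1)) la / cpz la) * Gf q t m N la mu.
Proof.
move=> Pla lm; rewrite /Rf; case: ifPn => [_|/Gf_nVV ->]; last by rewrite mulr0.
by rewrite PP_q // expz_sub // exprVn; ring.
Qed.

Lemma Rf_0 N mu : Rf q t 0 N [::] mu = PP q t t N mu.
Proof.
rewrite /Rf ifT; last by apply/forallP => -[].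
by rewrite mul0n expr0 mul1r /Gf big_ord0 mulr1 [PP _ _ _ 0 _]big_ord0 mulr1.
Qed.

(** For empty mu the product over j telescopes in each row. Its first term replaces m by -N in the
    shifted factorial, so the number of rows chosen for m drops out. *)
Lemma Rf_mu0 N nu : is_part nu ->
  Rf q t (size nu) N nu [::] = t ^+ nfun nu * (qtz (q * t ^ (- N%:Z - 1)) nu / cpz nu).
Proof.
move=> Pn; rewrite Rf_expl // PP_nil muln0 subr0 mulr1 exprnP -[LHS]mulrA; congr (_ * _).
rewrite mulrAC; congr (_ / _); rewrite /Gf /qtz -big_split; apply: eq_bigr => i _.
have := @prod_telescope _ (size nu + N) (fun j => qpz (q * t ^ (j%:Z - i%:Z - N%:Z - 1)) (nth 0%N nu i)).
move=> H; rewrite (_ : \prod_(j < _) _ = \prod_(j < size nu + N)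
   (qpz (q * t ^ (j%:Z - i%:Z - N%:Z - 1)) (nth 0%N nu i) / qpz (q * t ^ (j.+1%:Z - i%:Z - N%:Z - 1)) (nth 0%N nu i))); last first.
  by apply: eq_bigr => j _; rewrite nth_nil subr0 /gz; congr (_ / qpz (_ * t ^ _) _); lia.
rewrite H; last by move=> j _; apply: qpz_neq0.
have mulK (x y z : K) : y != 0 -> x = z -> y * (x / y) = z by move=> y0 ->; rewrite mulrC divfK.
rewrite -[q * _ * _]mulrA -expfzDr // -[in RHS]mulrA -expfzDr //.
rewrite (_ : (size nu + N)%N%:Z - i%:Z - N%:Z - 1 = (size nu)%:Z - 1 + - i%:Z); last by lia.
apply: mulK; first exact: qpz_neq0.
congr (qpz (q * t ^ _) _); lia.
Qed.
End Explicit.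

(** * Comparison with the definitions over Q(q,t) *)

Section Field.
Import Order.TTheory Num.Theory.

Lemma tofrac_nat n : (n%:R : Defs.K) = tofrac (n%:R : Rqt).
Proof. by rewrite rmorph_nat. Qed.

Lemma frac_inj (x y : Rqt) : tofrac x = tofrac y -> x = y.
Proof. by move/eqP; rewrite tofrac_eq => /eqP. Qed.

Lemma Kchar n : n.+1%:R != 0 :> Defs.K.
Proof. by rewrite tofrac_nat tofrac_eq0 -!polyC_natr !polyC_eq0 pnatr_eq0. Qed.

Lemma tt_neq0 : tt_ != 0.
Proof. by rewrite tofrac_eq0 polyC_eq0 polyX_eq0. Qed.

Lemma qq_neq0 : qq != 0.
Proof. by rewrite tofrac_eq0 polyX_eq0. Qed.

Lemma qt_monE a b : qq ^+ a * tt_ ^+ b = tofrac ('X^a * ('X^b)%:P : Rqt).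
Proof. by rewrite polyC_exp [RHS]rmorphM /= !rmorphXn. Qed.

Lemma qt_spec n (a b : nat -> nat) :
  \sum_(i < n) qq ^+ a i * tt_ ^+ i = \sum_(i < n) qq ^+ b i * tt_ ^+ i ->
  forall i, (i < n)%N -> a i = b i.
Proof.
under eq_bigr do rewrite qt_monE; under [in RHS]eq_bigr do rewrite qt_monE.
rewrite -!rmorph_sum => /frac_inj E i0 ni.
have C (c : nat -> nat) : (\sum_(i < n) 'X^(c i) * ('X^i)%:P : {poly {poly rat}})`_(a i0)`_i0 = (a i0 == c i0)%:R.
  rewrite coef_sum coef_sum (bigD1 (Ordinal ni)) //= big1 => [|i ne].
    by rewrite coefMC coefXn addr0 -[RHS]mul1r mulr_natl; case: eqP => _; rewrite ?mul1r ?mul0r ?coef0 // coefXn eqxx.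
  rewrite coefMC coefXn; case: eqP => _; rewrite ?mul1r ?mul0r ?coef0 // coefXn.
  by move: ne; rewrite -val_eqE /= eq_sym => /negbTE ->.
have := C b; rewrite -E C eqxx; by case: eqP => // _ /eqP.
Qed.

Lemma qt_indep a b c d : qq ^+ a * tt_ ^+ b = qq ^+ c * tt_ ^+ d -> a = c /\ b = d.
Proof.
rewrite !qt_monE => /frac_inj E.
have C (x y : nat) : ('X^x * ('X^y)%:P : {poly {poly rat}})`_a`_b = ((a == x) && (b == y))%:R.
  by rewrite coefMC coefXn; case: eqP => _; rewrite ?mul1r ?mul0r ?coef0 // coefXn.
have := C c d; rewrite -E C !eqxx; case: eqP => [->|_] /=; last by move/eqP; rewrite oner_eq0.
by case: eqP => [->|_] //= /eqP; rewrite oner_eq0.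
Qed.

Lemma qq_n1 r : qq ^+ r.+1 != 1.
Proof. by apply/eqP => e; have [] := @qt_indep r.+1 0 0 0; rewrite ?e ?expr0 ?mul1r. Qed.

Lemma tt_n1 r : tt_ ^+ r.+1 != 1.
Proof. by apply/eqP => e; have [] := @qt_indep 0 r.+1 0 0; rewrite ?e ?expr0 ?mul1r. Qed.
End Field.

Opaque Defs.K qq tt_.

(** * Identification of the chosen families with the eigenvectors *)

Section Comparison.
Local Notation K := Defs.K.
Local Notation hom D d f := ((f : {mpoly K[D]}) \is d.-homog for (@mnmwgt D)).
Local Notation Pe D := (@Pe K D qq tt_).
Local Notation pc := (@pc K _ qq tt_).
Local Notation toL D := (@toL K D).
Local Notation B := (@Bform K _ qq tt_).

Lemma toL_eq D d c c' : {in parts d, c =1 c'} -> toL D d c = toL D d c'.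
Proof. by move=> E; apply: eq_big_seq => s /E ->. Qed.

Lemma toL_lin D d (I : Type) (r : seq I) (h : I -> K) (F : I -> seq nat -> K) :
  toL D d (fun be => \sum_(i <- r) h i * F i be) = \sum_(i <- r) h i *: toL D d (F i).
Proof.
rewrite toLE (eq_bigr (fun s => \sum_(i <- r) (h i * F i s) *: pp K D s)) => [|s _]; last by rewrite scaler_suml.
rewrite exchange_big; apply: eq_bigr => i _; rewrite toLE scaler_sumr.
by apply: eq_bigr => s _; rewrite scalerA.
Qed.

Lemma mcoef_hc D d c mu : mu \in parts d -> (d <= D)%N -> mcoef c mu = hc (toL D d c) mu.
Proof.
move=> md dD; rewrite (hc_cf _ dD md) /mcoef; move: (md); rewrite mem_parts => /andP[_ /eqP ->].
by apply: eq_big_seq => r rd; rewrite cf_toL.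
Qed.

Lemma spqt_B D d c c' : (d <= D)%N -> spqt d c c' = B d (toL D d c) (toL D d c').
Proof. by move=> dD; apply: eq_big_seq => r rd; rewrite !cf_toL. Qed.

(* Witness that a Macdonald family exists. *)
Definition Pw (la rho : seq nat) : K :=
  if rho \in parts (sumn la) then cf (Pe (sumn la) la) rho else 0.

Lemma Pw_toL la : is_part la -> toL (sumn la) (sumn la) (Pw la) = Pe (sumn la) la.
Proof.
move=> Pla; have ld := part_parts Pla.
have [H _ _ _] := Pe_parts Kchar tt_neq0 qt_spec (leqnn (sumn la)) ld.
by rewrite [RHS](hom_cf H (leqnn _)); apply: toL_eq => r rd; rewrite /Pw rd.
Qed.

Lemma Pw_family : isMacFamily Pw.
Proof.
move=> la Pla; have ld := part_parts Pla.
have [H N T _] := Pe_parts Kchar tt_neq0 qt_spec (leqnn (sumn la)) ld.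
split; first by move=> rho h; rewrite /Pw (negbTE h).
have zero mu : is_part mu -> sumn mu != sumn la -> forall rho, rho \in parts (sumn mu) -> Pw la rho = 0.
  move=> Pm ne rho; rewrite /Pw !mem_parts => /andP[_ /eqP ->]; by rewrite (negbTE ne) andbF.
split => mu Pm.
  have md := part_parts Pm; split=> [->|nd].
    by rewrite (mcoef_hc _ ld (leqnn _)) Pw_toL.
  have [e|ne] := eqVneq (sumn mu) (sumn la); last first.
    by rewrite /mcoef big_seq big1 // => rho /(zero mu Pm ne) ->; rewrite mul0r.
  rewrite e in md; rewrite (mcoef_hc _ md (leqnn _)) Pw_toL //.
  by apply/eqP; apply: contraNT nd; apply: T.
move=> ne; have [e|nes] := eqVneq (sumn mu) (sumn la); last first.
  rewrite /spqt big_seq big1 // => rho.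
  rewrite mem_parts => /andP[_ /eqP r]; rewrite [X in _ * X * _](_ : _ = 0) ?mulr0 ?mul0r //.
  by rewrite /Pw mem_parts r eq_sym (negbTE nes) andbF.
rewrite (spqt_B _ _ (leqnn _)) Pw_toL // -e Pw_toL // e.
have md := part_parts Pm; rewrite e in md.
by apply: (Pe_orth Kchar tt_neq0 tt_n1 qt_spec (leqnn _)) => //; rewrite eq_sym.
Qed.

Lemma MacP_family : isMacFamily MacP.
Proof. exact: (epsilon_spec (inhabits (fun _ _ => 0)) isMacFamily (ex_intro _ _ Pw_family)). Qed.

(** Triangularity and orthogonality characterize the family, so the [epsilon] choice is the
    eigenvector basis, for every truncation D >= d. *)
Lemma MacP_toL D d la : (d <= D)%N -> la \in parts d -> toL D d (MacP la) = Pe D la.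
Proof.
move=> dD; apply: (Pe_uniq Kchar tt_neq0 qq_n1 tt_n1 qt_spec dD (Q := fun la => toL D d (MacP la))).
  move=> ka kd; move: (kd); rewrite mem_parts => /andP[Pk /eqP sk].
  have [_ [M _]] := MacP_family Pk; split; first exact: hom_toL.
    by rewrite -(mcoef_hc _ kd dD); case: (M ka Pk) => ->.
  move=> mu md; rewrite -(mcoef_hc _ md dD); apply: contraNT => nd.
  by move: (md); rewrite mem_parts => /andP[Pm _]; case: (M mu Pm) => _ ->.
move=> ka mu kd md ne; rewrite -(spqt_B _ _ dD).
move: (kd) (md); rewrite !mem_parts => /andP[Pk /eqP sk] /andP[Pm _].
by have [_ [_ O]] := MacP_family Pk; rewrite -{1}sk O.
Qed.

Lemma cf_MacP D d la rho : (d <= D)%N -> la \in parts d -> rho \in parts d -> cf (Pe D la) rho = MacP la rho.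
Proof. by move=> dD ld rd; rewrite -(MacP_toL dD ld) cf_toL. Qed.

Lemma pp_sort D s : pp K D (sort geq s) = pp K D s.
Proof. by apply: perm_big; rewrite perm_sort. Qed.

Lemma pmul_cf D d1 d2 c c' rho : (d1 + d2 <= D)%N -> rho \in parts (d1 + d2) ->
  pmul d1 d2 c c' rho = cf (toL D d1 c * toL D d2 c') rho.
Proof.
move=> dD rd; rewrite [toL D d1 c]toLE mulr_suml cf_sum /pmul !big_seq; apply: eq_bigr => al ald.
rewrite toLE mulr_sumr cf_sum !big_seq; apply: eq_bigr => be bed.
move: ald bed; rewrite !mem_parts => /andP[/is_part_pos A /eqP a] /andP[/is_part_pos A' /eqP b].
have pos : all (fun x => 0 < x)%N (al ++ be) by rewrite all_cat A A'.
rewrite -scalerAl -scalerAr !cfZ (_ : pp K D al * pp K D be = pp K D (sort geq (al ++ be))); last first.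
  by rewrite pp_sort /pp big_cat.
rewrite (cf_pp K rd dD (is_part_sort pos)); ring.
Qed.

(** The equation defining [LRcoefs] is solved by the P-expansion of the product, and linear
    independence of the P_ka makes the chosen solution agree with it on the partitions of d. *)
Lemma fLR_pc D la om nu : is_part om -> is_part nu -> (sumn om + sumn nu <= D)%N ->
  la \in parts (sumn om + sumn nu) -> fLR la om nu = pc la (Pe D om * Pe D nu).
Proof.
move=> Po Pn dD ld; rewrite /fLR ld /LRcoefs.
set d := (sumn om + sumn nu)%N in dD ld *.
have od := part_parts Po; have nd := part_parts Pn.
have oD : (sumn om <= D)%N by apply: leq_trans dD; rewrite leq_addr.
have nD : (sumn nu <= D)%N by apply: leq_trans dD; rewrite leq_addl.
have [Ho _ _ _] := Pe_parts Kchar tt_neq0 qt_spec oD od.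
have [Hn _ _ _] := Pe_parts Kchar tt_neq0 qt_spec nD nd.
have H : hom D d (Pe D om * Pe D nu) by apply: homM.
have E rho : rho \in parts d ->
    pmul (sumn om) (sumn nu) (MacP om) (MacP nu) rho = cf (Pe D om * Pe D nu) rho.
  by move=> rd; rewrite (pmul_cf _ _ dD rd) (MacP_toL oD od) (MacP_toL nD nd).
set Q := (fun g : seq nat -> K => _); set g := epsilon _ _.
have : Q g.
  apply: epsilon_spec; exists (fun ka => pc ka (Pe D om * Pe D nu)) => rho rd.
  rewrite E // {1}(Pe_exp Kchar tt_neq0 qq_n1 tt_n1 qt_spec dD H) cf_sum.
  by apply: eq_big_seq => ka kd; rewrite cfZ (cf_MacP dD kd rd).
rewrite /Q => gE.
have -> : Pe D om * Pe D nu = \sum_(ka <- parts d) g ka *: Pe D ka.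
  apply: (cf_hom_eq H _ dD).
    rewrite big_seq rpred_sum // => ka kd; apply: rpredZ.
    by have [] := Pe_parts Kchar tt_neq0 qt_spec dD kd.
  move=> rho rd; rewrite -E // gE // cf_sum; apply: eq_big_seq => ka kd.
  by rewrite cfZ (cf_MacP dD kd rd).
rewrite pc_sum (bigD1_seq la) ?uniq_parts //= pcZ (pc_Pe Kchar tt_neq0 qq_n1 tt_n1 qt_spec dD ld ld) eqxx mulr1.
rewrite big1_seq ?addr0 // => ka /andP[ne kd].
by rewrite pcZ (pc_Pe Kchar tt_neq0 qq_n1 tt_n1 qt_spec dD kd ld) (negbTE ne) mulr0.
Qed.
End Comparison.

(** * Expansion of Gamma over two alphabets *)

Fixpoint allp E : seq (seq nat) := if E is E'.+1 then allp E' ++ parts E else parts 0.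

Lemma sum_allp (V : nmodType) E (F : seq nat -> V) :
  \sum_(k < E.+1) \sum_(s <- parts k) F s = \sum_(s <- allp E) F s.
Proof.
elim: E => [|E IH]; first by rewrite big_ord_recl big_ord0 addr0.
by rewrite big_ord_recr IH -big_cat.
Qed.

Lemma mem_allp E s : (s \in allp E) = is_part s && (sumn s <= E)%N.
Proof.
elim: E => [|E IH]; first by rewrite mem_parts leqn0.
by rewrite /= mem_cat IH mem_parts -andb_orr orbC -leq_eqVlt.
Qed.

Lemma uniq_allp E : uniq (allp E).
Proof.
elim: E => [|E IH]; first exact: uniq_parts.
rewrite /= cat_uniq IH uniq_parts andbT; apply/hasPn => s; rewrite mem_parts => /andP[_ /eqP e].
by rewrite mem_allp e ltnn andbF.
Qed.

Definition subp (s : seq nat) (S : {set 'I_(size s)}) := [seq nth 0%N s (val i) | i <- enum S].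

Lemma subp_big (R : Type) (idx : R) (op : Monoid.com_law idx) s (S : {set 'I_(size s)}) (F : nat -> R) :
  \big[op/idx]_(r <- subp S) F r = \big[op/idx]_(i in S) F (nth 0%N s i).
Proof. by rewrite big_map big_enum. Qed.

Lemma subp_pos s (S : {set 'I_(size s)}) : all (fun x => 0 < x)%N s -> all (fun x => 0 < x)%N (subp S).
Proof.
by move=> h; apply/allP => x /mapP[i _ ->]; apply: (allP h); apply: mem_nth; exact: ltn_ord.
Qed.

Lemma subp_sumn s (S : {set 'I_(size s)}) : (sumn (subp S) <= sumn s)%N.
Proof.
have E u : sumn u = \sum_(x <- u) x by rewrite sumnE.
rewrite !E subp_big (big_nth 0%N) big_mkord big_mkcond.
by apply: leq_sum => i _; case: ifP.
Qed.

Section GamExpand.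
Variables (K : fieldType) (D : nat) (t : K) (N : nat).
Local Notation Lam := {mpoly K[D]}.
Local Notation Gam := (@Gam K D t N).
Local Notation tau := (tau t N).

Lemma Gam_pw r : (0 < r <= D)%N -> Gam (pw K D r) = (tau r)%:MP + t^-1 ^+ r *: pw K D r.
Proof. by move=> /pwP[i ->]; rewrite pwE GamX addrC. Qed.

Lemma prod_scale (I : finType) (P : pred I) (c : I -> K) (f : I -> Lam) :
  \prod_(i | P i) (c i *: f i) = (\prod_(i | P i) c i) *: \prod_(i | P i) f i.
Proof.
apply: (big_rec3 (fun x y z => x = y *: z)) => [|i x y z _ ->]; first by rewrite scale1r.
by rewrite -scalerAl -scalerAr scalerA.
Qed.

Lemma Gam_pp rho : all (fun x => 0 < x <= D)%N rho ->
  Gam (pp K D rho) = \sum_(S : {set 'I_(size rho)})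
    (t^-1 ^+ sumn (subp (~: S)) * \prod_(r <- subp S) tau r) *: pp K D (subp (~: S)).
Proof.
move=> h; rewrite /pp (big_nth 0%N) big_mkord rmorph_prod.
have E (i : 'I_(size rho)) : Gam (pw K D (nth 0%N rho i)) =
   (tau (nth 0%N rho i))%:MP + t^-1 ^+ nth 0%N rho i *: pw K D (nth 0%N rho i).
  by rewrite Gam_pw //; apply: (allP h); rewrite mem_nth.
rewrite (eq_bigr _ (fun i _ => E i)) bigA_distr; apply: eq_bigr => S _.
rewrite (bigID (fun i => i \in S)) /=.
rewrite (eq_bigr (fun i : 'I_(size rho) => tau (nth 0%N rho i) *: (1 : Lam))); last first.
  by move=> i ->; rewrite alg_mpolyC.
rewrite [X in _ * X](eq_bigr (fun i : 'I_(size rho) => t^-1 ^+ nth 0%N rho i *: pw K D (nth 0%N rho i))); last first.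
  by move=> i /negbTE ->.
rewrite !prod_scale big1_eq -scalerAl mul1r scalerA sumnE !subp_big expr_sum mulrC.
by congr ((_ * _) *: _); apply: eq_bigl => i; rewrite inE.
Qed.

Lemma natr_cards (I : finType) (P : pred I) : (#|[set i | P i]|)%:R = \sum_i (P i)%:R :> K.
Proof. by rewrite -sum1dep_card natr_sum big_mkcond; apply: eq_bigr => i _; case: (P i). Qed.

(** Gamma f is f(x, y) with x specialized to 1, t, ..., t^(N-1) and y scaled by 1/t. A subset S
    selects the parts of rho that take the alphabet x, which matches the count in [coef2]. *)
Lemma Gam_toL d E c : (d <= D)%N -> (d <= E)%N ->
  Gam (toL D d c) = \sum_(be <- allp E) (t^-1 ^+ sumn be *
    (\sum_(al <- allp d) (\prod_(r <- al) tau r) *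
      \sum_(rho <- parts d) c rho * (#|[set S : {set 'I_(size rho)} |
        (sort geq (subp S) == al) && (sort geq (subp (~: S)) == be)]|)%:R)) *: pp K D be.
Proof.
move=> dD dE.
have X be : \sum_(al <- allp d) (\prod_(r <- al) tau r) *
      \sum_(rho <- parts d) c rho * (#|[set S : {set 'I_(size rho)} |
        (sort geq (subp S) == al) && (sort geq (subp (~: S)) == be)]|)%:R =
   \sum_(rho <- parts d) \sum_(S : {set 'I_(size rho)})
     (sort geq (subp (~: S)) == be)%:R * (c rho * \prod_(r <- subp S) tau r).
  under eq_bigr do rewrite mulr_sumr.
  rewrite exchange_big; apply: eq_big_seq => rho; rewrite mem_parts => /andP[Pr /eqP sr].
  rewrite (eq_bigr (fun al => \sum_(S : {set 'I_(size rho)})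
     (sort geq (subp S) == al)%:R * ((sort geq (subp (~: S)) == be)%:R * (c rho * \prod_(r <- al) tau r)))); last first.
    move=> al _; rewrite (natr_cards (fun S => (sort geq (subp S) == al) && (sort geq (subp (~: S)) == be))).
    rewrite mulrA mulr_sumr; apply: eq_bigr => S _.
    by do 2!case: eqP => _; rewrite ?mulr1 ?mul1r ?mulr0 ?mul0r // mulrC.
  rewrite exchange_big; apply: eq_bigr => S _.
  have Sd : sort geq (subp S) \in allp d.
    rewrite mem_allp is_part_sort ?(perm_sumn (s2 := subp S)) ?perm_sort //; last exact/subp_pos/is_part_pos.
    by rewrite -sr subp_sumn.
  rewrite (bigD1_seq _ Sd (uniq_allp d)) /= eqxx mul1r [X in _ + X]big1 ?addr0 => [|al ne].
    by rewrite (perm_big (subp S)) ?perm_sort.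
  by rewrite eq_sym (negbTE ne) mul0r.
rewrite (eq_bigr _ (fun be _ => congr1 (fun x => (t^-1 ^+ sumn be * x) *: pp K D be) (X be))).
rewrite /toL rmorph_sum.
under [in RHS]eq_bigr do rewrite mulr_sumr scaler_suml.
rewrite exchange_big; apply: eq_big_seq => rho; rewrite mem_parts => /andP[Pr /eqP sr].
rewrite /= GamZ Gam_pp; last first.
  apply/allP => x xr; rewrite (allP (is_part_pos Pr)) //= (leq_trans _ dD) // -sr.
  by rewrite sumnE (big_rem x) //= leq_addr.
rewrite scaler_sumr; under [in RHS]eq_bigr do rewrite mulr_sumr scaler_suml.
rewrite exchange_big; apply: eq_bigr => S _.
have ps : perm_eq (sort geq (subp (~: S))) (subp (~: S)) by rewrite perm_sort.
have Sd : sort geq (subp (~: S)) \in allp E.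
  rewrite mem_allp is_part_sort ?(perm_sumn ps) //; last exact/subp_pos/is_part_pos.
  by rewrite (leq_trans (subp_sumn _)) // sr.
rewrite (bigD1_seq _ Sd (uniq_allp E)) /= eqxx mul1r [X in _ + X]big1 ?addr0 => [|al ne].
  rewrite scalerA (perm_sumn ps) mulrCA; congr (_ *: _).
  by rewrite /pp; apply: perm_big; rewrite perm_sym.
by rewrite eq_sym (negbTE ne) mul0r mulr0 scale0r.
Qed.

(** The constant term keeps only the specialized alphabet, so the principal specialization of P_mu
    is the coefficient of P_[] in Gamma P_mu. *)
Lemma Gam_coef0 d c : (d <= D)%N ->
  cf (Gam (toL D d c)) [::] = \sum_(rho <- parts d) c rho * \prod_(r <- rho) tau r.
Proof.
move=> dD; rewrite /toL rmorph_sum cf_sum; apply: eq_big_seq => rho.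
rewrite mem_parts => /andP[Pr /eqP sr].
rewrite /= GamZ cfZ /cf mon_nil /pp rmorph_prod (rmorph_prod (@mcoeff D K 0%MM)); congr (_ * _); apply: eq_big_seq => r rr.
rewrite /= Gam_pw; last first.
  rewrite (allP (is_part_pos Pr)) //= (leq_trans _ dD) // -sr.
  by rewrite sumnE (big_rem r) //= leq_addr.
have /andP[_ rD] : (0 < r <= D)%N.
  rewrite (allP (is_part_pos Pr)) //= (leq_trans _ dD) // -sr.
  by rewrite sumnE (big_rem r) //= leq_addr.
have [i ->] : exists i : 'I_D, r = i.+1 by apply: pwP; rewrite (allP (is_part_pos Pr)).
rewrite mcoeffD mcoeffC eqxx mulr1 mcoeffZ pwE mcoeffX.
by rewrite (_ : (U_(i) == 0)%MM = false) ?mulr0 ?addr0 //; apply/eqP => /mnmP /(_ i); rewrite mnm1E eqxx mnm0E.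
Qed.
End GamExpand.

Import Order.TTheory Num.Theory.

(** * The left-hand side as M(la, mu) *)

Section Assembly.
Local Notation K := Defs.K.
Local Notation hom D d f := ((f : {mpoly K[D]}) \is d.-homog for (@mnmwgt D)).
Local Notation Pe D := (@Pe K D qq tt_).
Local Notation pc := (@pc K _ qq tt_).
Local Notation toL D := (@toL K D).
Local Notation tau := (@tau K tt_).
Local Notation Gam D N := (@Gam K D tt_ N).
Local Notation Phi D N := (@Phi K D qq tt_ N).
Local Notation PeH := (Pe_parts Kchar tt_neq0 qt_spec).
Local Notation PeE := (Pe_exp Kchar tt_neq0 qq_n1 tt_n1 qt_spec).

Lemma allp_resize (V : nmodType) L E (F : seq nat -> V) : (L <= E)%N ->
  (forall s, is_part s -> (L < sumn s)%N -> (sumn s <= E)%N -> F s = 0) ->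
  \sum_(s <- allp E) F s = \sum_(s <- allp L) F s.
Proof.
move=> /subnK <-; elim: (E - L)%N => // k IH H.
rewrite addSn /= big_cat /= IH => [|s Ps Ls sk]; last by apply: H => //; rewrite addSn ltnW.
rewrite [X in _ + X]big1_seq ?addr0 // => s /andP[_]; rewrite mem_parts => /andP[Ps /eqP sk].
by apply: H; rewrite ?sk ?addSn // ltnS leq_addl.
Qed.

Lemma u0E N d c : u0 N d c = \sum_(al <- allp d) c al * \prod_(r <- al) tau N r.
Proof. by rewrite -sum_allp. Qed.

Lemma skewP_spec mu al be : is_part mu -> is_part al -> is_part be ->
  coef2 (sumn mu) (MacP mu) al be = \sum_(om <- parts (sumn be)) skewP mu om al * MacP om be.
Proof.
move=> Pm; rewrite /skewP; set Q := (fun g : seq nat -> seq nat -> K => _); set g := epsilon _ _.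
suff : Q g by move=> h; apply: h.
apply: epsilon_spec.
(* For a fixed index in the first alphabet, the part of P_mu(x, y) that multiplies p_a(x) is
   expanded in the P_om(y). *)
exists (fun om a => pc om (toL (sumn om) (sumn om) (fun b => coef2 (sumn mu) (MacP mu) a b))).
move=> a b Pa Pb; set e := sumn b; pose f := toL e e (fun b => coef2 (sumn mu) (MacP mu) a b).
have bd : b \in parts e := part_parts Pb.
transitivity (\sum_(om <- parts e) pc om f * MacP om b).
  transitivity (cf f b); first by rewrite cf_toL.
  have Hf : hom e e f by apply: hom_toL.
  rewrite {1}(PeE (leqnn e) Hf) cf_sum; apply: eq_big_seq => om od.
  by rewrite cfZ (cf_MacP (leqnn e) od bd).
apply: eq_big_seq => om; rewrite mem_parts => /andP[_ /eqP so]; congr (_ * _).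
by rewrite so.
Qed.

Lemma Gam_Pe D N d E mu : mu \in parts d -> (d <= E)%N -> (E <= D)%N ->
  Gam D N (Pe D mu) = \sum_(om <- allp E) (tt_^-1 ^+ sumn om * u0 N d (skewP mu om)) *: Pe D om.
Proof.
move=> md dE ED; have dD := leq_trans dE ED; have /andP[Pm /eqP sm] : is_part mu && (sumn mu == d) by rewrite -mem_parts.
rewrite -(MacP_toL dD md) (Gam_toL tt_ N (MacP mu) dD dE) -!sum_allp.
apply: eq_bigr => e _; have eD : (e <= D)%N by apply: leq_trans ED; rewrite -ltnS.
rewrite [RHS](eq_big_seq (fun om => (tt_^-1 ^+ e * u0 N d (skewP mu om)) *: toL D e (MacP om))); last first.
  by move=> om od; rewrite (MacP_toL eD od); move: od; rewrite mem_parts => /andP[_ /eqP ->].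
rewrite -toL_lin; apply: eq_big_seq => be; rewrite mem_parts => /andP[Pb /eqP sb]; congr (_ *: _).
rewrite sb; under [RHS]eq_bigr do rewrite -mulrA.
rewrite -mulr_sumr; congr (_ * _).
transitivity (\sum_(al <- allp d) (\prod_(r <- al) tau N r) * \sum_(om <- parts e) skewP mu om al * MacP om be).
  apply: eq_big_seq => al; rewrite mem_allp => /andP[Pa _]; congr (_ * _).
  by rewrite -sb -(skewP_spec Pm Pa Pb) /coef2 sm.
under eq_bigr do rewrite mulr_sumr.
rewrite exchange_big; apply: eq_bigr => om _; rewrite u0E mulr_suml; apply: eq_bigr => al _.
by rewrite mulrA [_ * skewP _ _ _]mulrC.
Qed.

Lemma pc_nil D (f : {mpoly K[D]}) : pc [::] f = cf f [::].
Proof.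
rewrite /pc (Pe_nil D Kchar tt_neq0 qq_n1 tt_n1 qt_spec) /Bform /= !big_seq1.
have -> : cf (1 : {mpoly K[D]}) [::] = 1 by rewrite /cf mon_nil mcoeff1 eqxx.
have -> : zg qq tt_ [::] = 1 by rewrite /zg /zfac !big_nil mulr1.
by rewrite !mulr1 divr1.
Qed.

Lemma u0_Mac N d mu : mu \in parts d -> (size mu <= N)%N -> u0 N d (MacP mu) = PP qq tt_ tt_ N mu.
Proof.
move=> md sN; have /andP[Pm /eqP sm] : is_part mu && (sumn mu == d) by rewrite -mem_parts.
(* The truncation is at d + 1 instead of d because the recurrences need D > 0, even for empty mu. *)
rewrite -(Rf_0 qq tt_) -(@MM_Rf K d.+1 Kchar qq tt_ tt_neq0 qq_neq0 qq_n1 tt_n1 qt_spec qt_indep isT) ?sm ?leqnSn //.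
rewrite /MM pc_nil /cf mon_nil rmorphM /=.
have -> : (Phi d.+1 N)@_0 = 1.
  have := MM_nil d.+1 Kchar tt_neq0 qq_n1 tt_n1 qt_spec N.
  by rewrite /MM (Pe_nil d.+1 Kchar tt_neq0 qq_n1 tt_n1 qt_spec) rmorph1 mulr1 pc_nil /cf mon_nil.
rewrite mul1r -(MacP_toL (leqnSn d) md).
have := Gam_coef0 tt_ N (MacP mu) (leqnSn d); rewrite /cf mon_nil => ->.
rewrite u0E -sum_allp big_ord_recr /= big1 ?add0r // => k _; rewrite big1_seq // => rho /andP[_ rk].
have [M0 _] := MacP_family Pm; rewrite M0 ?mul0r // sm.
by move: rk; rewrite !mem_parts => /andP[-> /eqP ->] /=; rewrite neq_ltn ltn_ord.
Qed.

Lemma Phi_exp D N : Phi D N = \sum_(nu <- allp D) pc nu (Phi D N) *: Pe D nu.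
Proof.
rewrite -sum_allp [LHS]PhiE; apply: eq_bigr => k _; have kD : (k <= D)%N by rewrite -ltnS.
rewrite {1}(PeE kD (hom_Ph D Kchar qq tt_ N k)); apply: eq_big_seq => nu nk; congr (_ *: _).
move: nk; rewrite mem_parts => /andP[_ /eqP nk].
rewrite PhiE pc_sum (bigD1 k) //= [X in _ + X]big1 ?addr0 // => j jk.
by apply: (pc_hom0 qq tt_ (hom_Ph D Kchar qq tt_ N j)); rewrite nk.
Qed.

Lemma qtzE b la : qtz qq tt_ b la = qtpoch b la.
Proof. by apply: eq_bigr => i _. Qed.
Lemma cpzE la : cpz qq tt_ la = cprime la.
Proof. by []. Qed.

Lemma pc_Phi D N nu : (0 < D)%N -> is_part nu -> (sumn nu <= D)%N ->
  pc nu (Phi D N) = tt_ ^+ nfun nu * (qtpoch (qq * tt_ ^ (- N%:Z - 1)) nu / cprime nu).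
Proof.
move=> D0 Pn nD; rewrite -qtzE -cpzE -(Rf_mu0 tt_neq0 qq_neq0 qt_indep N Pn).
rewrite -(MM_Rf Kchar tt_neq0 qq_neq0 qq_n1 tt_n1 qt_spec qt_indep D0) //.
by rewrite /MM (Pe_nil D Kchar tt_neq0 qq_n1 tt_n1 qt_spec) rmorph1 mulr1.
Qed.

Lemma fLR_eq D la om nu : is_part la -> is_part om -> is_part nu ->
  (sumn la <= D)%N -> (sumn om <= D)%N -> (sumn nu <= D)%N ->
  pc la (Pe D nu * Pe D om) = fLR la om nu.
Proof.
move=> Pla Po Pn lD oD nD.
have [Ho _ _ _] := PeH oD (part_parts Po); have [Hn _ _ _] := PeH nD (part_parts Pn).
have [e|ne] := eqVneq (sumn la) (sumn om + sumn nu)%N.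
  have ld : la \in parts (sumn om + sumn nu) by rewrite mem_parts Pla e eqxx.
  have dD : (sumn om + sumn nu <= D)%N by rewrite -e.
  by rewrite (fLR_pc Po Pn dD ld) mulrC.
rewrite /fLR mem_parts (negbTE ne) andbF; apply: (pc_hom0 qq tt_ (homM Hn Ho)) => //.
by rewrite addnC eq_sym.
Qed.

(** The sums in the statement stop at the size |la|: larger om or nu contribute only in degrees
    above |la|, which [pc la] does not see. *)
Lemma LHS_MM D N la mu : is_part la -> is_part mu -> (sumn la + sumn mu < D)%N ->
  \sum_(k < (sumn la).+1) \sum_(om <- parts k)
   \sum_(k' < (sumn la).+1) \sum_(nu <- parts k')
     tt_ ^ ((nfun nu)%:Z - (sumn om)%:Z) * fLR la om nu
     * u0 N (sumn mu) (skewP mu om)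
     * (qtpoch (qq * tt_ ^ (- N%:Z - 1)) nu / cprime nu) = MM D qq tt_ N la mu.
Proof.
move=> Pla Pm lD; rewrite /MM (@Gam_Pe D N (sumn mu) (sumn la + sumn mu) mu) ?leq_addl ?part_parts //; last exact: ltnW.
rewrite mulr_sumr pc_sum sum_allp.
have l1 : (sumn la <= sumn la + sumn mu)%N by rewrite leq_addr.
have l2 : (sumn la <= D)%N by apply: leq_trans l1 (ltnW lD).
rewrite (allp_resize l1) => [|om Po lo oE]; last first.
  have oD := leq_trans oE (ltnW lD); have [Ho _ _ _] := PeH oD (part_parts Po).
  rewrite -scalerAr pcZ Phi_exp mulr_suml pc_sum big1_seq ?mulr0 // => nu /andP[_]; rewrite mem_allp => /andP[Pn nD].
  have [Hn _ _ _] := PeH nD (part_parts Pn).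
  rewrite -scalerAl pcZ (pc_hom0 qq tt_ (homM Hn Ho)) ?mulr0 //.
  by move: lo; clear; lia.
apply: eq_big_seq => om; rewrite mem_allp => /andP[Po ol].
have oD := leq_trans ol l2; have [Ho _ _ _] := PeH oD (part_parts Po).
rewrite -scalerAr pcZ {1}Phi_exp mulr_suml pc_sum (allp_resize l2) => [|nu Pn ln nD]; last first.
  have [Hn _ _ _] := PeH nD (part_parts Pn).
  rewrite -scalerAl pcZ (pc_hom0 qq tt_ (homM Hn Ho)) ?mulr0 //.
  by move: ln; clear; lia.
rewrite sum_allp mulr_sumr; apply: eq_big_seq => nu; rewrite mem_allp => /andP[Pn nl].
have nD := leq_trans nl l2.
rewrite -scalerAl pcZ fLR_eq // pc_Phi //; last exact: leq_ltn_trans lD.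
rewrite expz_sub ?tt_neq0 // exprVn.
set a := qtpoch _ _ / _; move: a => a; ring.
Qed.
End Assembly.

Theorem theorem2p1 (m n : nat) (la mu : seq nat) :
  (m <= n)%N -> is_part la -> is_part mu ->
  (size la <= m)%N -> (size mu <= n)%N ->
  \sum_(k < (sumn la).+1) \sum_(om <- parts k)
   \sum_(k' < (sumn la).+1) \sum_(nu <- parts k')
     tt_ ^ ((nfun nu)%:Z - (sumn om)%:Z) * fLR la om nu
     * u0 (n - m) (sumn mu) (skewP mu om)
     * (qtpoch (qq * tt_ ^ (m%:Z - n%:Z - 1)) nu / cprime nu)
  =
  tt_ ^ ((nfun la)%:Z - (m * sumn mu)%:Z) * u0 n (sumn mu) (MacP mu)
  * (qtpoch (qq * tt_ ^ (m%:Z - 1)) la / cprime la)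
  * \prod_(i < m) \prod_(j < n)
      (qpoch (qq * tt_ ^ (j%:Z - i%:Z + m%:Z - n%:Z - 1)) qq
             ((nth 0 la i)%:Z - (nth 0 mu j)%:Z)
       / qpoch (qq * tt_ ^ (j%:Z - i%:Z + m%:Z - n%:Z)) qq
             ((nth 0 la i)%:Z - (nth 0 mu j)%:Z)).
Proof.
move=> mn Pla Pm lm sn; set N := (n - m)%N.
have nE : n = (m + N)%N by rewrite subnKC.
have -> : m%:Z - n%:Z = - N%:Z by rewrite nE; clear; lia.
clearbody N; rewrite nE in sn *; clear mn nE.
(* Any truncation above |la| + |mu| would do; this one is also positive when both partitions are
   empty. *)
rewrite (@LHS_MM (sumn la + sumn mu).+1) //.
rewrite (MM_Rf Kchar tt_neq0 qq_neq0 qq_n1 tt_n1 qt_spec qt_indep (ltn0Sn _) Pla Pm lm sn) ?leqW ?leq_addr ?leq_addl //.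
rewrite (Rf_expl tt_neq0 qq_neq0 qt_indep) // -(@u0_Mac _ (sumn mu)) ?part_parts // qtzE cpzE; congr (_ * _).
apply: eq_bigr => i _; apply: eq_bigr => j _; rewrite /gz.
have -> : j%:Z - i%:Z + m%:Z - (m + N)%N%:Z = j%:Z - i%:Z - N%:Z by clear; lia.
by [].
Qed.
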